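(* Let $K\in\mathbb{R}^{d\times d}$ be symmetric and $\mu_x,\mu_y>0$. Let $(z_n)_{n\ge0}$, $z_n=(x_n,y_n)$, be the sequence initialized at an arbitrary $z_0=(x_0,y_0)$ and generated by SAPD with $\tau=\frac{1-\theta}{\theta\mu_x}$, $\sigma=\frac{1-\theta}{\theta\mu_y}$ (with $\theta<1$ sufficiently close to $1$) on the quadratic problem $$\min_{x\in\mathbb{R}^d}\max_{y\in\mathbb{R}^d}\ \frac{\mu_x}2\|x\|^2+\langle Kx,y\rangle-\frac{\mu_y}2\|y\|^2,$$ whose saddle point is $z^\star=(0,0)$, where the gradient noise sequences $(\omega_k^x)_{k\ge0}$, $(\omega_k^y)_{k\ge0}$ are i.i.d. centered Gaussian, independent of each other, with covariance $\frac{\delta^2}dI_d$, $\delta>0$. Then $(z_n)_{n\ge0}$ converges in distribution to a Gaussian vector $z_\infty$. Furthermore, for any $p\in(0,1)$, the $p$-th quantile $Q_p(\|z_\infty-z^\star\|^2)$ admits the bounds $$\psi_1(p,\theta)\le Q_p(\|z_\infty-z^\star\|^2)\le\psi_2(p,\theta),$$ for some functions $\psi_1,\psi_2$ with $\psi_1(p,\theta)=(1-\theta)\log(1/(1-p))\,\Theta(1)$ and $\psi_2(p,\theta)=(1-\theta)\,\mathcal{O}(1+\log(1/(1-p)))$ as $\theta\to1$.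
   Context: SAPD on this problem: given $(x_0,y_0)\in\mathbb{R}^d\times\mathbb{R}^d$, let $\tilde\nabla_y\Phi_k=Kx_k+\omega_k^y$, $\tilde q_0=0$, and for $k\ge0$: $y_{k+1}=\frac1{1+\sigma\mu_y}\big(y_k+\sigma(\tilde\nabla_y\Phi_k+\theta\tilde q_k)\big)$, $x_{k+1}=\frac1{1+\tau\mu_x}\big(x_k-\tau(K^\top y_{k+1}+\omega_k^x)\big)$, $\tilde q_{k+1}=\tilde\nabla_y\Phi_{k+1}-\tilde\nabla_y\Phi_k$. $Q_p(U)=\inf\{t\in\mathbb{R}:\mathbb{P}[U\le t]\ge p\}$. $h=\Theta(1)$ means $h=\mathcal{O}(1)$ and $1=\mathcal{O}(h)$. *)

(* Defs.v *)
From HB Require Import structures.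
From mathcomp Require Import all_boot all_order all_algebra.
From mathcomp Require Import all_classical all_reals all_analysis.

Set Implicit Arguments.
Unset Strict Implicit.
Unset Printing Implicit Defensive.

Import Order.TTheory GRing.Theory Num.Theory.
Import numFieldNormedType.Exports.

Local Open Scope classical_set_scope.
Local Open Scope ring_scope.

Section Problem.
Context {R : realType} {d : nat}.
Implicit Types (K : 'M[R]_d) (x y : 'cV[R]_d).

Definition dotp n (u v : 'cV[R]_n) : R := \sum_(i < n) u i 0 * v i 0.

(* Squared Euclidean norm; the library norm on matrices is the max norm. *)
Definition sqnorm n (u : 'cV[R]_n) : R := dotp u u.

Definition objective K (mux muy : R) x y : R :=
  mux / 2 * sqnorm x + dotp (K *m x) y - muy / 2 * sqnorm y.

Definition saddle_point (L : 'cV[R]_d -> 'cV[R]_d -> R) xs ys : Prop :=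
  forall x y, L xs y <= L xs ys /\ L xs ys <= L x ys.

(* The state after k steps is (x_k, y_k, q_k); wx and wy are one realization of
   the noise sequences. *)
Fixpoint sapd K (mux muy tau sigma theta : R) (wx wy : nat -> 'cV[R]_d) x0 y0
    (k : nat) : 'cV[R]_d * 'cV[R]_d * 'cV[R]_d :=
  match k with
  | 0%N => (x0, y0, 0)
  | j.+1 =>
    let: (x, y, q) := sapd K mux muy tau sigma theta wx wy x0 y0 j in
    let g := K *m x + wy j in
    let y' := (1 + sigma * muy)^-1 *: (y + sigma *: (g + theta *: q)) in
    let x' := (1 + tau * mux)^-1 *: (x - tau *: (K^T *m y' + wx j)) in
    (x', y', (K *m x' + wy j.+1) - g)
  end.

Definition sapd_z K (mux muy tau sigma theta : R) (wx wy : nat -> 'cV[R]_d)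
    x0 y0 (k : nat) : 'cV[R]_(d + d) :=
  let s := sapd K mux muy tau sigma theta wx wy x0 y0 k in
  col_mx s.1.1 s.1.2.

End Problem.

Section RandomVectors.
Context {R : realType}.

Definition borel n : set (set 'cV[R]_n) := <<s [set U | open U] >>.

Definition random_vector disp (T : measurableType disp) n (X : T -> 'cV[R]_n) :=
  forall B, borel B -> measurable (X @^-1` B).

(* N(m, v) on the line for v >= 0; the case v = 0 is separate because
   [normal_prob m 0] is not the point mass at m. *)
Definition gaussian1 (m v : R) (A : set R) : \bar R :=
  if v == 0 then \d_m A else normal_prob m (Num.sqrt v) A.

(* X has law N(m, S), where S may be singular: each linear form <u, X> has law
   N(<u, m>, <u, S u>). *)
Definition gaussian disp (T : measurableType disp) (P : probability T R) n
    (X : T -> 'cV[R]_n) (m : 'cV[R]_n) (S : 'M[R]_n) : Prop :=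
  [/\ random_vector X,
      S^T = S,
      forall u, 0 <= dotp u (S *m u)
    & forall (u : 'cV[R]_n) (A : set R), measurable A ->
        P ((fun w => dotp u (X w)) @^-1` A)
        = gaussian1 (dotp u m) (dotp u (S *m u)) A].

Definition mutually_independent disp (T : measurableType disp)
    (P : probability T R) (I : eqType) n (X : I -> T -> 'cV[R]_n) : Prop :=
  forall (s : seq I) (B : I -> set 'cV[R]_n), uniq s ->
    (forall i, i \in s -> borel (B i)) ->
    P (\bigcap_(i in [set` s]) (X i @^-1` B i))
    = (\prod_(i <- s) P (X i @^-1` B i))%E.

(* The two sequences are i.i.d. with law N(0, (delta^2 / d) I_d) and independent
   of each other, that is, all vectors of both sequences form one mutually
   independent family. *)
Definition gaussian_noise disp (T : measurableType disp) (P : probability T R)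
    d (delta : R) (wx wy : nat -> T -> 'cV[R]_d) : Prop :=
  [/\ forall k, gaussian P (wx k) 0 (delta ^+ 2 / d%:R)%:M,
      forall k, gaussian P (wy k) 0 (delta ^+ 2 / d%:R)%:M
    & mutually_independent P
        (fun i : nat + nat => match i with inl k => wx k | inr k => wy k end)].

Definition cvg_in_distribution disp (T : measurableType disp)
    (P : probability T R) disp' (T' : measurableType disp')
    (P' : probability T' R) n (X : nat -> T -> 'cV[R]_n) (Y : T' -> 'cV[R]_n) :=
  forall f : 'cV[R]_n -> R, continuous f -> (exists M, forall x, `|f x| <= M) ->
    ('E_P[fun w => f (X k w)] @[k --> \oo] --> 'E_P'[fun w => f (Y w)])%E.

Definition quantile disp (T : measurableType disp) (P : probability T R)
    (p : R) (U : T -> R) : R :=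
  inf [set t : R | (p%:E <= P [set w | (U w <= t)%R])%E].

End RandomVectors.

(* The filter on pairs (p, theta) for which "near" means: for all theta < 1
   close enough to 1, uniformly in p in ]0, 1[. *)
Definition theta_to_1 (R : realType) : set_system (R * R) :=
  filter_prod (globally `]0, 1[) (1^'-).
Arguments theta_to_1 {R}.

Canonical theta_to_1_filter (R : realType) :=
  FilterType (@theta_to_1 R) (filter_prod_filter _ _).

(* Main.v *)
Require Import Defs.
From HB Require Import structures.
From mathcomp Require Import all_boot all_order all_algebra.
From mathcomp Require Import all_classical all_reals all_analysis.
From mathcomp Require Import measurable_realfun.
From mathcomp Require Import ring lra.

Set Implicit Arguments.
Unset Strict Implicit.
Unset Printing Implicit Defensive.

Import Order.TTheory GRing.Theory Num.Theory.
Import numFieldNormedType.Exports.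

Local Open Scope classical_set_scope.
Local Open Scope ring_scope.

(** Write e = 1 - theta and work in the coordinates X = sqrt(mux) x and
Y = sqrt(muy) y, with N = K / sqrt(mux muy). For the prescribed step sizes the
momentum term q can be eliminated, and the iterates Z = (X, Y) satisfy a linear
recursion Z_(k+2) = D Z_(k+1) + E0 w_(k+1) + E1 w_k ([sapd_step]), where w_k
stacks the two gradient noises and D = (1 - e) + e (1 - e) J + O(e^2) with
J = (0, -N; N, 0). As K is symmetric, J is antisymmetric: a vector u is
orthogonal to J u, so 1 + e J changes its length by O(e^2) only, and the
length of D^T u lies between (1 - 2 e) |u| and (1 - e / 2) |u| for small e
([near_rotation_bounds]).

The vector V_k = Z_(k+1) - E0 w_k follows the autoregression
V_(k+1) = D V_k + G w_k with G = D E0 + E1. Hence each linear form of Z_(n+2) is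
a constant plus a linear form of independent Gaussian noises
([dotp_moving_average]); it is Gaussian, its mean tends to 0 geometrically, and
its variance tends to that of the stationary law. Convergence of the
means and variances of all linear forms gives convergence in distribution
([cramer_wold]): on a large box a bounded continuous function is uniformly close
to a trigonometric polynomial, obtained from Bernstein polynomials in the
sines of the coordinates, Gaussian tails control the complement of the box, and
the expectation of cos (c + <u, Z>) depends continuously on the mean and the
variance of <u, Z>.

With v = delta^2 / d, the limit covariance is v B, where B is, up to the fixed
change of coordinates, the sum of E0 E0^T and of the series of the
D^j G G^T (D^T)^j. One has G = e (diag (-1, 1) + O(e)) in the rescaled noise, so
|G^T u| is of exact order e |u|; the sum of e^2 times a geometric series of ratio
1 - Theta(e) is of exact order e, whence lam e <= B <= Lam e with lam and
Lam independent of e ([stationary_bounds], [sapd_limit_law]).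

A vector with the limit law is zinf = L w_0, where L L^T = B ([cholesky]).
For the lower bound on the quantiles, |zinf|^2 >= lam e |w_0|^2
>= lam e v (g1^2 + g2^2), where g1 and g2 are independent standard Gaussian
variables, one coordinate of each of the two noises; and
P(g1^2 + g2^2 <= t) <= 1 - exp (-7 t) ([gaussian_pair_ball_le]) says precisely that
the p-quantile of g1^2 + g2^2 is at least log (1 / (1 - p)) / 7. Two coordinates
are needed: the p-quantile of a single squared Gaussian variable is of order p^2,
not p, as p tends to 0. The upper bound is a union bound over the 2 d
coordinates ([gaussian_sqnorm_quantile_le]). *)

(** * Gaussian laws on the line *)

Lemma bounded_integrable d (T : measurableType d) (R : realType)
    (P : probability T R) (f : T -> R) (C : R) :
  measurable_fun setT f -> (forall x, `|f x| <= C) ->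
  P.-integrable setT (EFin \o f).
Proof.
move=> mf fC; apply: (@le_integrable _ _ _ _ _ _ _ (EFin \o cst C)) => //.
- exact/measurable_EFinP.
- by move=> x _ /=; rewrite lee_fin (le_trans (fC x)) ?ler_norm.
- exact: finite_measure_integrable_cst.
Qed.

Lemma lebesgue_measure_affine (R : realType) (m s : R) (A : set R) :
  0 < s -> measurable A ->
  lebesgue_measure [set x : R | A (m + s * x)]
  = (s^-1%:E * lebesgue_measure A)%E.
Proof.
move=> s0 mA.
pose phi (x : measurableTypeR R) : measurableTypeR R := m + s * x.
have mphi : measurable_fun setT phi.
  by apply: measurable_funD => //; apply: measurable_funM.
have s_ge0 : 0 <= s by exact: ltW.
pose nu0 := mscale (NngNum s_ge0) (pushforward lebesgue_measure phi).
pose nu := nu0 mphi.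
have nuE : lebesgue_measure A = nu A.
  apply: (lebesgue_measure_unique (mu := nu)) => // X [[a b] _ <-].
  rewrite -[RHS]/(s%:E * lebesgue_measure (phi @^-1` `]a, b]))%E.
  have -> : phi @^-1` `]a, b] = `](a - m) / s, (b - m) / s]%classic.
    apply/seteqP; split => x /=; rewrite !in_itv/= ltr_pdivrMr// ler_pdivlMr//;
    rewrite ltrBlDr lerBrDr /phi (mulrC x) (addrC m) //.
  rewrite !lebesgue_measure_itv/= !lte_fin ltr_pM2r ?invr_gt0// ltrD2r.
  case: ifP => _; last by rewrite mule0.
  rewrite -EFinB -EFinM; congr EFin; field.
  by rewrite gt_eqF.
by rewrite nuE /nu /mscale/= muleA -EFinM mulVf ?gt_eqF// mul1e.
Qed.

(** The change of variables is in terms of the Radon-Nikodym derivative of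
[normal_prob], which agrees with [normal_pdf] almost everywhere only. *)
Lemma integral_normal_prob (R : realType) (m s : R) (f : R -> R) :
  measurable_fun setT f -> (forall x, 0 <= f x <= 1) ->
  (\int[normal_prob m s]_x (f x)%:E
   = \int[lebesgue_measure]_x (f x * normal_pdf m s x)%:E)%E.
Proof.
move=> mf f01.
have finf : (normal_prob m s).-integrable setT (EFin \o f).
  apply: (@bounded_integrable _ _ _ _ _ 1) => // x.
  by have /andP[f0 f1] := f01 x; rewrite ger0_norm.
transitivity (\int[lebesgue_measure]_x ((f x)%:E * (normal_pdf m s x)%:E))%E; last by [].
rewrite -(Radon_Nikodym_change_of_variables (normal_prob_dominates m s))//=.
apply: ae_eq_integral => //.
- apply: emeasurable_funM => //; first exact/measurable_EFinP.
  apply: (measurable_int lebesgue_measure).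
  by apply: Radon_Nikodym_integrable; exact: normal_prob_dominates.
- apply: emeasurable_funM => //=; first exact/measurable_EFinP.
  by apply/measurableT_comp => //=; exact: measurable_normal_pdf.
- apply: ae_eqe_mul2l => /=.
  rewrite Radon_NikodymE//=; first exact: normal_prob_dominates.
  move=> abmu; case: cid => /= h [h1 h2 h3].
  apply: integral_ae_eq => //=.
  + by apply/measurableT_comp =>//; exact: measurable_normal_pdf.
  + by move=> E E01 mE; rewrite -h3.
Qed.

(** Covers the point masses and the laws with a density at once, so that later
arguments need not separate the two cases of [gaussian1]. *)
Lemma gaussian1E (R : realType) (m v : R) (A : set R) :
  0 <= v -> measurable A ->
  gaussian1 m v A = normal_prob 0 1 [set x | A (m + Num.sqrt v * x)].
Proof.
move=> v0 mA; rewrite /gaussian1; have [->|vn0] := eqVneq v 0.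
  rewrite sqrtr0 /dirac indicE; have [Am|Am] := boolP (m \in A).
    rewrite (_ : [set x | _] = setT) ?probability_setT//.
    by apply/seteqP; split => x //= _; rewrite mul0r addr0; exact/set_mem.
  rewrite (_ : [set x | _] = set0) ?measure0//.
  apply/seteqP; split => x //=; rewrite mul0r addr0 => mA'.
  by rewrite mem_set in Am.
set s := Num.sqrt v; have s0 : 0 < s by rewrite sqrtr_gt0 lt_neqAle eq_sym vn0.
have sn0 : s != 0 by rewrite gt_eqF.
have s_ge0 : 0 <= s^-1 by rewrite invr_ge0 ltW.
pose phi (x : measurableTypeR R) : measurableTypeR R := m + s * x.
have mphi : measurable_fun setT phi.
  by apply: measurable_funD => //; apply: measurable_funM.
rewrite /normal_prob.
pose h (y : R) := (s * normal_pdf m s y)%:E.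
have mh : measurable_fun setT h.
  by apply/measurable_EFinP/measurable_funM => //; exact: measurable_normal_pdf.
have h0 y : (0 <= h y)%E by rewrite lee_fin mulr_ge0 ?normal_pdf_ge0// ltW.
transitivity (\int[lebesgue_measure]_(x in phi @^-1` A) (h \o phi) x)%E; last first.
  apply: eq_integral => x _; rewrite /h /= !normal_pdfE ?oner_eq0//; congr EFin.
  rewrite /normal_peak /normal_fun /phi subr0 addrC addKr.
  rewrite mulrA expr1n mul1r -mulrnAr sqrtrM ?sqr_ge0// sqrtr_sqr.
  rewrite gtr0_norm// invfM mulrA divff// mul1r; congr (_ * expR _).
  by field.
rewrite -(ge0_integral_pushforward mphi)//; last exact: measurable_funTS.
rewrite [RHS](eq_measure_integral (mscale (NngNum s_ge0) lebesgue_measure)); last first.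
  by move=> B mB _; rewrite /mscale/= /pushforward lebesgue_measure_affine.
rewrite ge0_integral_mscale//; last exact: measurable_funTS.
rewrite /= -ge0_integralZl//; last first.
  exact: measurable_funTS.
apply: eq_integral => x _; rewrite /h -EFinM; congr EFin.
by rewrite mulrA mulVf// mul1r.
Qed.

(** Completing the square in [x]: the joint density of a Gaussian variable and of
its sum with an independent one factors as marginal times conditional. *)
Lemma normal_pdf_mul (R : realType) (m s1 s2 x y : R) : 0 < s1 -> 0 < s2 ->
  let t := Num.sqrt (s1 ^+ 2 + s2 ^+ 2) in
  normal_pdf m s1 x * normal_pdf x s2 y
  = normal_pdf m t y
    * normal_pdf ((m * s2 ^+ 2 + y * s1 ^+ 2) / t ^+ 2) (s1 * s2 / t) x.
Proof.
move=> s10 s20 t.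
have t2 : t ^+ 2 = s1 ^+ 2 + s2 ^+ 2 by rewrite sqr_sqrtr// addr_ge0// sqr_ge0.
have t0 : 0 < t by rewrite sqrtr_gt0 addr_gt0// exprn_gt0.
have tn0 : s1 ^+ 2 + s2 ^+ 2 != 0 by rewrite -t2 sqrf_eq0 gt_eqF.
rewrite !normal_pdfE ?gt_eqF ?divr_gt0 ?mulr_gt0// /normal_fun /normal_peak.
rewrite mulrACA [RHS]mulrACA -!expRD; congr (_ * expR _).
  have h (s : R) : 0 <= s ^+ 2 * pi *+ 2.
    by rewrite mulrn_wge0// mulr_ge0 ?sqr_ge0 ?pi_ge0.
  rewrite -!invfM -!sqrtrM ?h//.
  congr (Num.sqrt _)^-1; rewrite exprMn exprVn exprMn t2.
  by field.
rewrite !exprMn !exprVn t2; field.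
by rewrite !gt_eqF// -t2 exprn_gt0.
Qed.

Lemma measurable_normal_pdf2 (R : realType) (s : R) : s != 0 ->
  measurable_fun setT (fun z : R * R => normal_pdf z.1 s z.2).
Proof.
move=> s0; rewrite (_ : (fun z : R * R => _)
  = fun z : R * R => normal_peak s * normal_fun 0 s (z.2 - z.1)); last first.
  by apply/funext => z; rewrite normal_pdfE// /normal_fun subr0.
apply: measurable_funM => //.
apply: (measurableT_comp (measurable_normal_fun 0 s)).
by apply: measurable_funB.
Qed.

(** By Tonelli, the density of the mixture at [y] is the integral in [x] of the
product in [normal_pdf_mul]; its second factor integrates to 1. *)
Lemma normal_prob_conv (R : realType) (m s1 s2 : R) (A : set R) :
  0 < s1 -> 0 < s2 -> measurable A ->
  (\int[normal_prob m s1]_x normal_prob x s2 A)%E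
  = normal_prob m (Num.sqrt (s1 ^+ 2 + s2 ^+ 2)) A.
Proof.
move=> s10 s20 mA; set t := Num.sqrt _.
have mpdf := @measurable_normal_pdf2 R s2 (lt0r_neq0 s20).
have pA x : normal_prob x s2 A
    = (\int[lebesgue_measure]_y (\1_A y * normal_pdf x s2 y)%:E)%E.
  rewrite /normal_prob [LHS]integral_mkcond; apply: eq_integral => y _.
  by rewrite patchE indicE; case: (y \in A); rewrite ?mul1r ?mul0r.
pose f (z : R * R) := (\1_A z.2 * normal_pdf z.1 s2 z.2)%:E.
have mf : measurable_fun setT f.
  apply/measurable_EFinP/measurable_funM => //.
  by apply: measurableT_comp => //; exact: measurable_indic.
have f0 z : (0 <= f z)%E by rewrite lee_fin mulr_ge0 ?normal_pdf_ge0.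
have mF : measurable_fun setT (fun x => normal_prob x s2 A).
  rewrite (_ : (fun x => _) = fubini_F lebesgue_measure f).
    exact: measurable_fun_fubini_tonelli_F.
  by apply/funext => x; rewrite pA.
have finF x : normal_prob x s2 A \is a fin_num by exact: fin_num_measure.
transitivity (\int[normal_prob m s1]_x (fine (normal_prob x s2 A))%:E)%E.
  by apply: eq_integral => x _; rewrite fineK.
rewrite integral_normal_prob; last 2 first.
  exact: measurableT_comp.
  move=> x; rewrite fine_ge0//= -lee_fin fineK//; exact: probability_le1.
pose g (z : R * R) := (f z * (normal_pdf m s1 z.1)%:E)%E.
have mg : measurable_fun setT g.
  apply: emeasurable_funM => //; apply/measurable_EFinP.
  by apply: measurableT_comp => //; exact: measurable_normal_pdf.
have g0 z : (0 <= g z)%E by apply: mule_ge0 => //; rewrite lee_fin normal_pdf_ge0.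
transitivity (\int[lebesgue_measure]_x \int[lebesgue_measure]_y g (x, y))%E.
  apply: eq_integral => x _; rewrite EFinM fineK// pA /g/=.
  rewrite ge0_integralZr//; last 2 first.
  - apply/measurable_EFinP/measurable_funM; first exact: measurable_indic.
    exact: measurable_normal_pdf.
  - by rewrite lee_fin normal_pdf_ge0.
transitivity (\int[lebesgue_measure]_y \int[lebesgue_measure]_x g (x, y))%E.
  exact: fubini_tonelli.
rewrite /normal_prob [RHS]integral_mkcond; apply: eq_integral => y _.
pose mu := (m * s2 ^+ 2 + y * s1 ^+ 2) / t ^+ 2; pose s := s1 * s2 / t.
transitivity (\int[lebesgue_measure]_x
   ((\1_A y * normal_pdf m t y)%:E * (normal_pdf mu s x)%:E))%E.
  apply: eq_integral => x _; rewrite /g /f/= -!EFinM; congr EFin.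
  by rewrite -mulrA (mulrC (normal_pdf x s2 y)) normal_pdf_mul// mulrA.
rewrite ge0_integralZl//; last 3 first.
- by apply/measurable_EFinP; exact: measurable_normal_pdf.
- by move=> x _; rewrite lee_fin normal_pdf_ge0.
- by rewrite lee_fin mulr_ge0 ?normal_pdf_ge0.
rewrite integral_normal_pdf mule1 patchE indicE.
by case: (y \in A); rewrite ?mul1r ?mul0r.
Qed.

Lemma gaussian1_conv (R : realType) (m v1 v2 : R) (A : set R) :
  0 <= v1 -> 0 <= v2 -> measurable A ->
  (\int[normal_prob 0 1]_x gaussian1 (m + Num.sqrt v1 * x) v2 A)%E
  = gaussian1 m (v1 + v2) A.
Proof.
move=> v10 v20 mA.
have [->|v1n0] := eqVneq v1 0.
  rewrite add0r sqrtr0; under eq_integral do rewrite mul0r addr0.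
  rewrite gaussian1E// integral_cst//= probability_setT mule1//.
have mphi : measurable_fun setT
    (fun x : R => m + Num.sqrt v1 * x : measurableTypeR R).
  by apply: measurable_funD => //; apply: measurable_funM.
have [->|v2n0] := eqVneq v2 0.
  rewrite addr0 gaussian1E//.
  transitivity (\int[normal_prob 0 1]_x
      (\1_[set x | A (m + Num.sqrt v1 * x)] x)%:E)%E; last first.
    rewrite integral_indic ?setIT//.
    by rewrite -[X in measurable X]setTI; exact: mphi.
  apply: eq_integral => x _; rewrite /gaussian1 eqxx /dirac !indicE; congr (_%:R%:E).
have s10 : 0 < Num.sqrt v1 by rewrite sqrtr_gt0 lt_neqAle eq_sym v1n0.
have s20 : 0 < Num.sqrt v2 by rewrite sqrtr_gt0 lt_neqAle eq_sym v2n0.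
transitivity (\int[normal_prob m (Num.sqrt v1)]_x normal_prob x (Num.sqrt v2) A)%E;
  last first.
  rewrite normal_prob_conv// !sqr_sqrtr// /gaussian1 gt_eqF//.
  by rewrite -(sqr_sqrtr v10) -(sqr_sqrtr v20) addr_gt0// exprn_gt0.
have mF : measurable_fun setT (fun x => normal_prob x (Num.sqrt v2) A).
  rewrite (_ : (fun x => _) = fun x => normal_prob 0 1
     (xsection [set z : R * R | A (z.1 + Num.sqrt v2 * z.2)] x)).
    apply: measurable_fun_xsection.
    rewrite -[X in measurable X]setTI.
    have : measurable_fun setT (fun z : R * R => z.1 + Num.sqrt v2 * z.2).
      by apply: measurable_funD => //; apply: measurable_funM.
    exact.
  apply/funext => x; have := @gaussian1E R x v2 A v20 mA.
  rewrite /gaussian1 (negbTE v2n0) => ->; congr (normal_prob 0 1 _).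
  by apply/seteqP; split => y; rewrite /xsection/= ?inE//= => /set_mem.
rewrite [RHS](eq_measure_integral (pushforward (normal_prob 0 1)
    (fun x : R => m + Num.sqrt v1 * x : measurableTypeR R))); last first.
  move=> B mB _; have := @gaussian1E R m v1 B v10 mB.
  by rewrite /gaussian1 (negbTE v1n0) => h; exact: h.
rewrite ge0_integral_pushforward//.
by apply: eq_integral => x _; rewrite /gaussian1 (negbTE v2n0).
Qed.

(** * Sums of independent Gaussian variables *)

(** Degenerate laws belong to the class: a linear form of the noise may vanish. *)
Definition gaussian_rv d (T : measurableType d) (R : realType)
    (P : probability T R) (X : T -> R) (m v : R) : Prop :=
  [/\ measurable_fun setT X, 0 <= v
    & forall A : set R, measurable A -> P (X @^-1` A) = gaussian1 m v A].

Lemma measurable_preimage d (T : measurableType d) (R : realType)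
    (X : T -> R) (A : set R) :
  measurable_fun setT X -> measurable A -> measurable (X @^-1` A).
Proof. by move=> mX mA; rewrite -[X in measurable X]setTI; exact: mX. Qed.

Lemma measurable_affine (R : realType) (m s : R) :
  measurable_fun setT (fun x : measurableTypeR R => m + s * x : measurableTypeR R).
Proof. by apply: measurable_funD => //; apply: measurable_funM. Qed.

(** Expresses integrals against the law of [X] on a fixed probability space, where
dominated convergence in [m] and [v] applies. *)
Lemma gaussian_rv_integral d (T : measurableType d) (R : realType)
    (P : probability T R) (X : T -> R) (m v : R) (g : R -> R) (C : R) :
  gaussian_rv P X m v -> measurable_fun setT g -> (forall x, `|g x| <= C) ->
  (\int[P]_w (g (X w))%:E
   = \int[normal_prob 0 1]_x (g (m + Num.sqrt v * x))%:E)%E.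
Proof.
move=> [mX v0 lX] mg gC.
have mX' : measurable_fun setT (X : T -> measurableTypeR R) by [].
have mphi := @measurable_affine R m (Num.sqrt v).
have mg' : measurable_fun setT (EFin \o g : measurableTypeR R -> \bar R).
  exact/measurable_EFinP.
have i1 : P.-integrable (X @^-1` setT) ((EFin \o g) \o X).
  rewrite preimage_setT.
  apply: (@bounded_integrable _ _ _ P (g \o X) C) => [|w]; last exact: gC.
  exact: measurableT_comp.
have i2 : (normal_prob 0 1).-integrable
    ((fun x : measurableTypeR R => m + Num.sqrt v * x : measurableTypeR R) @^-1` setT)
    ((EFin \o g) \o (fun x : measurableTypeR R => m + Num.sqrt v * x)).
  rewrite preimage_setT.
  apply: (@bounded_integrable _ _ _ (normal_prob 0 1)
    (g \o (fun x => m + Num.sqrt v * x)) C) => [|w]; last exact: gC.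
  exact: measurableT_comp.
have := integral_pushforward mX' mg' i1 measurableT; rewrite preimage_setT => <-.
have := integral_pushforward mphi mg' i2 measurableT; rewrite preimage_setT => <-.
apply: eq_measure_integral => A mA _.
by have := lX A mA; rewrite gaussian1E// => h; exact: h.
Qed.

Lemma gaussian1_translate (R : realType) (m v x : R) (A : set R) :
  0 <= v -> measurable A ->
  gaussian1 m v [set y | A (x + y)] = gaussian1 (x + m) v A.
Proof.
move=> v0 mA; rewrite !gaussian1E//.
  by congr (normal_prob 0 1 _); apply/seteqP; split => y /=; rewrite addrA.
by apply: (@measurable_preimage _ _ _ (fun y => x + y)) => //; apply: measurable_funD.
Qed.

Section sum_of_independent.
Context d (T : measurableType d) (R : realType) (P : probability T R).
Variables (X Y : T -> R) (mX : measurable_fun setT X) (mY : measurable_fun setT Y).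

Let mX' : measurable_fun setT (X : T -> measurableTypeR R) := mX.
Let mY' : measurable_fun setT (Y : T -> measurableTypeR R) := mY.
Let X' : {mfun T >-> measurableTypeR R} := HB.pack X (isMeasurableFun.Build _ _ _ _ _ mX').
Let Y' : {mfun T >-> measurableTypeR R} := HB.pack Y (isMeasurableFun.Build _ _ _ _ _ mY').

(** A finite measure on the plane is determined by its values on rectangles. The
event [E] carries the variables that are not summed in the
induction for families. *)
Lemma indep_joint_law (E : set T) : measurable E ->
  (forall A B : set R, measurable A -> measurable B ->
    P (X @^-1` A `&` Y @^-1` B `&` E) = (P (X @^-1` A) * P (Y @^-1` B) * P E)%E) ->
  forall Z : set (measurableTypeR R * measurableTypeR R), measurable Z ->
    P ((fun w => (X w, Y w)) @^-1` Z `&` E)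
    = (P E * (distribution P X' \x distribution P Y') Z)%E.
Proof.
move=> mE ind Z mZ.
have mXY : measurable_fun setT (fun w => (X w, Y w)).
  exact/measurable_fun_pair.
pose nu0 : {measure set _ -> \bar R} :=
  pushforward (mrestr P mE) (fun w => (X' w, Y' w)).
pose nu := nu0 mXY.
have PE : P E \is a fin_num by exact: fin_num_measure.
have PE0 : 0 <= fine (P E) by exact: fine_ge0.
pose muX := mscale (NngNum PE0) (distribution P X').
have -> : P ((fun w => (X w, Y w)) @^-1` Z `&` E) = nu Z by [].
rewrite -(@product_measure_unique _ _ _ _ _ muX (distribution P Y') nu)//.
  rewrite /product_measure1 /= ge0_integral_mscale//=.
    by rewrite fineK.
  exact: measurable_fun_xsection.
move=> A B mA mB.
transitivity (P (X @^-1` A `&` Y @^-1` B `&` E)); first by [].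
rewrite ind//.
transitivity ((fine (P E))%:E * P (X @^-1` A) * P (Y @^-1` B))%E; last by [].
by rewrite (fineK PE) -[RHS]muleA [RHS]muleC.
Qed.

Lemma indep_sum_event (E : set T) : measurable E ->
  (forall A B : set R, measurable A -> measurable B ->
    P (X @^-1` A `&` Y @^-1` B) = (P (X @^-1` A) * P (Y @^-1` B))%E) ->
  (forall A B : set R, measurable A -> measurable B ->
    P (X @^-1` A `&` Y @^-1` B `&` E) = (P (X @^-1` A) * P (Y @^-1` B) * P E)%E) ->
  forall A : set R, measurable A ->
    P ((fun w => (X w + Y w)%R) @^-1` A `&` E)
    = (P ((fun w => (X w + Y w)%R) @^-1` A) * P E)%E.
Proof.
move=> mE ind indE A mA.
pose Z := [set z : measurableTypeR R * measurableTypeR R | A (z.1 + z.2)].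
have mZ : measurable Z.
  rewrite -[X in measurable X]setTI.
  have : measurable_fun setT (fun z : R * R => z.1 + z.2) by exact: measurable_funD.
  exact.
have h1 := indep_joint_law mE indE mZ.
have h2 : P ((fun w => (X w, Y w)) @^-1` Z `&` setT)
    = (P setT * (distribution P X' \x distribution P Y') Z)%E.
  apply: indep_joint_law => // B C mB mC.
  by rewrite setIT probability_setT mule1 ind.
rewrite setIT probability_setT mul1e in h2.
rewrite [LHS]h1 muleC; congr (_ * _)%E; exact/esym.
Qed.

(** The law of the sum is the integral, over the law of [X], of the law of [Y]
translated by [X]; the convolution identity [gaussian1_conv] evaluates it. *)
Lemma indep_gaussian_sum (m1 v1 m2 v2 : R) :
  gaussian_rv P X m1 v1 -> gaussian_rv P Y m2 v2 ->
  (forall A B : set R, measurable A -> measurable B ->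
    P (X @^-1` A `&` Y @^-1` B) = (P (X @^-1` A) * P (Y @^-1` B))%E) ->
  gaussian_rv P (fun w => X w + Y w) (m1 + m2) (v1 + v2).
Proof.
move=> [_ v10 lX] [_ v20 lY] ind; split; first exact: measurable_funD.
  exact: addr_ge0.
move=> A mA.
pose Z := [set z : measurableTypeR R * measurableTypeR R | A (z.1 + z.2)].
have mZ : measurable Z.
  rewrite -[X in measurable X]setTI.
  have : measurable_fun setT (fun z : R * R => z.1 + z.2) by exact: measurable_funD.
  exact.
have h2 : P ((fun w => (X w, Y w)) @^-1` Z `&` setT)
    = (P setT * (distribution P X' \x distribution P Y') Z)%E.
  apply: indep_joint_law => // B C mB mC.
  by rewrite setIT probability_setT mule1 ind.
rewrite setIT probability_setT mul1e in h2.
transitivity ((distribution P X' \x distribution P Y')%E Z); first exact: h2.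
rewrite /product_measure1/=.
have secE x : distribution P Y' (xsection Z x) = gaussian1 (x + m2) v2 A.
  have mxA : measurable [set y | A (x + y)].
    by apply: (@measurable_preimage _ _ _ (fun y => x + y)) => //; apply: measurable_funD.
  rewrite -gaussian1_translate// -lY//; congr (P _).
  by apply/seteqP; split => w /=; rewrite /xsection/= ?inE// => /set_mem.
under eq_integral do rewrite /= secE.
have mF : measurable_fun setT (fun x : measurableTypeR R => gaussian1 (x + m2) v2 A).
  rewrite (_ : (fun x => _) = distribution P Y' \o xsection Z).
    exact: measurable_fun_xsection.
  by apply/funext => x /=; rewrite secE.
have mphi := @measurable_affine R m1 (Num.sqrt v1).
rewrite (eq_measure_integral (pushforward (normal_prob 0 1)
    (fun x : R => m1 + Num.sqrt v1 * x : measurableTypeR R))); last first.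
  by move=> B mB _; have := lX B mB; rewrite gaussian1E// => h; exact: h.
rewrite ge0_integral_pushforward//; last first.
  by move=> x _; rewrite -secE.
rewrite -[RHS](@gaussian1_conv R (m1 + m2) v1 v2 A v10 v20 mA) preimage_setT.
apply: eq_integral => x _.
by rewrite -[LHS]/(gaussian1 (m1 + Num.sqrt v1 * x + m2) v2 A) addrAC.
Qed.

End sum_of_independent.

Lemma gaussian_rv_cst d (T : measurableType d) (R : realType)
    (P : probability T R) (c : R) : gaussian_rv P (cst c) c 0.
Proof.
split => // A mA; rewrite /gaussian1 eqxx /dirac indicE.
have [Ac|Ac] := boolP (c \in A).
  rewrite (_ : cst c @^-1` A = setT) ?probability_setT//.
  by apply/seteqP; split => w //= _; exact/set_mem.
rewrite (_ : cst c @^-1` A = set0) ?measure0//.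
by apply/seteqP; split => w //=; move/mem_set; rewrite (negbTE Ac).
Qed.

Lemma gaussian_rv_shift d (T : measurableType d) (R : realType)
    (P : probability T R) (X : T -> R) (m v c : R) :
  gaussian_rv P X m v -> gaussian_rv P (fun w => c + X w) (c + m) v.
Proof.
move=> [mX v0 lX]; split => //; first exact: measurable_funD.
move=> A mA; rewrite -gaussian1_translate// -lX//.
by apply: (@measurable_preimage _ _ _ (fun y => c + y)) => //; apply: measurable_funD.
Qed.

Section independent_family.
Context d (T : measurableType d) (R : realType) (P : probability T R).
Variables (I : choiceType) (Y : I -> T -> R).
Hypothesis mY : forall i, measurable_fun setT (Y i).
Hypothesis ind : forall (s : seq I) (B : I -> set R), uniq s ->
  (forall i, i \in s -> measurable (B i)) ->
  P (\bigcap_(i in [set` s]) (Y i @^-1` B i))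
  = (\prod_(i <- s) P (Y i @^-1` B i))%E.

Let cap (t : seq I) (B : I -> set R) := \bigcap_(i in [set` t]) (Y i @^-1` B i).

Let sum (s : seq I) (w : T) : R := \sum_(i <- s) Y i w.

Let cap_cons i t B : cap (i :: t) B = Y i @^-1` B i `&` cap t B.
Proof.
apply/seteqP; split => w /=.
  by move=> h; split => [|j /= jt]; apply: h; rewrite /= in_cons ?eqxx ?jt ?orbT.
move=> [h1 h2] j /=; rewrite in_cons => /orP[/eqP->//|]; exact: h2.
Qed.

Let measurable_cap t B : (forall i, i \in t -> measurable (B i)) -> measurable (cap t B).
Proof.
elim: t => [_|i t IH mB].
  by rewrite /cap (_ : [set` [::]] = set0) ?bigcap_set0//; apply/seteqP; split.
rewrite cap_cons; apply: measurableI.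
  by apply: measurable_preimage => //; apply: mB; rewrite mem_head.
by apply: IH => j jt; apply: mB; rewrite in_cons jt orbT.
Qed.

Let measurable_sumY s : measurable_fun setT (sum s).
Proof. exact: measurable_sum. Qed.

Let P_cap_cons i t B : uniq (i :: t) ->
  (forall j, j \in i :: t -> measurable (B j)) ->
  P (cap (i :: t) B) = (P (Y i @^-1` B i) * P (cap t B))%E.
Proof.
move=> it mB; rewrite /cap ind// big_cons ind//; first by case/andP: it.
by move=> j jt; apply: mB; rewrite in_cons jt orbT.
Qed.

(** A partial sum is independent of the remaining variables. The event on the
remaining variables has to be a general intersection for the induction on the
list of summands to go through: summand [i] moves from one side to the other. *)
Lemma indep_sum_rest (s t : seq I) (A : set R) (B : I -> set R) :
  uniq (s ++ t) -> measurable A -> (forall i, i \in t -> measurable (B i)) ->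
  P (sum s @^-1` A `&` cap t B) = (P (sum s @^-1` A) * P (cap t B))%E.
Proof.
elim: s t A B => [|i s IH] t A B st mA mB.
  have -> : sum [::] = cst 0 by apply/funext => w; rewrite /sum big_nil.
  have [A0|A0] := boolP (0 \in A).
    rewrite (_ : cst 0 @^-1` A = setT) ?setTI ?probability_setT ?mul1e//.
    by apply/seteqP; split => w //= _; exact/set_mem.
  rewrite (_ : cst 0 @^-1` A = set0) ?set0I ?measure0 ?mul0e//.
  by apply/seteqP; split => w //=; move/mem_set; rewrite (negbTE A0).
have [its uts] : i \notin s ++ t /\ uniq (s ++ t) by move: st => /= /andP[].
have uit : uniq (i :: t).
  move: its uts; rewrite mem_cat negb_or cat_uniq /= => /andP[_ ->].
  by case/and3P.
have ust : uniq (s ++ i :: t).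
  by rewrite (perm_uniq (permEl (perm_catCA s [:: i] t))).
have usi : uniq (s ++ [:: i]).
  by move: ust; rewrite -cat1s catA cat_uniq => /andP[].
have ind2 (C D : set R) : measurable C -> measurable D ->
    P (sum s @^-1` C `&` Y i @^-1` D) = (P (sum s @^-1` C) * P (Y i @^-1` D))%E.
  move=> mC mD; have := IH [:: i] C (fun=> D) usi mC (fun _ _ => mD).
  rewrite cap_cons /cap (_ : [set` [::]] = set0) ?bigcap_set0 ?setIT//.
  by apply/seteqP; split.
rewrite (_ : sum (i :: s) = fun w => sum s w + Y i w); last first.
  by apply/funext => w; rewrite /sum big_cons addrC.
apply: indep_sum_event => //; first exact: measurable_cap.
move=> C D mC mD; pose B' j := if j == i then D else B j.
have capB' : cap t B' = cap t B.
  apply: eq_bigcapr => j /= jt; rewrite /B'; case: eqP => // ji.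
  by move: uit; rewrite /= -ji jt.
have mB' j : j \in i :: t -> measurable (B' j).
  by rewrite in_cons /B'; case: eqP => //= _ jt; exact: mB.
rewrite -setIA (_ : Y i @^-1` D `&` cap t B = cap (i :: t) B'); last first.
  by rewrite cap_cons capB' /B' eqxx.
by rewrite IH// P_cap_cons// capB' /B' eqxx muleA.
Qed.

Lemma gaussian_rv_sum (m v : I -> R) (s : seq I) : uniq s ->
  (forall i, i \in s -> gaussian_rv P (Y i) (m i) (v i)) ->
  gaussian_rv P (fun w => \sum_(i <- s) Y i w)
    (\sum_(i <- s) m i) (\sum_(i <- s) v i).
Proof.
elim: s => [_ _|i s IH us gY].
  rewrite !big_nil (_ : (fun w => _) = cst 0); first exact: gaussian_rv_cst.
  by apply/funext => w; rewrite big_nil.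
rewrite !big_cons (_ : (fun w => _) = fun w => sum s w + Y i w); last first.
  by apply/funext => w; rewrite /sum big_cons addrC.
rewrite (addrC (m i)) (addrC (v i)); apply: indep_gaussian_sum => //.
- apply: IH; first by case/andP: us.
  by move=> j js; apply: gY; rewrite in_cons js orbT.
- by apply: gY; rewrite mem_head.
move=> A B mA mB; have := @indep_sum_rest s [:: i] A (fun=> B).
rewrite cap_cons /cap (_ : [set` [::]] = set0) ?bigcap_set0 ?setIT.
  by apply => //; rewrite cats1 rcons_uniq.
by apply/seteqP; split.
Qed.

End independent_family.

(** * Tail and small-ball estimates for standard Gaussian variables *)

Lemma sqrt_2pi_gt0 (R : realType) : 0 < Num.sqrt (pi *+ 2) :> R.
Proof. by rewrite sqrtr_gt0 mulrn_wgt0// pi_gt0. Qed.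

(** The density is at most [2 * expR (- (a ^+ 2 / 4))] times the density of variance 2
on this set: half of the exponent is given away to the bound. *)
Lemma normal_tail_le (R : realType) (a : R) : 0 <= a ->
  (normal_prob 0 1 [set x : R | (a <= `|x|)%R] <= (2 * expR (- (a ^+ 2 / 4)))%:E)%E.
Proof.
move=> a0; pose s : R := Num.sqrt 2.
have s2 : s ^+ 2 = 2 by rewrite sqr_sqrtr.
have sgt0 : 0 < s by rewrite sqrtr_gt0.
have mA : measurable [set x : R | a <= `|x|].
  rewrite (_ : [set x | _] = (fun x : R => `|x|) @^-1` `[a, +oo[).
    by apply: measurable_preimage => //; exact: measurableT_comp.
  by apply/seteqP; split => x /=; rewrite in_itv/= andbT.
have pdfE x : normal_pdf 0 1 x = s * expR (- (x ^+ 2 / 4)) * normal_pdf 0 s x.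
  rewrite !normal_pdfE ?gt_eqF// /normal_peak /normal_fun subr0 s2 expr1n mul1r.
  rewrite -mulrnAr sqrtrM// -/s.
  have -> : expR (- x ^+ 2 / (1 *+ 2)) =
      expR (- (x ^+ 2 / 4)) * expR (- x ^+ 2 / (2 *+ 2)) :> R.
    by rewrite -expRD; congr expR; field.
  have p0 : Num.sqrt (pi *+ 2) != 0 :> R.
    by rewrite gt_eqF// sqrt_2pi_gt0.
  by field; rewrite p0 gt_eqF.
rewrite /normal_prob.
apply: (@le_trans _ _ (\int[lebesgue_measure]_(x in [set x : R | (a <= `|x|)%R])
   ((2 * expR (- (a ^+ 2 / 4)))%:E * (normal_pdf 0 s x)%:E))%E).
  apply: ge0_le_integral => //.
  - by move=> x _; rewrite lee_fin normal_pdf_ge0.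
  - by apply/measurable_EFinP/measurable_funTS; exact: measurable_normal_pdf.
  - apply/measurable_EFinP/measurable_funTS/measurable_funM => //.
    exact: measurable_normal_pdf.
  - move=> x /= ax; rewrite lee_fin pdfE ler_wpM2r ?normal_pdf_ge0//.
    apply: ler_pM; rewrite ?expR_ge0 ?sqrtr_ge0//.
      rewrite /s -[leRHS]ger0_norm// -sqrtr_sqr ler_wsqrtr//; lra.
    rewrite ler_expR lerN2 ler_pM2r// -[x ^+ 2]real_normK ?num_real//.
    by rewrite lerXn2r// nnegrE.
rewrite ge0_integralZl//; last 2 first.
- by apply/measurable_EFinP/measurable_funTS; exact: measurable_normal_pdf.
- by move=> x _; rewrite lee_fin normal_pdf_ge0.
rewrite -[leRHS]mule1 lee_wpmul2l ?lee_fin ?mulr_ge0 ?expR_ge0//.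
exact: (probability_le1 (normal_prob 0 s)).
Qed.

(** The density is at most [2^-1] since [2 * pi >= 4]. *)
Lemma normal_small_ball (R : realType) (r : R) : 0 <= r ->
  (normal_prob 0 1 [set x : R | (`|x| <= r)%R] <= r%:E)%E.
Proof.
move=> r0.
have -> : [set x : R | `|x| <= r] = `[- r, r]%classic.
  by apply/seteqP; split => x /=; rewrite in_itv/= ler_norml.
rewrite /normal_prob.
apply: (@le_trans _ _ (\int[lebesgue_measure]_(x in `[(- r)%R, r]%classic) (cst (2^-1)%:E x))%E).
  apply: ge0_le_integral => //.
  - by move=> x _; rewrite lee_fin normal_pdf_ge0.
  - by apply/measurable_EFinP/measurable_funTS; exact: measurable_normal_pdf.
  - move=> x _; rewrite lee_fin (le_trans (normal_pdf_ub _ _ _))// /normal_peak.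
    rewrite expr1n mul1r lef_pV2 ?posrE ?sqrt_2pi_gt0//.
    rewrite -[leLHS]ger0_norm// -sqrtr_sqr ler_wsqrtr//.
    by have := pi_ge2 R; lra.
rewrite integral_cst//= lebesgue_measure_itv/= lte_fin.
case: ifP => [_|_]; last by rewrite mule0 lee_fin.
by rewrite -EFinD -EFinM lee_fin; lra.
Qed.

(** Keeps only the unit interval to the right of [r], where the density is at least
[expR (- 2) * expR (- (1 + r ^+ 2))], as [(r + 1) ^+ 2 / 2 <= 1 + r ^+ 2]. *)
Lemma normal_tail_ge (R : realType) (r : R) : 0 <= r ->
  ((expR (- (3 + r ^+ 2)))%:E <= normal_prob 0 1 [set x : R | (r < x)%R])%E.
Proof.
move=> r0.
apply: (@le_trans _ _ (normal_prob 0 1 `]r, r + 1])); last first.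
  apply: le_measure; rewrite ?inE//.
  - rewrite (_ : [set x | _] = `]r, +oo[%classic)//.
    by apply/seteqP; split => x /=; rewrite in_itv/= andbT.
  - by move=> x /=; rewrite in_itv/= => /andP[].
rewrite /normal_prob.
apply: (@le_trans _ _ (\int[lebesgue_measure]_(x in `]r, (r + 1)%R]%classic)
   (cst (expR (- (3 + r ^+ 2)))%:E x))%E).
  rewrite integral_cst//= lebesgue_measure_itv/= lte_fin ltrDl ltr01.
  by rewrite -EFinD (addrAC r) subrr add0r mule1.
apply: ge0_le_integral => //.
- by move=> x _; rewrite lee_fin expR_ge0.
- by apply/measurable_EFinP/measurable_funTS; exact: measurable_normal_pdf.
- move=> x /=; rewrite in_itv/= => /andP[rx xr1].
  rewrite lee_fin normal_pdfE ?oner_eq0// /normal_peak /normal_fun subr0.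
  rewrite (_ : 3 + r ^+ 2 = 2 + (1 + r ^+ 2)); last by lra.
  rewrite opprD expRD; apply: ler_pM; rewrite ?expR_ge0//.
    rewrite expRN expr1n mul1r lef_pV2 ?posrE ?sqrt_2pi_gt0 ?expR_gt0//.
    apply: (@le_trans _ _ 3); last first.
      by apply: le_trans (expR_ge1Dx _); lra.
    rewrite -[leRHS]ger0_norm// -sqrtr_sqr ler_wsqrtr//.
    by have := pihalf_lt2 R; lra.
  rewrite ler_expR expr1n mulNr lerN2 ler_pdivrMr//.
  have : x ^+ 2 <= (r + 1) ^+ 2 by rewrite lerXn2r// nnegrE; lra.
  have := sqr_ge0 (r - 1); rewrite !expr2; lra.
Qed.

Lemma expR_N7_le (R : realType) (t : R) : 0 <= t <= 2^-1 -> expR (- (7 * t)) <= 1 - t.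
Proof.
move=> /andP[t0 t1]; have h : 0 < 1 - t by lra.
rewrite expRN -[leRHS]invrK lef_pV2 ?posrE ?expR_gt0 ?invr_gt0//.
apply: le_trans (expR_ge1Dx _).
rewrite -[leLHS]mul1r ler_pdivrMr//.
have : 0 <= t * (2^-1 - t) by rewrite mulr_ge0// subr_ge0.
nra.
Qed.

(** For small [t] the disc is inside a square of probability at most [t], by the
density bound on each side; for large [t] one coordinate alone has a
large enough tail. The constant 7 makes both regimes fit: [expR_N7_le] for
[t <= 2^-1], and [3 + t <= 7 * t] for [t >= 2^-1]. *)
Lemma gaussian_pair_ball_le d (T : measurableType d) (R : realType)
    (P : probability T R) (X Y : T -> R) (t : R) :
  gaussian_rv P X 0 1 -> gaussian_rv P Y 0 1 ->
  (forall A B : set R, measurable A -> measurable B ->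
    P (X @^-1` A `&` Y @^-1` B) = (P (X @^-1` A) * P (Y @^-1` B))%E) ->
  0 <= t ->
  (P [set w | (X w ^+ 2 + Y w ^+ 2 <= t)%R] <= (1 - expR (- (7 * t)))%:E)%E.
Proof.
move=> [mX _ lX] [mY _ lY] ind t0.
have g1 A : gaussian1 0 1 A = normal_prob (0 : R) 1 A.
  by rewrite /gaussian1 oner_eq0 sqrtr1.
have mE : measurable [set w | X w ^+ 2 + Y w ^+ 2 <= t].
  rewrite (_ : [set w | _] = (fun w => X w ^+ 2 + Y w ^+ 2) @^-1` `]-oo, t]).
    apply: measurable_preimage => //.
    by apply: measurable_funD; apply: measurable_funX.
  by apply/seteqP; split => w /=; rewrite in_itv.
have [t2|t2] := leP t 2^-1.
  pose B := [set x : R | `|x| <= Num.sqrt t].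
  have mB : measurable B.
    rewrite (_ : B = `[- Num.sqrt t, Num.sqrt t]%classic)//.
    by apply/seteqP; split => x /=; rewrite /B/= in_itv/= ler_norml.
  apply: (@le_trans _ _ (P (X @^-1` B `&` Y @^-1` B))).
    apply: le_measure; rewrite ?inE//.
      by apply: measurableI; exact: measurable_preimage.
    move=> w /= h; split; rewrite /B/= -sqrtr_sqr ler_wsqrtr//.
      by apply: le_trans h; rewrite lerDl sqr_ge0.
    by apply: le_trans h; rewrite lerDr sqr_ge0.
  rewrite ind// lX// lY// g1.
  have hB := @normal_small_ball R _ (sqrtr_ge0 t).
  apply: (@le_trans _ _ ((Num.sqrt t)%:E * (Num.sqrt t)%:E)%E).
    by apply: lee_pmul => //; exact: measure_ge0.
  rewrite -EFinM lee_fin -expr2 sqr_sqrtr//.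
  by have := @expR_N7_le R t; rewrite t0 t2 => /(_ isT); lra.
pose B := [set x : R | Num.sqrt t < x].
have mB : measurable B.
  rewrite (_ : B = `]Num.sqrt t, +oo[%classic)//.
  by apply/seteqP; split => x /=; rewrite /B/= in_itv/= andbT.
apply: (@le_trans _ _ (P (~` (X @^-1` B)))).
  apply: le_measure; rewrite ?inE//.
    by apply: measurableC; exact: measurable_preimage.
  move=> w /= h; apply/negP; rewrite -leNgt (le_trans (ler_norm _))//.
  by rewrite -sqrtr_sqr ler_wsqrtr//; apply: le_trans h; rewrite lerDl sqr_ge0.
rewrite probability_setC; last exact: measurable_preimage.
rewrite lX// g1 EFinB leeB// (le_trans _ (normal_tail_ge (sqrtr_ge0 t)))//.
by rewrite lee_fin ler_expR sqr_sqrtr//; lra.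
Qed.

(** * Approximation by trigonometric polynomials *)

Lemma mx_norm_leP (R : realType) m n (A : 'M[R]_(m, n)) (e : R) :
  0 <= e -> (`|A| <= e <-> forall i j, `|A i j| <= e).
Proof.
move=> e0; split => [Ae i j|h].
  apply: le_trans Ae; rewrite [leRHS]mx_normrE.
  exact: (le_bigmax _ (fun ij => `|A ij.1 ij.2|) (i, j)).
by rewrite [leLHS]mx_normrE; apply: bigmax_le => // -[i j] _; exact: h.
Qed.

Lemma continuous_trmx (R : realType) n :
  continuous (fun x : 'rV[R]_n => x^T : 'cV[R]_n).
Proof.
move=> x A [B Bx BA]; exists (fun i j => B j i) => [i j|y By].
  by have := Bx j i; rewrite mxE.
by apply: BA => i j; rewrite mxE; exact: By.
Qed.

(** Tychonoff for row vectors, transposed. *)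
Lemma compact_cV_box (R : realType) n (r : R) :
  compact [set x : 'cV[R]_n | forall i, `|x i 0| <= r].
Proof.
have cI (i : 'I_n) : compact `[- r, r]%classic by exact: segment_compact.
have := rV_compact cI => cB.
have -> : [set x : 'cV[R]_n | forall i, `|x i 0| <= r]
    = (fun x : 'rV[R]_n => x^T : 'cV[R]_n) @`
      [set v : 'rV[R]_n | forall i, `[- r, r]%classic (v ord0 i)].
  apply/seteqP; split => [x xr|x [v /= vr <-] i]; last first.
    by have := vr i; rewrite /= in_itv/= mxE ler_norml.
  exists (x^T); last exact: trmxK.
  by move=> i /=; have := xr i; rewrite in_itv/= mxE ler_norml.
apply: continuous_compact => //.
apply: continuous_subspaceT; exact: continuous_trmx.
Qed.

(** The second point may lie outside of [K], which is what near coverings give. *)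
Lemma uniform_continuity_on_compact (R : realType) (V : normedModType R)
    (f : V -> R) (K : set V) (e : R) :
  compact K -> continuous f -> 0 < e ->
  exists2 dl : R, 0 < dl & forall x y, K x -> `|x - y| <= dl -> `|f x - f y| <= e.
Proof.
move=> cK cf e0.
have cK' : near_covering K by apply/compact_near_coveringP.
have : \forall dl \near 0^'+, K `<=`
    (fun x => forall y, `|x - y| <= dl -> `|f x - f y| <= e).
  apply: cK' => x Kx.
  have e20 : 0 < e / 2 by rewrite divr_gt0.
  have /cvgrPdist_le/(_ _ e20) := cf x.
  move=> /nbhs_ballP[r /= r0 rP].
  exists ([set y | `|x - y| < r / 2], [set dl : R | dl < r / 2]) => /=.
    split; first by apply: cvgr_dist_lt; rewrite ?divr_gt0//; exact: cvg_id.
    by apply: nbhs_right_lt; rewrite divr_gt0.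
  move=> [y dl] /= [xy dlr] z yz.
  have h1 : `|f x - f y| <= e / 2.
    by apply: rP; rewrite -ball_normE /ball_/=; apply: lt_trans xy _; lra.
  have h2 : `|f x - f z| <= e / 2.
    apply: rP; rewrite -ball_normE /ball_/=.
    rewrite (_ : x - z = (x - y) + (y - z)); last by rewrite addrA subrK.
    apply: le_lt_trans (ler_normD _ _) _; lra.
  rewrite (_ : f y - f z = (f x - f z) - (f x - f y)); last by lra.
  apply: le_trans (ler_normB _ _) _; lra.
move=> H; near (0 : R)^'+ => dl.
exists dl; first by near: dl; exact: nbhs_right_gt.
have HK : K `<=` (fun x => forall y, `|x - y| <= dl -> `|f x - f y| <= e).
  by near: dl; exact: H.
by move=> x y Kx; exact: HK.
Unshelve. all: by end_near.
Qed.

Lemma dotp_delta (R : realType) n (i : 'I_n) (x : 'cV[R]_n) :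
  dotp (delta_mx i 0) x = x i 0.
Proof.
rewrite /dotp (bigD1 i)//= big1 => [|j ji]; first by rewrite !mxE !eqxx mul1r addr0.
by rewrite !mxE (negbTE ji) mul0r.
Qed.

Section trigonometric_polynomials.
Context (R : realType) (n : nat).
Implicit Types (f g : 'cV[R]_n -> R) (u : 'cV[R]_n).

Definition trig_monomial (t : R * R * 'cV[R]_n) (x : 'cV[R]_n) : R :=
  t.1.1 * cos (t.1.2 + dotp t.2 x).

(** Phases and frequency vectors are arbitrary, so that sines and products stay in
the class. *)
Definition trig_poly f := exists s : seq (R * R * 'cV[R]_n),
  forall x, f x = \sum_(t <- s) trig_monomial t x.

Lemma trig_poly_eq f g : f =1 g -> trig_poly g -> trig_poly f.
Proof. by move=> fg [s gs]; exists s => x; rewrite fg. Qed.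

Lemma trig_poly_monomial c a u : trig_poly (fun x => c * cos (a + dotp u x)).
Proof. by exists [:: (c, a, u)] => x; rewrite big_seq1. Qed.

Lemma dotp0 u : dotp (0 : 'cV[R]_n) u = 0.
Proof. by rewrite /dotp big1// => i _; rewrite mxE mul0r. Qed.

Lemma trig_poly_cst c : trig_poly (cst c).
Proof.
apply: trig_poly_eq (trig_poly_monomial c 0 0) => x.
by rewrite dotp0 addr0 cos0 mulr1.
Qed.

Lemma trig_polyD f g : trig_poly f -> trig_poly g -> trig_poly (f \+ g).
Proof. by move=> [s fs] [t gt]; exists (s ++ t) => x; rewrite big_cat/= -fs -gt. Qed.

Lemma trig_poly_sum (I : Type) (s : seq I) (F : I -> 'cV[R]_n -> R) :
  (forall i, trig_poly (F i)) -> trig_poly (fun x => \sum_(i <- s) F i x).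
Proof.
move=> tF; elim: s => [|i s IH].
  by apply: trig_poly_eq (trig_poly_cst 0) => x; rewrite big_nil.
by apply: trig_poly_eq (trig_polyD (tF i) IH) => x; rewrite big_cons.
Qed.

Lemma cosM (a b : R) : cos a * cos b = 2^-1 * (cos (a + b) + cos (a - b)).
Proof. by rewrite !cosD cosN sinN; field. Qed.

Lemma dotpDl u v x : dotp (u + v : 'cV[R]_n) x = dotp u x + dotp v x.
Proof. by rewrite /dotp -big_split; apply: eq_bigr => i _; rewrite mxE mulrDl. Qed.

Lemma dotpNl u x : dotp (- u) x = - dotp u x.
Proof. by rewrite /dotp -sumrN; apply: eq_bigr => i _; rewrite mxE mulNr. Qed.

Lemma trig_polyM f g : trig_poly f -> trig_poly g -> trig_poly (f \* g).
Proof.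
move=> [s fs] [t gt].
pose F (p q : R * R * 'cV[R]_n) x := trig_monomial p x * trig_monomial q x.
apply: (@trig_poly_eq _ (fun x => \sum_(p <- s) \sum_(q <- t) F p q x)).
  by move=> x /=; rewrite fs gt big_distrlr.
apply: trig_poly_sum => p; apply: trig_poly_sum => q.
pose c := p.1.1 * q.1.1 / 2.
apply: trig_poly_eq (trig_polyD (trig_poly_monomial c (p.1.2 + q.1.2) (p.2 + q.2))
  (trig_poly_monomial c (p.1.2 - q.1.2) (p.2 - q.2))) => x.
rewrite /F /trig_monomial /= mulrACA cosM /c !dotpDl dotpNl.
rewrite (_ : p.1.2 + q.1.2 + (dotp p.2 x + dotp q.2 x)
  = p.1.2 + dotp p.2 x + (q.1.2 + dotp q.2 x)); last by lra.
rewrite (_ : p.1.2 - q.1.2 + (dotp p.2 x - dotp q.2 x)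
  = p.1.2 + dotp p.2 x - (q.1.2 + dotp q.2 x)); last by lra.
by lra.
Qed.

Lemma trig_poly_prod (I : Type) (s : seq I) (F : I -> 'cV[R]_n -> R) :
  (forall i, trig_poly (F i)) -> trig_poly (fun x => \prod_(i <- s) F i x).
Proof.
move=> tF; elim: s => [|i s IH].
  by apply: trig_poly_eq (trig_poly_cst 1) => x; rewrite big_nil.
by apply: trig_poly_eq (trig_polyM (tF i) IH) => x; rewrite big_cons.
Qed.

Lemma trig_poly_sin c (i : 'I_n) : trig_poly (fun x => sin (c * x i 0)).
Proof.
apply: trig_poly_eq (trig_poly_monomial 1 (- (pi / 2)) (c *: delta_mx i 0)) => x.
rewrite mul1r -cosN opprD opprK.
rewrite (_ : dotp _ x = c * x i 0).
  by rewrite cosD cosN sinN cos_pihalf sin_pihalf; lra.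
rewrite /dotp (bigD1 i)//= big1 => [|j ji]; rewrite !mxE ?eqxx ?(negbTE ji)/=; lra.
Qed.

End trigonometric_polynomials.

Section bernstein_weights.
Context (R : realType).
Implicit Types (s : R) (g : nat -> R).

(** The binomial law with [N] trials of parameter [s], defined by conditioning on
one trial: its moments follow by induction on [N] without binomial
coefficients, and it is visibly a polynomial in [s]. *)
Fixpoint bern_weight s N j : R :=
  match N with
  | 0%N => (j == 0%N)%:R
  | N'.+1 => s * (if j is j'.+1 then bern_weight s N' j' else 0)
             + (1 - s) * bern_weight s N' j
  end.

Lemma bern_weight_ge0 s N j : 0 <= s <= 1 -> 0 <= bern_weight s N j.
Proof.
move=> /andP[s0 s1]; elim: N j => [|N IH] j /=; first by [].
apply: addr_ge0; apply: mulr_ge0 => //; last by rewrite subr_ge0.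
by case: j.
Qed.

Lemma bern_weight_out s N j : (N < j)%N -> bern_weight s N j = 0.
Proof.
elim: N j => [|N IH] [|j]//= Nj.
by rewrite !IH// 1?ltnW// !mulr0 addr0.
Qed.

Definition bern_sum s N g := \sum_(j < N.+1) g j * bern_weight s N j.

Lemma bern_sumS s N g :
  bern_sum s N.+1 g = s * bern_sum s N (g \o succn) + (1 - s) * bern_sum s N g.
Proof.
rewrite /bern_sum.
under eq_bigr do rewrite /= mulrDr.
rewrite big_split/=; congr (_ + _).
  rewrite big_ord_recl/= !mulr0 add0r mulr_sumr; apply: eq_bigr => j _ /=.
  by rewrite mulrCA.
rewrite big_ord_recr/= bern_weight_out// !mulr0 addr0 mulr_sumr.
by apply: eq_bigr => j _; rewrite mulrCA.
Qed.

Lemma eq_bern_sum s N g h : g =1 h -> bern_sum s N g = bern_sum s N h.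
Proof. by move=> gh; apply: eq_bigr => j _; rewrite gh. Qed.

Lemma bern_sumD s N g h : bern_sum s N (g \+ h) = bern_sum s N g + bern_sum s N h.
Proof. by rewrite /bern_sum -big_split; apply: eq_bigr => j _; rewrite mulrDl. Qed.

Lemma bern_sumZ s N c g : bern_sum s N (fun j => c * g j) = c * bern_sum s N g.
Proof. by rewrite /bern_sum mulr_sumr; apply: eq_bigr => j _; rewrite mulrA. Qed.

Lemma bern_sum1 s N : bern_sum s N (fun=> 1) = 1.
Proof.
elim: N => [|N IH]; first by rewrite /bern_sum big_ord1 mulr1.
by rewrite bern_sumS -[bern_sum s N (_ \o _)]/(bern_sum s N (fun=> 1)) IH; lra.
Qed.

Lemma bern_sum_mean s N : bern_sum s N (fun j => j%:R - N%:R * s) = 0.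
Proof.
elim: N => [|N IH]; first by rewrite /bern_sum big_ord1 /=; lra.
have E c : bern_sum s N (fun j => c * 1 + (j%:R - N%:R * s)) = c.
  by rewrite (bern_sumD s N (fun=> c * 1)) bern_sumZ bern_sum1 IH; lra.
rewrite bern_sumS (eq_bern_sum _ _ (h := fun j => (1 - s) * 1 + (j%:R - N%:R * s))).
  rewrite E (eq_bern_sum _ _ (h := fun j => (- s) * 1 + (j%:R - N%:R * s))).
    by rewrite E; lra.
  by move=> j; rewrite -natr1; lra.
by move=> j /=; rewrite -!natr1; lra.
Qed.

Lemma bern_sum_variance s N :
  bern_sum s N (fun j => (j%:R - N%:R * s) ^+ 2) = N%:R * (s * (1 - s)).
Proof.
elim: N => [|N IH]; first by rewrite /bern_sum big_ord1 /=; lra.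
pose D j : R := j%:R - N%:R * s.
have E c : bern_sum s N (fun j => (c ^+ 2 * 1 + (2 * c) * D j) + D j ^+ 2)
    = c ^+ 2 + N%:R * (s * (1 - s)).
  rewrite (bern_sumD s N (fun j => c ^+ 2 * 1 + (2 * c) * D j)) IH.
  rewrite (bern_sumD s N (fun=> c ^+ 2 * 1)) !bern_sumZ bern_sum1 bern_sum_mean.
  by lra.
rewrite bern_sumS (eq_bern_sum _ _
  (h := fun j => ((1 - s) ^+ 2 * 1 + (2 * (1 - s)) * D j) + D j ^+ 2)).
  rewrite E (eq_bern_sum _ _
    (h := fun j => ((- s) ^+ 2 * 1 + (2 * (- s)) * D j) + D j ^+ 2)).
    by rewrite E -natr1 !expr2; lra.
  by move=> j; rewrite /D -natr1 !expr2; lra.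
by move=> j /=; rewrite /D -!natr1 !expr2; lra.
Qed.

End bernstein_weights.

Lemma cos_ge_half (R : realType) (z : R) : `|z| <= 2^-1 -> 2^-1 <= cos z.
Proof.
move=> zh.
have sinz (a : R) : 0 <= a <= 2^-1 -> sin a <= a.
  move=> /andP[a0 a1].
  have [b] := @MVT_segment R sin cos 0 a a0 (fun x _ => is_derive_sin x)
    (continuous_subspaceT (@continuous_sin R)).
  move=> _; rewrite sin0 !subr0 => ->.
  by rewrite ler_piMl// cos_le1.
have cos_abs : cos z = cos `|z| 
  by have [z0|z0] := leP 0 z; [rewrite ger0_norm|rewrite ltr0_norm// cosN].
rewrite cos_abs; set a := `|z| in zh *; have a0 : 0 <= a by exact: normr_ge0.
have [b] := @MVT_segment R cos (fun x => - sin x) 0 a a0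
  (fun x _ => is_derive_cos x) (continuous_subspaceT (@continuous_cos R)).
rewrite in_itv/= cos0 subr0 => /andP[b0 b1] E.
have sb : sin b <= 2^-1.
  by apply: le_trans (sinz b _) _; rewrite ?b0/=; lra.
have sb1 := sin_geN1 b.
nra.
Qed.

(** By the mean value theorem, the cosine being at least [2^-1] on this interval:
the sine is a bi-Lipschitz coordinate there. *)
Lemma sin_dist_ge (R : realType) (a b : R) : `|a| <= 2^-1 -> `|b| <= 2^-1 ->
  `|a - b| <= 2 * `|sin a - sin b|.
Proof.
wlog ab : a b / a <= b.
  move=> H ha hb; have [/H|/ltW/H] := leP a b; first exact.
  by rewrite distrC (distrC (sin b)); exact.
move=> ha hb.
have /andP[a1 a2] : - 2^-1 <= a <= 2^-1 by rewrite -ler_norml.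
have /andP[b1 b2] : - 2^-1 <= b <= 2^-1 by rewrite -ler_norml.
have [c] := @MVT_segment R sin cos a b ab (fun x _ => is_derive_sin x)
  (continuous_subspaceT (@continuous_sin R)).
rewrite in_itv/= => /andP[ac cb] E.
have cc : 2^-1 <= cos c by apply: cos_ge_half; rewrite ler_norml; apply/andP; split; lra.
have ba : 0 <= b - a by lra.
have c0 : 0 <= cos c by lra.
rewrite distrC (distrC (sin a)) E normrM !ger0_norm//; nra.
Qed.

Section bernstein_approximation.
Context (R : realType) (n : nat).

Let sq (c : R) (x : 'cV[R]_n) (i : 'I_n) : R := (1 + sin (c * x i 0)) / 2.

Let sq01 c x i : 0 <= sq c x i <= 1.
Proof.
have := sin_le1 (c * x i 0); have := sin_geN1 (c * x i 0).
by rewrite /sq => h1 h2; apply/andP; split; lra.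
Qed.

Let weight c N (phi : {ffun 'I_n -> 'I_N.+1}) x : R :=
  \prod_i bern_weight (sq c x i) N (phi i).
Arguments weight : clear implicits.

Let weight_ge0 c N phi x : 0 <= weight c N phi x.
Proof. by apply: prodr_ge0 => i _; exact: bern_weight_ge0. Qed.

Let sum_weight c N x : \sum_phi weight c N phi x = 1.
Proof.
rewrite -(bigA_distr_bigA (fun i (j : 'I_N.+1) => bern_weight (sq c x i) N j)).
apply: big1 => i _; rewrite -[RHS](bern_sum1 (sq c x i) N) /bern_sum.
by apply: eq_bigr => j _; rewrite mul1r.
Qed.

Let sum_weight_dev c N x k :
  \sum_phi weight c N phi x * ((phi k)%:R - N%:R * sq c x k) ^+ 2 <= N%:R.
Proof.
pose F i (j : 'I_N.+1) := bern_weight (sq c x i) N j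
  * (if i == k then (j%:R - N%:R * sq c x k) ^+ 2 else 1).
have -> : \sum_phi weight c N phi x * ((phi k)%:R - N%:R * sq c x k) ^+ 2
    = \sum_(phi : {ffun 'I_n -> 'I_N.+1}) \prod_i F i (phi i).
  apply: eq_bigr => phi _; rewrite /F big_split/=; congr (_ * _).
  by rewrite (bigD1 k)//= eqxx big1 ?mulr1// => i /negbTE ->.
rewrite -bigA_distr_bigA (bigD1 k)//= [X in _ * X]big1 ?mulr1 => [|i ik].
  have := bern_sum_variance (sq c x k) N; rewrite /bern_sum => E.
  rewrite (_ : \sum_(j < N.+1) F k j = N%:R * (sq c x k * (1 - sq c x k))).
    have /andP[s0 s1] := sq01 c x k.
    have N0 : 0 <= N%:R :> R by exact: ler0n.
    by rewrite ler_piMr//; nra.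
  by rewrite -E; apply: eq_bigr => j _; rewrite /F eqxx mulrC.
rewrite -[RHS](bern_sum1 (sq c x i) N) /bern_sum.
by apply: eq_bigr => j _; rewrite /F (negbTE ik) mul1r mulr1.
Qed.

Let trig_poly_weight c N phi : trig_poly (weight c N phi).
Proof.
have trig_sq i : trig_poly (sq c ^~ i).
  have h := trig_polyD (trig_poly_cst n 2^-1)
    (trig_polyM (trig_poly_cst n 2^-1) (trig_poly_sin c i)).
  by apply: trig_poly_eq h => x; rewrite /sq/=; lra.
rewrite /weight; apply: trig_poly_prod => i.
move: (phi i : nat) => j {phi}; elim: N j => [|N IH] j /=; first exact: trig_poly_cst.
apply: trig_polyD; apply: trig_polyM => //.
  by case: j => [|j]; [exact: trig_poly_cst|exact: IH].
have h := trig_polyD (trig_poly_cst n 1) (trig_polyM (trig_poly_cst n (-1)) (trig_sq i)).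
by apply: trig_poly_eq h => x /=; lra.
Qed.

(** Bernstein approximation in the variables [(1 + sin (c * x i)) / 2], which lie in
the unit interval everywhere and, for [c * r <= 2^-1], separate the points of the
box. The approximant averages values of [f] with nonnegative weights
of sum 1, so it is bounded by [M] on the whole space, not only on the box. *)
Lemma trig_poly_approx (f : 'cV[R]_n -> R) (M r e : R) :
  continuous f -> (forall x, `|f x| <= M) -> 0 < r -> 0 < e ->
  exists h : 'cV[R]_n -> R, [/\ trig_poly h, forall x, `|h x| <= M
    & forall x : 'cV[R]_n, (forall i, `|x i 0| <= r) -> `|h x - f x| <= e].
Proof.
move=> cf fM r0 e0; pose box := [set x : 'cV[R]_n | forall i, `|x i 0| <= r].
have M0 : 0 <= M by apply: le_trans (normr_ge0 _) (fM 0).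
have e20 : 0 < e / 2 by rewrite divr_gt0.
have [dl dl0 dlP] := uniform_continuity_on_compact (@compact_cV_box R n r) cf e20.
pose c := (2 * r)^-1; have c0 : 0 < c by rewrite invr_gt0 mulr_gt0.
pose eta := dl * c / 8; have eta0 : 0 < eta by rewrite divr_gt0 ?mulr_gt0.
pose q := 4 * M * n%:R / (eta ^+ 2 * e).
have q0 : 0 <= q by rewrite divr_ge0 ?mulr_ge0 ?ler0n ?sqr_ge0// ltW.
pose N := (Num.bound q).+1.
have N0 : 0 < N%:R :> R by rewrite ltr0n.
have NP : 2 * M * n%:R / (N%:R * eta ^+ 2) <= e / 2.
  have Nb : q <= N%:R by apply: le_trans (ltW (archi_boundP q0)) _; rewrite ler_nat.
  rewrite ler_pdivrMr; last by rewrite mulr_gt0// exprn_gt0.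
  move: Nb; rewrite /q ler_pdivrMr; last by rewrite mulr_gt0// exprn_gt0.
  by lra.
(* [val phi] is the value of [f] at some point of the box whose coordinates are
   close to the grid point [phi / N], and 0 when there is none. *)
pose close (phi : {ffun 'I_n -> 'I_N.+1}) x :=
  box x /\ forall i, `|(phi i)%:R / N%:R - sq c x i| <= eta.
pose val phi := if pselect (exists x, close phi x) is left ex then f (projT1 (cid ex)) else 0.
have valM phi : `|val phi| <= M.
  by rewrite /val; case: pselect => // _; rewrite normr0.
have valP phi x : close phi x -> `|val phi - f x| <= e / 2.
  rewrite /val; case: pselect => [ex [xb xc]|h cl]; last by case: h; exists x.
  case: (cid ex) => y [yb yc] /=; apply: dlP => //.
  apply/(mx_norm_leP _ (ltW dl0)) => i j; rewrite (ord1 j) !mxE.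
  have cx z : box z -> `|c * z i 0| <= 2^-1.
    move=> /(_ i) zi; rewrite normrM gtr0_norm// /c invfM.
    by rewrite -mulrA ler_piMr ?invr_ge0// mulrC ler_pdivrMr// mul1r.
  have := sin_dist_ge (cx _ yb) (cx _ xb).
  rewrite -mulrBr normrM gtr0_norm// => h1.
  have h2 : `|sq c y i - sq c x i| <= 2 * eta.
    rewrite (_ : sq c y i - sq c x i =
      ((phi i)%:R / N%:R - sq c x i) - ((phi i)%:R / N%:R - sq c y i)); last by lra.
    by apply: le_trans (ler_normB _ _) _; have := xc i; have := yc i; lra.
  have h3 : `|sq c y i - sq c x i| = `|sin (c * y i 0) - sin (c * x i 0)| / 2.
    rewrite -[2 in RHS]ger0_norm// -normf_div; congr `|_|; rewrite /sq; lra.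
  have : c * `|y i 0 - x i 0| <= dl * c by move: h1 h2; rewrite h3 /eta; lra.
  by rewrite mulrC ler_pM2r.
exists (fun x => \sum_phi val phi * weight c N phi x); split.
- apply: trig_poly_sum => phi; apply: trig_polyM => //; exact: trig_poly_cst.
- move=> x; apply: le_trans (ler_norm_sum _ _ _) _.
  rewrite -[leRHS]mulr1 -(sum_weight c N x) mulr_sumr; apply: ler_sum => phi _.
  by rewrite normrM (ger0_norm (weight_ge0 _ _ _)) ler_wpM2r.
move=> x xb.
(* Chebyshev: away from the grid points close to x, the trivial bound [2 * M] is
   paid for by the squared deviation. *)
have pointwise phi : `|val phi - f x| <= e / 2
    + 2 * M / (N%:R * eta) ^+ 2 * \sum_i ((phi i)%:R - N%:R * sq c x i) ^+ 2.
  have S0 : 0 <= \sum_i ((phi i)%:R - N%:R * sq c x i) ^+ 2.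
    by apply: sumr_ge0 => i _; exact: sqr_ge0.
  have C0 : 0 <= 2 * M / (N%:R * eta) ^+ 2.
    by rewrite divr_ge0 ?sqr_ge0// mulr_ge0.
  have [cl|ncl] := pselect (close phi x).
    by apply: le_trans (valP _ _ cl) _; rewrite lerDl mulr_ge0.
  have [i ieta] : exists i, eta < `|(phi i)%:R / N%:R - sq c x i|.
    apply: contrapT => /forallNP h; apply: ncl; split => // i.
    by rewrite leNgt; apply/negP; exact: h.
  have Si : (N%:R * eta) ^+ 2 <= \sum_i ((phi i)%:R - N%:R * sq c x i) ^+ 2.
    apply: (@le_trans _ _ (((phi i)%:R - N%:R * sq c x i) ^+ 2)); last first.
      by rewrite (bigD1 i)//= lerDl; apply: sumr_ge0 => j _; exact: sqr_ge0.
    rewrite (_ : (phi i)%:R - N%:R * sq c x i = N%:R * ((phi i)%:R / N%:R - sq c x i)).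
      rewrite exprMn [leRHS]exprMn ler_pM2l ?exprn_gt0// -[leRHS]real_normK ?num_real//.
      by rewrite lerXn2r ?nnegrE ?normr_ge0 ?ltW.
    by field; rewrite gt_eqF.
  apply: (@le_trans _ _ (2 * M)).
    by apply: le_trans (ler_normB _ _) _; have := valM phi; have := fM x; lra.
  apply: (@le_trans _ _ (2 * M / (N%:R * eta) ^+ 2 * (N%:R * eta) ^+ 2)).
    by rewrite divfK// sqrf_eq0 mulf_neq0 ?gt_eqF.
  by apply: ler_wpDl; [exact: ltW|exact: ler_wpM2l].
have -> : \sum_phi val phi * weight c N phi x - f x
    = \sum_phi (val phi - f x) * weight c N phi x.
  rewrite -[f x in LHS]mulr1 -(sum_weight c N x) mulr_sumr -sumrB.
  by apply: eq_bigr => phi _; rewrite mulrBl.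
apply: le_trans (ler_norm_sum _ _ _) _.
apply: (@le_trans _ _ (\sum_phi (e / 2 * weight c N phi x
   + 2 * M / (N%:R * eta) ^+ 2 *
     \sum_i weight c N phi x * ((phi i)%:R - N%:R * sq c x i) ^+ 2))).
  apply: ler_sum => phi _; rewrite normrM (ger0_norm (weight_ge0 _ _ _)).
  rewrite -mulr_sumr (mulrCA (_ / _)) (mulrC (e / 2)) -mulrDr mulrC.
  by rewrite ler_wpM2l.
rewrite big_split/= -!mulr_sumr sum_weight mulr1 exchange_big/=.
rewrite [leRHS](_ : e = e / 2 + e / 2); last by lra.
rewrite lerD2l.
apply: (@le_trans _ _ (2 * M / (N%:R * eta) ^+ 2 * \sum_(i < n) N%:R)).
  apply: ler_wpM2l; first by rewrite divr_ge0 ?sqr_ge0// mulr_ge0.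
  by apply: ler_sum => i _; exact: sum_weight_dev.
rewrite sumr_const card_ord; apply: le_trans NP.
rewrite -mulr_natr le_eqVlt; apply/orP; left; apply/eqP.
by field; rewrite !gt_eqF.
Qed.

End bernstein_approximation.

(** * Convergence in distribution from Gaussian linear forms *)

Lemma continuous_scale (R : realType) (U : topologicalType) (c : R) (f : U -> R) :
  continuous f -> continuous (fun x => c * f x).
Proof. by move=> cf x; apply: cvgM; [exact: cvg_cst|exact: cf]. Qed.

Lemma continuous_cos_shift (R : realType) (U : topologicalType) (c : R) (f : U -> R) :
  continuous f -> continuous (fun x => cos (c + f x)).
Proof.
move=> cf x; apply: (@continuous_comp _ _ _ (fun x => c + f x) cos).
  by apply: cvgD; [exact: cvg_cst|exact: cf].
exact: continuous_cos.
Qed.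

Lemma measurable_cos_shift (R : realType) (c : R) :
  measurable_fun setT (fun x : R => cos (c + x)).
Proof.
apply: continuous_measurable_fun.
by apply: (@continuous_cos_shift R R c id) => x; exact: cvg_id.
Qed.

Lemma continuous_dotp (R : realType) n (u : 'cV[R]_n) :
  continuous (fun x : 'cV[R]_n => dotp u x).
Proof.
apply: continuous_big => [|i _]; first exact: add_continuous.
by apply: continuous_scale; exact: coord_continuous.
Qed.

Lemma borel_continuous_preimage (R : realType) n (f : 'cV[R]_n -> R) (A : set R) :
  continuous f -> measurable A -> borel (f @^-1` A).
Proof.
move=> cf mA.
pose G : set (set 'cV[R]_n) := [set U | open U].
have mf : measurable_fun setT (f : g_sigma_algebraType G -> R).
  apply: (measurability _ (RGenOInfty.measurableE R)) => _ [_ [a ->] <-].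
  rewrite setTI; apply: sub_sigma_algebra; apply: open_comp => [x _|]; first exact: cf.
  by rewrite set_itvE; exact: open_gt.
by have := mf measurableT A mA; rewrite setTI.
Qed.

Lemma random_vector_comp d (T : measurableType d) (R : realType) n
    (X : T -> 'cV[R]_n) (f : 'cV[R]_n -> R) :
  random_vector X -> continuous f -> measurable_fun setT (f \o X).
Proof.
move=> rX cf _ A mA; rewrite setTI comp_preimage.
by apply: rX; exact: borel_continuous_preimage.
Qed.

Lemma expectation_Rintegral d (T : measurableType d) (R : realType)
    (P : probability T R) (g : T -> R) (C : R) :
  measurable_fun setT g -> (forall w, `|g w| <= C) ->
  'E_P[g]%E = (\int[P]_w g w)%:E.
Proof.
move=> mg gC; rewrite unlock /Rintegral fineK//.
by apply: integrable_fin_num => //; exact: bounded_integrable gC.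
Qed.

(** The radius [r] does not depend on the particular [m] and [v]: this gives tightness
of a sequence of laws with bounded means and variances. *)
Lemma gaussian_rv_tail d (T : measurableType d) (R : realType)
    (P : probability T R) (Z : T -> R) (m v a r : R) :
  gaussian_rv P Z m v -> 0 <= a -> `|m| + Num.sqrt v * a <= r ->
  (P (Z @^-1` [set x : R | (r < `|x|)%R]) <= (2 * expR (- (a ^+ 2 / 4)))%:E)%E.
Proof.
move=> [mZ v0 lZ] a0 mr.
have mA : measurable [set x : R | r < `|x|].
  rewrite (_ : [set x | _] = (fun x : R => `|x|) @^-1` `]r, +oo[).
    by apply: measurable_preimage => //; exact: measurableT_comp.
  by apply/seteqP; split => x /=; rewrite in_itv/= andbT.
have mB : measurable [set x : R | a <= `|x|].
  rewrite (_ : [set x | _] = (fun x : R => `|x|) @^-1` `[a, +oo[).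
    by apply: measurable_preimage => //; exact: measurableT_comp.
  by apply/seteqP; split => x /=; rewrite in_itv/= andbT.
rewrite lZ// gaussian1E//; apply: le_trans (normal_tail_le a0).
apply: le_measure; rewrite ?inE//.
  exact: (@measurable_preimage _ _ _ (fun x : measurableTypeR R => m + Num.sqrt v * x)
    _ (@measurable_affine R m (Num.sqrt v)) mA).
move=> x /= rx; rewrite leNgt; apply/negP => xa.
have := ler_normD m (Num.sqrt v * x).
rewrite normrM (ger0_norm (sqrtr_ge0 v)).
have := sqrtr_ge0 v; set s := Num.sqrt v in mr rx *; move=> s0.
have : s * `|x| <= s * a by rewrite ler_wpM2l// ltW.
lra.
Qed.

(** Plays the role of the convergence of characteristic functions, without having to
compute them: dominated convergence on the standard Gaussian space. *)
Lemma gaussian_cos_cvg (R : realType) (c m v : R) (mk vk : nat -> R) :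
  mk k @[k --> \oo] --> m -> vk k @[k --> \oo] --> v ->
  (\int[normal_prob 0 1]_x (cos (c + (mk k + Num.sqrt (vk k) * x)))%:E)%E
    @[k --> \oo] -->
  (\int[normal_prob 0 1]_x (cos (c + (m + Num.sqrt v * x)))%:E)%E.
Proof.
move=> cm cv.
have mcos a b : measurable_fun setT
    (fun x : measurableTypeR R => (cos (c + (a + b * x)))%:E).
  apply/measurable_EFinP.
  exact: (measurableT_comp (@measurable_cos_shift R c) (@measurable_affine R a b)).
have cvg_cos : {ae (normal_prob 0 1 : set (measurableTypeR R) -> \bar R), forall x, setT x ->
    (cos (c + (mk k + Num.sqrt (vk k) * x)))%:E @[k --> \oo] -->
    (cos (c + (m + Num.sqrt v * x)))%:E}.
  apply: aeW => x _; apply: cvg_EFin; first exact: nearW.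
  have : cos (c + (mk k + Num.sqrt (vk k) * x)) @[k --> \oo] -->
      cos (c + (m + Num.sqrt v * x)); last by [].
  apply: (@cvg_comp _ _ _ (fun k => c + (mk k + Num.sqrt (vk k) * x)) cos);
    last exact: continuous_cos.
  apply: cvgD; first exact: cvg_cst.
  apply: cvgD => //; apply: cvgM; last exact: cvg_cst.
  exact: (cvg_comp _ _ cv (@sqrt_continuous R v)).
have cos_le : {ae (normal_prob 0 1 : set (measurableTypeR R) -> \bar R), forall x n,
    setT x -> (`|(cos (c + (mk n + Num.sqrt (vk n) * x)))%:E| <= (EFin \o cst (1 : R)%R) x)%E}.
  by apply: aeW => x k _; rewrite /= lee_fin; exact: cos_max.
by have [_ _] := dominated_convergence measurableT (fun k => mcos (mk k) (Num.sqrt (vk k)))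
  (mcos _ _) cvg_cos (finite_measure_integrable_cst _ 1 measurableT) cos_le.
Qed.

Section cramer_wold.
Context d (T : measurableType d) d' (T' : measurableType d') (R : realType).
Variables (P : probability T R) (P' : probability T' R) (n : nat).
Variables (X : nat -> T -> 'cV[R]_n) (Y : T' -> 'cV[R]_n).
Variables (a b : nat -> 'cV[R]_n -> R) (a' b' : 'cV[R]_n -> R).
Hypothesis rX : forall k, random_vector (X k).
Hypothesis rY : random_vector Y.
Hypothesis lX : forall k u, gaussian_rv P (fun w => dotp u (X k w)) (a k u) (b k u).
Hypothesis lY : forall u, gaussian_rv P' (fun w => dotp u (Y w)) (a' u) (b' u).
Hypothesis cvg_a : forall u, a k u @[k --> \oo] --> a' u.
Hypothesis cvg_b : forall u, b k u @[k --> \oo] --> b' u.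

Let continuous_monomial t : continuous (@trig_monomial R n t).
Proof.
apply: continuous_scale; apply: continuous_cos_shift; exact: continuous_dotp.
Qed.

Let monomial_bound (t : R * R * 'cV[R]_n) x : `|trig_monomial t x| <= `|t.1.1|.
Proof. by rewrite normrM ler_piMr// cos_max. Qed.

Lemma trig_monomial_cvg t :
  \int[P]_w trig_monomial t (X k w) @[k --> \oo] --> \int[P']_w trig_monomial t (Y w).
Proof.
case: t => [[q c] u]; rewrite /trig_monomial/=.
have mcosu : continuous (fun x : 'cV[R]_n => cos (c + dotp u x)).
  by apply: continuous_cos_shift; exact: continuous_dotp.
have cos1 (x : R) : `|cos (c + x)| <= 1 by exact: cos_max.
have mcosc := @measurable_cos_shift R c.
have iX k : P.-integrable setT (EFin \o (fun w => cos (c + dotp u (X k w)))).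
  apply: (@bounded_integrable _ _ _ _ _ 1) => [|w]; last exact: cos1.
  exact: (random_vector_comp (rX k) mcosu).
have iY : P'.-integrable setT (EFin \o (fun w => cos (c + dotp u (Y w)))).
  apply: (@bounded_integrable _ _ _ _ _ 1) => [|w]; last exact: cos1.
  exact: (random_vector_comp rY mcosu).
rewrite RintegralZl//.
under eq_cvg do rewrite RintegralZl//.
apply: cvgM; first exact: cvg_cst.
apply: fine_cvg; rewrite fineK; last exact: integrable_fin_num.
rewrite (gaussian_rv_integral (lY u) mcosc cos1).
under eq_cvg => k do rewrite (gaussian_rv_integral (lX k u) mcosc cos1).
exact: gaussian_cos_cvg.
Qed.

Let sum_bound (s : seq (R * R * 'cV[R]_n)) x :
  `|\sum_(t <- s) trig_monomial t x| <= \sum_(t <- s) `|t.1.1|.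
Proof. by apply: le_trans (ler_norm_sum _ _ _) _; apply: ler_sum. Qed.

Let continuous_sum (s : seq (R * R * 'cV[R]_n)) :
  continuous (fun x : 'cV[R]_n => \sum_(t <- s) trig_monomial t x).
Proof.
apply: continuous_big => [|t _]; first exact: add_continuous.
exact: continuous_monomial.
Qed.

Lemma trig_poly_cvg s :
  \int[P]_w \sum_(t <- s) trig_monomial t (X k w) @[k --> \oo] -->
  \int[P']_w \sum_(t <- s) trig_monomial t (Y w).
Proof.
have int_X k s' : P.-integrable setT
    (EFin \o (fun w => \sum_(t <- s') trig_monomial t (X k w))).
  apply: (@bounded_integrable _ _ _ _ _ (\sum_(t <- s') `|t.1.1|)) => [|w] //.
  exact: (random_vector_comp (rX k) (@continuous_sum s')).
have int_Y s' : P'.-integrable setT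
    (EFin \o (fun w => \sum_(t <- s') trig_monomial t (Y w))).
  apply: (@bounded_integrable _ _ _ _ _ (\sum_(t <- s') `|t.1.1|)) => [|w] //.
  exact: (random_vector_comp rY (@continuous_sum s')).
have int1_X k t : P.-integrable setT (EFin \o (fun w => trig_monomial t (X k w))).
  apply: (@bounded_integrable _ _ _ _ _ `|t.1.1|) => [|w] //.
  exact: (random_vector_comp (rX k) (@continuous_monomial t)).
have int1_Y t : P'.-integrable setT (EFin \o (fun w => trig_monomial t (Y w))).
  apply: (@bounded_integrable _ _ _ _ _ `|t.1.1|) => [|w] //.
  exact: (random_vector_comp rY (@continuous_monomial t)).
elim: s => [|t s IH].
  have E0 d0 (T0 : measurableType d0) (P0 : probability T0 R) (I : Type) (F : I -> T0 -> R) :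
      \int[P0]_w \sum_(t <- [::]) F t w = 0 :> R.
    under eq_Rintegral do rewrite big_nil.
    by rewrite Rintegral_cst// mul0r.
  rewrite E0 (_ : (fun k => _) = cst 0); first exact: cvg_cst.
  by apply/funext => k; rewrite E0.
rewrite (_ : \int[P']_w \sum_(t0 <- t :: s) trig_monomial t0 (Y w)
  = \int[P']_w trig_monomial t (Y w)
    + \int[P']_w \sum_(t <- s) trig_monomial t (Y w)); last first.
  by rewrite -RintegralD//; apply: eq_Rintegral => w _; rewrite big_cons.
rewrite (_ : (fun k => _) = fun k => \int[P]_w trig_monomial t (X k w)
    + \int[P]_w \sum_(t <- s) trig_monomial t (X k w)); last first.
  apply/funext => k.
  by rewrite -RintegralD//; apply: eq_Rintegral => w _; rewrite big_cons.
by apply: cvgD => //; exact: trig_monomial_cvg.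
Qed.

(** The trigonometric approximant of [f] is close to [f] on a box that carries most
of the mass of [Y] and of all late [X k], uniformly in [k] by the
Gaussian tails; outside of it both functions are bounded by [M]. *)
Lemma cramer_wold : cvg_in_distribution P P' X Y.
Proof.
move=> f cf [M0 fM0].
pose M := `|M0| + 1.
have M_gt0 : 0 < M by rewrite ltr_wpDl.
have fM x : `|f x| <= M.
  by apply: le_trans (fM0 x) _; have := ler_norm M0; rewrite /M; lra.
have mfX k : measurable_fun setT (f \o X k) by exact: random_vector_comp.
have mfY : measurable_fun setT (f \o Y) by exact: random_vector_comp.
rewrite (expectation_Rintegral P' mfY (fun w => fM (Y w))).
under eq_cvg => k do rewrite (expectation_Rintegral P (mfX k) (fun w => fM (X k w))).
apply: cvg_EFin; first exact: nearW.
apply/cvgrPdist_le => e e0 /=.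
(* [A] is large enough for the tails of the [n] coordinates to cost at most [e / 8];
   the bound [expR q >= 1 + q] suffices for that. *)
pose q := 32 * M * n%:R / e.
have q0 : 0 <= q by rewrite divr_ge0 ?mulr_ge0 ?ler0n// ltW.
pose A := 2 * Num.sqrt q.
have A0 : 0 <= A by rewrite mulr_ge0 ?sqrtr_ge0.
pose tau := 2 * expR (- (A ^+ 2 / 4)).
have tau_ge0 : 0 <= tau by rewrite mulr_ge0 ?expR_ge0.
have tauP : 2 * M * (n%:R * tau) <= e / 8.
  have qtau : tau * (1 + q) <= 2.
    rewrite /tau /A exprMn sqr_sqrtr// (_ : 2 ^+ 2 * q / 4 = q); last by field.
    rewrite expRN -mulrA ler_piMr// mulrC ler_pdivrMr ?expR_gt0// mul1r.
    exact: expR_ge1Dx.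
  have : tau * q <= 2 by nra.
  rewrite /q mulrA ler_pdivrMr//; lra.
pose ei (i : 'I_n) : 'cV[R]_n := delta_mx i 0.
have dotp_ei i x : dotp (ei i) x = x i 0 by exact: dotp_delta.
pose ri i := `|a' (ei i)| + 1 + Num.sqrt (b' (ei i) + 1) * A.
have ri0 i : 0 <= ri i by rewrite !addr_ge0// mulr_ge0// sqrtr_ge0.
pose r := 1 + \sum_i ri i.
have ri_le i : ri i <= r.
  rewrite /r (bigD1 i)//= addrCA lerDl addr_ge0//.
  by apply: sumr_ge0 => j _; exact: ri0.
have r0 : 0 < r by rewrite ltr_pwDl// sumr_ge0.
pose bad := [set x : R | r < `|x|].
have mbad : measurable bad.
  rewrite (_ : bad = (fun x : R => `|x|) @^-1` `]r, +oo[).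
    by apply: measurable_preimage => //; exact: measurableT_comp.
  by apply/seteqP; split => x /=; rewrite in_itv/= andbT.
have e80 : 0 < e / 8 by rewrite divr_gt0.
have [h [[s hs] hM hf]] := trig_poly_approx cf fM r0 e80.
have ch : continuous h.
  rewrite (_ : h = fun x => \sum_(t <- s) trig_monomial t x); last exact/funext.
  exact: continuous_sum.
(* stated for an arbitrary law, as it serves both [Y] and every late [X k] *)
have error d0 (T0 : measurableType d0) (P0 : probability T0 R) (Z : T0 -> 'cV[R]_n) :
    random_vector Z ->
    (forall i, (P0 ((fun w => dotp (ei i) (Z w)) @^-1` bad) <= tau%:E)%E) ->
    `|\int[P0]_w f (Z w) - \int[P0]_w h (Z w)| <= e / 4.
  move=> rZ tailZ.
  have iM (g : 'cV[R]_n -> R) (C : R) : continuous g -> (forall x, `|g x| <= C) ->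
      P0.-integrable setT (EFin \o (fun w => g (Z w))).
    move=> cg gC; apply: (@bounded_integrable _ _ _ _ _ C) => [|w]; last exact: gC.
    exact: random_vector_comp rZ cg.
  have mZi i : measurable_fun setT (fun w => dotp (ei i) (Z w)).
    exact: random_vector_comp rZ (@continuous_dotp R n (ei i)).
  pose bi i := (fun w => dotp (ei i) (Z w)) @^-1` bad.
  have mbi i : measurable (bi i) by exact: measurable_preimage.
  pose g w : R := \sum_i \1_(bi i) w.
  have mg : measurable_fun setT g.
    by apply: measurable_sum => i; exact: measurable_indic.
  have g0 w : 0 <= g w by apply: sumr_ge0 => i _; rewrite indicE.
  have gn w : `|g w| <= n%:R.
    rewrite ger0_norm// -[n in leRHS]card_ord -sumr_const; apply: ler_sum => i _.
    by rewrite indicE lern1 leq_b1.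
  have ig : P0.-integrable setT (EFin \o g) by exact: bounded_integrable gn.
  have intg : \int[P0]_w g w <= n%:R * tau.
    rewrite -lee_fin /Rintegral fineK; last exact: integrable_fin_num.
    rewrite (_ : (\int[P0]_x (g x)%:E)%E = (\sum_(i < n) P0 (bi i))%E).
      apply: (@le_trans _ _ (\sum_(i < n) tau%:E)%E).
        by apply: lee_sum => i _; exact: tailZ.
      by rewrite sumEFin sumr_const card_ord mulr_natl.
    under eq_integral do rewrite /g -sumEFin.
    rewrite ge0_integral_sum//.
    - by apply: eq_bigr => i _; rewrite integral_indic// setIT.
    - by move=> i; apply/measurable_EFinP; exact: measurable_indic.
  rewrite -RintegralB//; [|exact: iM cf fM|exact: iM ch hM].
  have mfh : measurable_fun setT (fun w => f (Z w) - h (Z w)).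
    apply: measurable_funB; [exact: random_vector_comp rZ cf|].
    exact: random_vector_comp rZ ch.
  have ifh : P0.-integrable setT (EFin \o (fun w => f (Z w) - h (Z w))).
    apply: (@bounded_integrable _ _ _ _ _ (2 * M)) => // w.
    by apply: le_trans (ler_normB _ _) _; have := fM (Z w); have := hM (Z w); lra.
  apply: le_trans (le_normr_Rintegral measurableT ifh) _.
  apply: (@le_trans _ _ (\int[P0]_w (e / 8 + 2 * M * g w))).
    apply: le_Rintegral => //.
    - exact: integrable_norm ifh.
    - apply: (@bounded_integrable _ _ _ _ _ (e / 8 + 2 * M * n%:R)) => [|w].
        by apply: measurable_funD => //; exact: measurable_funM.
      rewrite ger0_norm; last by rewrite addr_ge0 ?mulr_ge0// ltW.
      rewrite lerD2l; apply: ler_wpM2l; first by rewrite mulr_ge0// ltW.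
      by apply: le_trans (ler_norm _) _; exact: gn.
    move=> w _; have [zr|] := pselect (forall i, `|Z w i 0| <= r).
      rewrite distrC; apply: le_trans (hf _ zr) _.
      by rewrite lerDl mulr_ge0// mulr_ge0// ltW.
    move=> /existsNP[i /negP]; rewrite -ltNge => zi.
    have gi : 1 <= g w.
      rewrite /g (bigD1 i)//= indicE mem_set/=; last by rewrite /bi/= dotp_ei.
      by rewrite lerDl; apply: sumr_ge0 => j _; rewrite indicE.
    apply: le_trans (ler_normB _ _) _.
    have := fM (Z w); have := hM (Z w); have := ltW e80.
    have : 2 * M <= 2 * M * g w by rewrite ler_peMr// mulr_ge0// ltW.
    lra.
  rewrite RintegralD//; last 2 first.
  - exact: (finite_measure_integrable_cst P0 (e / 8) measurableT).
  - by apply: (@bounded_integrable _ _ _ _ _ (2 * M * n%:R)) => [|w];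
      [exact: measurable_funM|rewrite normrM ger0_norm ?ler_wpM2l ?mulr_ge0// ltW].
  have -> : \int[P0]__ (e / 8) = e / 8.
    rewrite Rintegral_cst// [X in fine X](_ : _ = 1%E) ?mulr1//.
    exact: probability_setT.
  rewrite (@RintegralZl _ _ _ P0 setT g (2 * M) measurableT ig).
  have : 2 * M * \int[P0]_w g w <= 2 * M * (n%:R * tau).
    by rewrite ler_wpM2l// mulr_ge0// ltW.
  by move: tauP; lra.
have tail_le d0 (T0 : measurableType d0) (P0 : probability T0 R) (Z : T0 -> 'cV[R]_n)
    i m v : gaussian_rv P0 (fun w => dotp (ei i) (Z w)) m v ->
    `|m| <= `|a' (ei i)| + 1 -> v <= b' (ei i) + 1 ->
    (P0 ((fun w => dotp (ei i) (Z w)) @^-1` bad) <= tau%:E)%E.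
  move=> lZ ma vb; apply: gaussian_rv_tail lZ A0 _.
  apply: le_trans (ri_le i); rewrite /ri.
  apply: lerD => //.
  by apply: ler_wpM2r; [rewrite /A mulr_ge0 ?sqrtr_ge0|exact: ler_wsqrtr].
have errY : `|\int[P']_w f (Y w) - \int[P']_w h (Y w)| <= e / 4.
  apply: error => // i; apply: tail_le (lY (ei i)) _ _; last by rewrite lerDl.
  by rewrite lerDl.
have hcvg := @trig_poly_cvg s.
have h_cvg : \int[P]_w h (X k w) @[k --> \oo] --> \int[P']_w h (Y w).
  rewrite (_ : \int[P']_w h (Y w) = \int[P']_w \sum_(t <- s) trig_monomial t (Y w)).
    rewrite (_ : (fun k => _) = fun k => \int[P]_w \sum_(t <- s) trig_monomial t (X k w))//.
    by apply/funext => k; apply: eq_Rintegral => w _.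
  by apply: eq_Rintegral => w _.
have e40 : 0 < e / 4 by rewrite divr_gt0.
near=> k.
have errX : `|\int[P]_w f (X k w) - \int[P]_w h (X k w)| <= e / 4.
  apply: error => // i; apply: tail_le (lX k (ei i)) _ _.
    have : `|a' (ei i) - a k (ei i)| <= 1.
      move: i; near: k; apply: filter_forall => i.
      by move/cvgrPdist_le : (@cvg_a (ei i)) => /(_ _ ltr01).
    by move=> h1; have := ler_normB (a' (ei i)) (a' (ei i) - a k (ei i)); rewrite subKr; lra.
  have : `|b' (ei i) - b k (ei i)| <= 1.
    move: i; near: k; apply: filter_forall => i.
    by move/cvgrPdist_le : (@cvg_b (ei i)) => /(_ _ ltr01).
  by rewrite ler_norml => /andP[h1 h2]; lra.
have hk : `|\int[P']_w h (Y w) - \int[P]_w h (X k w)| <= e / 4.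
  by near: k; move/cvgrPdist_le : h_cvg => /(_ _ e40).
set fY := \int[P']_w f (Y w) in errY *; set hY := \int[P']_w h (Y w) in errY hk.
set fX := \int[P]_w f (X k w) in errX *; set hX := \int[P]_w h (X k w) in errX hk.
rewrite -[X in `|X|]/(fY - fX).
rewrite (_ : fY - fX = (fY - hY) + (hY - hX) - (fX - hX)); last by lra.
apply: le_trans (ler_normB _ _) _.
have := ler_normD (fY - hY) (hY - hX); lra.
Unshelve. all: by end_near.
Qed.

End cramer_wold.

(** * Euclidean norms and bounded families of matrices *)

Section inner_product.
Context (R : realType).

Lemma dotpC n (u v : 'cV[R]_n) : dotp u v = dotp v u.
Proof. by rewrite /dotp; apply: eq_bigr => i _; rewrite mulrC. Qed.

Lemma dotpDr n (u v w : 'cV[R]_n) : dotp u (v + w) = dotp u v + dotp u w.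
Proof. by rewrite dotpC dotpDl !(dotpC _ u). Qed.

Lemma dotpZl n c (u v : 'cV[R]_n) : dotp (c *: u) v = c * dotp u v.
Proof. by rewrite /dotp mulr_sumr; apply: eq_bigr => i _; rewrite mxE mulrA. Qed.

Lemma dotpZr n c (u v : 'cV[R]_n) : dotp u (c *: v) = c * dotp u v.
Proof. by rewrite dotpC dotpZl dotpC. Qed.

Lemma dotp_sumr n (I : Type) (s : seq I) (u : 'cV[R]_n) (F : I -> 'cV[R]_n) :
  dotp u (\sum_(i <- s) F i) = \sum_(i <- s) dotp u (F i).
Proof.
elim/big_rec2: _ => [|i y x _ <-]; last by rewrite dotpDr.
by rewrite dotpC dotp0.
Qed.

Lemma dotpE n (u v : 'cV[R]_n) : dotp u v = (u^T *m v) 0 0.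
Proof. by rewrite mxE; apply: eq_bigr => i _; rewrite mxE. Qed.

Lemma dotp_mulmx m n (A : 'M[R]_(m, n)) u v : dotp u (A *m v) = dotp (A^T *m u) v.
Proof. by rewrite !dotpE trmx_mul trmxK mulmxA. Qed.

Lemma dotp_col m n (u1 v1 : 'cV[R]_m) (u2 v2 : 'cV[R]_n) :
  dotp (col_mx u1 u2) (col_mx v1 v2) = dotp u1 v1 + dotp u2 v2.
Proof.
rewrite /dotp big_split_ord/=; congr (_ + _); apply: eq_bigr => i _.
  by rewrite !col_mxEu.
by rewrite !col_mxEd.
Qed.

Lemma sqnorm_ge0 n (u : 'cV[R]_n) : 0 <= sqnorm u.
Proof. by apply: sumr_ge0 => i _; rewrite -expr2 sqr_ge0. Qed.

Lemma sqnorm_eq0 n (u : 'cV[R]_n) : sqnorm u = 0 -> u = 0.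
Proof.
move=> u0; apply/matrixP => i j; rewrite (ord1 j) mxE.
have h k : 0 <= u k 0 * u k 0 by rewrite -expr2 sqr_ge0.
have /eqP : u i 0 * u i 0 = 0.
  by apply: (psumr_eq0P (P := xpredT) (F := fun k => u k 0 * u k 0)).
by rewrite mulf_eq0 orbb => /eqP.
Qed.

Lemma sqnormD n (u v : 'cV[R]_n) :
  sqnorm (u + v) = sqnorm u + 2 * dotp u v + sqnorm v.
Proof. by rewrite /sqnorm dotpDl !dotpDr (dotpC v u); lra. Qed.

Lemma sqnormZ n c (u : 'cV[R]_n) : sqnorm (c *: u) = c ^+ 2 * sqnorm u.
Proof. by rewrite /sqnorm dotpZl dotpZr mulrA. Qed.

Definition nrm n (u : 'cV[R]_n) : R := Num.sqrt (sqnorm u).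

Lemma nrm_ge0 n (u : 'cV[R]_n) : 0 <= nrm u. Proof. exact: sqrtr_ge0. Qed.

Lemma sqr_nrm n (u : 'cV[R]_n) : nrm u ^+ 2 = sqnorm u.
Proof. by rewrite sqr_sqrtr ?sqnorm_ge0. Qed.

Lemma nrmZ n c (u : 'cV[R]_n) : nrm (c *: u) = `|c| * nrm u.
Proof. by rewrite /nrm sqnormZ sqrtrM ?sqr_ge0// sqrtr_sqr. Qed.

Lemma cauchy_schwarz n (u v : 'cV[R]_n) : dotp u v <= nrm u * nrm v.
Proof.
have := sqnorm_ge0 (nrm v *: u + (- nrm u) *: v).
rewrite sqnormD !sqnormZ dotpZl dotpZr -!sqr_nrm => h.
have [u0|u0] := eqVneq (nrm u) 0.
  have -> : u = 0 by apply: sqnorm_eq0; rewrite -sqr_nrm u0 expr0n.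
  by rewrite dotp0 mulr_ge0 ?nrm_ge0.
have [v0|v0] := eqVneq (nrm v) 0.
  have -> : v = 0 by apply: sqnorm_eq0; rewrite -sqr_nrm v0 expr0n.
  by rewrite dotpC dotp0 mulr_ge0 ?nrm_ge0.
have uv : 0 < nrm u * nrm v.
  by rewrite mulr_gt0// lt_neqAle eq_sym ?u0 ?v0 nrm_ge0.
rewrite -(ler_pM2l uv); nra.
Qed.

Lemma cauchy_schwarz_abs n (u v : 'cV[R]_n) : `|dotp u v| <= nrm u * nrm v.
Proof.
rewrite ler_norml cauchy_schwarz andbT lerNl -dotpNl.
have := cauchy_schwarz (- u) v; rewrite -scaleN1r nrmZ normrN1 mul1r.
by rewrite scaleN1r.
Qed.

Lemma nrmD n (u v : 'cV[R]_n) : nrm (u + v) <= nrm u + nrm v.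
Proof.
rewrite -(@ler_pXn2r _ 2) ?nnegrE ?addr_ge0 ?nrm_ge0// sqr_nrm sqnormD.
rewrite -!sqr_nrm; have := cauchy_schwarz u v; nra.
Qed.

Lemma nrmD_ge n (u v : 'cV[R]_n) : nrm u - nrm v <= nrm (u + v).
Proof.
have := nrmD (u + v) (- v); rewrite addrK -(scaleN1r v) nrmZ normrN1 mul1r; lra.
Qed.

Lemma nrm_le_coord n (u : 'cV[R]_n) (B : R) :
  0 <= B -> (forall i, `|u i 0| <= B) -> nrm u <= n%:R * B.
Proof.
move=> B0 uB.
rewrite -(@ler_pXn2r _ 2) ?nnegrE ?mulr_ge0 ?nrm_ge0// sqr_nrm.
apply: (@le_trans _ _ (\sum_(i < n) B ^+ 2)).
  apply: ler_sum => i _; rewrite -expr2 -real_normK ?num_real//.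
  by rewrite lerXn2r// nnegrE.
rewrite sumr_const card_ord exprMn -[leLHS]mulr_natl ler_wpM2r ?sqr_ge0//.
by rewrite -natrX ler_nat; case: n {u uB} => // n; rewrite expnS leq_pmulr// expn_gt0.
Qed.

Lemma coord_le_nrm n (u : 'cV[R]_n) i : `|u i 0| <= nrm u.
Proof.
rewrite -(@ler_pXn2r _ 2) ?nnegrE ?nrm_ge0// sqr_nrm real_normK ?num_real//.
rewrite /sqnorm /dotp (bigD1 i)//= -expr2 lerDl.
by apply: sumr_ge0 => j _; rewrite -expr2 sqr_ge0.
Qed.

End inner_product.

Section bounded_families.
Context (R : realType).

(** The class of remainders of expansions at [e = 0]. Confining [e] to the unit
interval makes [e] itself a bounded factor. *)
Definition bddm m n (A : R -> 'M[R]_(m, n)) : Prop :=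
  exists2 C, 0 <= C & forall e, 0 <= e <= 1 -> forall i j, `|A e i j| <= C.

Definition bdds (f : R -> R) : Prop :=
  exists2 C, 0 <= C & forall e, 0 <= e <= 1 -> `|f e| <= C.

Lemma bddm_cst m n (A : 'M[R]_(m, n)) : bddm (fun=> A).
Proof. by exists `|A| => // e _; exact: (proj1 (mx_norm_leP A (normr_ge0 A))). Qed.

Lemma bdds_id : bdds id.
Proof. by exists 1 => // e /andP[e0 e1]; rewrite ger0_norm. Qed.

Lemma bdds_cst c : bdds (fun=> c).
Proof. by exists `|c|. Qed.

Lemma bddsD f g : bdds f -> bdds g -> bdds (fun e => f e + g e).
Proof.
move=> [C C0 fC] [D D0 gD]; exists (C + D); first exact: addr_ge0.
by move=> e e01; apply: le_trans (ler_normD _ _) _; rewrite lerD ?fC ?gD.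
Qed.

Lemma bddmD m n (A B : R -> 'M[R]_(m, n)) : bddm A -> bddm B -> bddm (fun e => A e + B e).
Proof.
move=> [C C0 fC] [D D0 gD]; exists (C + D); first exact: addr_ge0.
move=> e e01 i j; rewrite mxE; apply: le_trans (ler_normD _ _) _.
by rewrite lerD ?fC ?gD.
Qed.

Lemma bddmZ m n f (A : R -> 'M[R]_(m, n)) : bdds f -> bddm A -> bddm (fun e => f e *: A e).
Proof.
move=> [C C0 fC] [D D0 gD]; exists (C * D); first exact: mulr_ge0.
by move=> e e01 i j; rewrite mxE normrM ler_pM ?fC ?gD.
Qed.

Lemma bddmM m n p (A : R -> 'M[R]_(m, n)) (B : R -> 'M[R]_(n, p)) :
  bddm A -> bddm B -> bddm (fun e => A e *m B e).
Proof.
move=> [C C0 fC] [D D0 gD]; exists (n%:R * (C * D)); first by rewrite !mulr_ge0.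
move=> e e01 i j; rewrite mxE; apply: le_trans (ler_norm_sum _ _ _) _.
apply: (@le_trans _ _ (\sum_(k < n) C * D)).
  by apply: ler_sum => k _; rewrite normrM ler_pM ?fC ?gD.
by rewrite sumr_const card_ord mulr_natl.
Qed.

Lemma bddm_tr m n (A : R -> 'M[R]_(m, n)) : bddm A -> bddm (fun e => (A e)^T).
Proof. by move=> [C C0 fC]; exists C => // e e01 i j; rewrite mxE fC. Qed.

Lemma bddm_block m1 m2 n1 n2 (A : R -> 'M[R]_(m1, n1)) (B : R -> 'M[R]_(m1, n2))
    (C : R -> 'M[R]_(m2, n1)) (D : R -> 'M[R]_(m2, n2)) :
  bddm A -> bddm B -> bddm C -> bddm D ->
  bddm (fun e => block_mx (A e) (B e) (C e) (D e)).
Proof.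
move=> [a a0 hA] [b b0 hB] [c c0 hC] [q q0 hD].
exists (a + b + c + q); first by rewrite !addr_ge0.
move=> e e01 i j; rewrite -(splitK i) -(splitK j).
case: (fintype.split i) => i'; case: (fintype.split j) => j' /=;
  rewrite ?block_mxEul ?block_mxEur ?block_mxEdl ?block_mxEdr.
- by have := hA e e01 i' j'; lra.
- by have := hB e e01 i' j'; lra.
- by have := hC e e01 i' j'; lra.
- by have := hD e e01 i' j'; lra.
Qed.

Lemma bddm_nrm m n (A : R -> 'M[R]_(m, n)) : bddm A ->
  exists2 C, 0 <= C & forall e, 0 <= e <= 1 -> forall u, nrm (A e *m u) <= C * nrm u.
Proof.
move=> [C C0 AC]; exists (m%:R * (n%:R * C)); first by rewrite !mulr_ge0.
move=> e e01 u; rewrite -mulrA; apply: nrm_le_coord => [|i].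
  by rewrite !mulr_ge0// nrm_ge0.
rewrite mxE; apply: le_trans (ler_norm_sum _ _ _) _.
apply: (@le_trans _ _ (\sum_(k < n) C * nrm u)).
  by apply: ler_sum => k _; rewrite normrM ler_pM// ?AC// coord_le_nrm.
by rewrite sumr_const card_ord -mulrA mulr_natl.
Qed.

End bounded_families.

(** * Covariance matrices and their factors *)

Section covariance_series.
Context (R : realType) (m n : nat).

(** Polarization: the entries of [S] are the series of the scalar products of columns
of [Q j], which converge absolutely by Cauchy-Schwarz. *)
Lemma covariance_series (Q : nat -> 'M[R]_(m, n)) (C r : R) :
  0 <= r < 1 -> (forall j u, nrm (Q j *m u) <= C * r ^+ j * nrm u) ->
  exists2 S : 'M[R]_n, S^T = S &
    forall u, \sum_(0 <= j < k) sqnorm (Q j *m u) @[k --> \oo] --> dotp u (S *m u).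
Proof.
move=> /andP[r0 r1] QC.
pose ei (i : 'I_n) : 'cV[R]_n := delta_mx i 0.
pose s i l j := dotp (Q j *m ei i) (Q j *m ei l).
have nrm_ei i : nrm (ei i) = 1.
  by rewrite /nrm /sqnorm dotp_delta mxE !eqxx sqrtr1.
have s_cvg i l : cvgn (series (s i l)).
  apply: normed_cvg.
  apply: (@series_le_cvg _ _ (geometric (C ^+ 2) (r ^+ 2))) => [j|j|j|].
  - exact: normr_ge0.
  - by rewrite /geometric /= mulr_ge0 ?sqr_ge0// exprn_ge0 ?sqr_ge0.
  - apply: le_trans (cauchy_schwarz_abs _ _) _.
    rewrite /geometric/= -exprM mulnC exprM -exprMn [leRHS]expr2.
    have h k : nrm (Q j *m ei k) <= C * r ^+ j by have := QC j (ei k); rewrite nrm_ei mulr1.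
    by apply: ler_pM; rewrite ?nrm_ge0.
  - apply: is_cvg_geometric_series.
    by rewrite ger0_norm ?sqr_ge0// expr2; nra.
pose S : 'M[R]_n := \matrix_(i, l) limn (series (s i l)).
exists S.
  apply/matrixP => i l; rewrite !mxE; congr (lim (_ @ \oo)).
  by apply/funext => k; apply: eq_bigr => j _; exact: dotpC.
move=> u.
have uE : u = \sum_i u i 0 *: ei i.
  apply/matrixP => i j; rewrite (ord1 j) summxE (bigD1 i)//= big1.
    by rewrite !mxE !eqxx/= mulr1 addr0.
  by move=> l li; rewrite !mxE eq_sym (negbTE li)/= mulr0.
have -> : dotp u (S *m u) = \sum_i \sum_l u i 0 * u l 0 * limn (series (s i l)).
  rewrite /dotp; apply: eq_bigr => i _; rewrite mxE mulr_sumr.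
  by apply: eq_bigr => l _; rewrite mxE; ring.
have -> : (fun k => \sum_(0 <= j < k) sqnorm (Q j *m u))
    = (fun k => \sum_i \sum_l u i 0 * u l 0 * series (s i l) k).
  apply/funext => k.
  under eq_bigr => j _.
    have -> : sqnorm (Q j *m u) = \sum_i \sum_l u i 0 * u l 0 * s i l j.
      have Qu : Q j *m u = \sum_i u i 0 *: (Q j *m ei i).
        by rewrite {1}uE mulmx_sumr; apply: eq_bigr => i _; rewrite scalemxAr.
      rewrite /sqnorm {2}Qu dotp_sumr [RHS]exchange_big/=.
      apply: eq_bigr => l _; rewrite dotpZr dotpC Qu dotp_sumr mulr_sumr.
      by apply: eq_bigr => i _; rewrite dotpZr dotpC /s; ring.
    over.
  rewrite exchange_big/=; apply: eq_bigr => i _.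
  rewrite exchange_big/=; apply: eq_bigr => l _.
  by rewrite /series/= mulr_sumr.
apply: cvg_big => [|i _]; first exact: add_continuous.
apply: cvg_big => [|l _]; first exact: add_continuous.
by apply: cvgM; [exact: cvg_cst|exact: s_cvg].
Qed.

End covariance_series.

Section cholesky.
Context (R : realType).

(** Block elimination. The Schur complement inherits the lower bound: it is the form
of [S] at the vector whose first coordinate minimizes that form. *)
Lemma cholesky n (S : 'M[R]_n) (lam : R) : 0 < lam -> S^T = S ->
  (forall u, lam * sqnorm u <= dotp u (S *m u)) ->
  exists L : 'M[R]_n, L *m L^T = S.
Proof.
move=> lam0; elim: n S => [|n IH] S.
  by move=> _ _; exists 0; apply/matrixP => -[].
rewrite -[n.+1]/(1 + n)%N in S *.
rewrite -(submxK S).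
move: (ulsubmx S) (ursubmx S) (dlsubmx S) (drsubmx S) => a b c D {S}.
rewrite tr_block_mx => Ssym Spos.
have [aT cb bc DT] := eq_block_mx Ssym.
have posE (x : 'cV_1) (y : 'cV_n) :
    lam * (sqnorm x + sqnorm y) <= dotp x (a *m x) + dotp x (b *m y)
      + (dotp y (c *m x) + dotp y (D *m y)).
  have := Spos (col_mx x y).
  by rewrite /sqnorm !dotp_col mul_block_col dotp_col !dotpDr.
pose al := a 0 0.
have aE : a = al%:M by apply: mx11_scalar.
have al0 : 0 < al.
  have := posE 1%:M 0; rewrite /sqnorm !mulmx0 !(dotpC _ 0) !dotp0 !addr0 !mulmx1.
  rewrite /dotp !big_ord1 !mxE eqxx mulr1n !mul1r mulr1 => h.
  by apply: lt_le_trans lam0 _; rewrite /al.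
have al_neq0 : al != 0 by rewrite gt_eqF.
pose S' := D - al^-1 *: (c *m b).
have S'sym : S'^T = S'.
  by rewrite /S' linearB linearZ/= trmx_mul DT cb bc.
have S'pos u : lam * sqnorm u <= dotp u (S' *m u).
  set w := b *m u.
  have cw : dotp u (c *m w) = sqnorm w by rewrite dotp_mulmx -bc trmxK.
  have S'u : dotp u (S' *m u) = dotp u (D *m u) - al^-1 * sqnorm w.
    rewrite mulmxBl -scalemxAl -mulmxA -/w -scaleN1r !dotpDr !dotpZr cw; lra.
  have := posE (- al^-1 *: w) u.
  rewrite aE mul_scalar_mx -/w -scalemxAr !dotpZr !dotpZl cw -/(sqnorm w).
  rewrite S'u sqnormZ => h.
  have h1 : 0 <= lam * ((- al^-1) ^+ 2 * sqnorm w).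
    by apply: mulr_ge0; [exact: ltW|apply: mulr_ge0; rewrite ?sqr_ge0 ?sqnorm_ge0].
  have h2 : al * (- al^-1 * (- al^-1 * sqnorm w)) = al^-1 * sqnorm w by field.
  by move: h; rewrite h2; lra.
have [L' L'E] := IH S' S'sym S'pos.
pose s := Num.sqrt al.
have s2 : s * s = al by rewrite -expr2 sqr_sqrtr// ltW.
have s0 : s != 0 by rewrite gt_eqF// sqrtr_gt0.
exists (block_mx s%:M 0 (s^-1 *: c) L').
rewrite tr_block_mx mulmx_block tr_scalar_mx linearZ/= cb !trmx0.
rewrite !mul0mx !mulmx0 !addr0 L'E aE !mul_scalar_mx.
rewrite scale_scalar_mx s2 scalerA divff// scale1r.
rewrite mul_mx_scalar scalerA divff// scale1r.
by rewrite -scalemxAl -scalemxAr scalerA -invfM s2 /S' addrC subrK.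
Qed.

(** The hypothesis bounds [L^T] from below, and the transpose of a square matrix has
the same smallest singular value: with [L^T x = v], the scalar product
[<v, v> = <x, L v>] is at most [|x| |L v|]. *)
Lemma factor_nrm_ge n (L S : 'M[R]_n) (lam : R) (v : 'cV[R]_n) : 0 < lam ->
  L *m L^T = S -> (forall u, lam * sqnorm u <= dotp u (S *m u)) ->
  lam * sqnorm v <= sqnorm (L *m v).
Proof.
move=> lam0 LS Spos.
have LT u : lam * sqnorm u <= sqnorm (L^T *m u).
  by rewrite (le_trans (Spos u))// -LS -mulmxA dotp_mulmx.
have Lunit : L \in unitmx.
  rewrite -row_free_unit; apply: inj_row_free => w wL.
  have LTw : L^T *m w^T = 0 by rewrite -trmx_mul wL trmx0.
  have := LT w^T; rewrite LTw /sqnorm dotp0 => h.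
  apply: (can_inj trmxK); rewrite trmx0; apply: sqnorm_eq0.
  by have := sqnorm_ge0 w^T; rewrite /sqnorm; nra.
pose x := invmx L^T *m v.
have LTx : L^T *m x = v by rewrite mulmxA mulmxV ?mul1mx// unitmx_tr.
have := LT x; rewrite LTx => xv.
have vv : sqnorm v <= nrm x * nrm (L *m v).
  rewrite {1}/sqnorm -{1}LTx -dotp_mulmx; exact: cauchy_schwarz.
rewrite -(sqr_nrm v) -(sqr_nrm x) -(sqr_nrm (L *m v)) in xv vv *.
have := nrm_ge0 v; have := nrm_ge0 x; have := nrm_ge0 (L *m v).
move: (nrm v) (nrm x) (nrm (L *m v)) xv vv => p q r xv vv r0 q0 p0.
have [->|pn0] := eqVneq p 0; first by rewrite expr0n mulr0 sqr_ge0.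
have p_gt0 : 0 < p ^+ 2 by rewrite exprn_even_gt0.
rewrite -(ler_pM2l p_gt0) mulrCA.
have : p ^+ 2 * p ^+ 2 <= (q * r) ^+ 2.
  by rewrite -expr2 lerXn2r// nnegrE ?mulr_ge0 ?sqr_ge0.
rewrite exprMn => h; apply: le_trans (ler_wpM2l (ltW lam0) h) _.
by rewrite mulrA ler_wpM2r ?sqr_ge0.
Qed.

End cholesky.

(** * Perturbations of infinitesimal rotations *)

Lemma near_zero_choice (R : realType) (C : R) :
  exists2 e0 : R, 0 < e0 <= 2^-1 & forall e, 0 < e <= e0 -> e * C <= 2^-1.
Proof.
pose D := 2 * (1 + `|C|).
have D0 : 0 < D by rewrite mulr_gt0// ltr_wpDr.
exists (D^-1).
  by rewrite invr_gt0 D0 lef_pV2 ?posrE// /D; have := normr_ge0 C; lra.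
move=> e /andP[e0 eD].
have : e * D <= 1 by move: eD; rewrite -[D^-1]mul1r ler_pdivlMr.
rewrite /D => h; have := ler_norm C; have := normr_ge0 C; nra.
Qed.

Section expansion.
Context (R : realType) (n : nat).
Variables (J : 'M[R]_n) (W : R -> 'M[R]_n).
Hypothesis J_anti : J^T = - J.
Hypothesis W_bdd : bddm W.

Let M e : 'M[R]_n := (1 - e)%:M + (e * (1 - e)) *: J + e ^+ 2 *: W e.

Let dotpJ u : dotp u (J^T *m u) = 0.
Proof.
have := dotp_mulmx J u u; rewrite J_anti mulNmx.
rewrite (dotpC (- _)) -scaleN1r dotpZr; lra.
Qed.

(** [1 + e J^T] changes lengths by a factor [1 + O(e^2)], because [u] and [J^T u] are
orthogonal; the factor [1 - e] thus survives up to [O(e^2)]. *)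
Lemma near_rotation_bounds : exists2 e0 : R, 0 < e0 <= 2^-1 &
  forall e, 0 < e <= e0 -> forall u,
    nrm ((M e)^T *m u) <= (1 - e / 2) * nrm u
    /\ (1 - 2 * e) * nrm u <= nrm ((M e)^T *m u).
Proof.
have [w w0 Ww] := bddm_nrm (bddm_tr W_bdd).
have [k k0 Jk] := bddm_nrm (bddm_tr (bddm_cst J)).
have [e0 e0P e0C] := near_zero_choice (k ^+ 2 + w).
exists e0 => // e e0e u; have := e0C e e0e => eC.
have /andP[e_gt0 e_le] : 0 < e <= 2^-1 by lra.
have e01 : 0 <= e <= 1 by apply/andP; split; lra.
have ME : (M e)^T *m u = (1 - e) *: (u + e *: (J^T *m u)) + e ^+ 2 *: ((W e)^T *m u).
  rewrite /M !linearD/= !linearZ/= tr_scalar_mx !mulmxDl mul_scalar_mx.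
  by rewrite -!scalemxAl !scalerA (mulrC e).
have nu := nrm_ge0 u.
have ek : 0 <= e ^+ 2 * k ^+ 2 by rewrite mulr_ge0 ?sqr_ge0.
have rot : nrm (u + e *: (J^T *m u)) ^+ 2 = nrm u ^+ 2 + e ^+ 2 * nrm (J^T *m u) ^+ 2.
  by rewrite !sqr_nrm sqnormD dotpZr dotpJ sqnormZ; lra.
have rot_ge : nrm u <= nrm (u + e *: (J^T *m u)).
  rewrite -(@ler_pXn2r _ 2) ?nnegrE ?nrm_ge0// rot lerDl.
  by rewrite mulr_ge0 ?sqr_ge0.
have rot_le : nrm (u + e *: (J^T *m u)) <= (1 + e ^+ 2 * k ^+ 2) * nrm u.
  rewrite -(@ler_pXn2r _ 2) ?nnegrE ?nrm_ge0//; last first.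
    by rewrite mulr_ge0// addr_ge0.
  rewrite rot exprMn.
  have h : nrm (J^T *m u) ^+ 2 <= (k * nrm u) ^+ 2.
    by rewrite lerXn2r ?nnegrE ?nrm_ge0 ?mulr_ge0 ?(Jk e).
  have : e ^+ 2 * nrm (J^T *m u) ^+ 2 <= e ^+ 2 * (k * nrm u) ^+ 2.
    by rewrite ler_wpM2l ?sqr_ge0.
  have h2 : 0 <= (e ^+ 2 * k ^+ 2) ^+ 2 * nrm u ^+ 2 by rewrite mulr_ge0 ?sqr_ge0.
  have h3 : 0 <= e ^+ 2 * k ^+ 2 * nrm u ^+ 2 by rewrite mulr_ge0 ?sqr_ge0.
  move: h2 h3; lra.
have We : nrm (e ^+ 2 *: ((W e)^T *m u)) <= e ^+ 2 * w * nrm u.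
  by rewrite nrmZ ger0_norm ?sqr_ge0// -mulrA ler_wpM2l ?sqr_ge0// Ww.
have scal : nrm ((1 - e) *: (u + e *: (J^T *m u))) = (1 - e) * nrm (u + e *: (J^T *m u)).
  by rewrite nrmZ ger0_norm//; lra.
rewrite ME; split.
  apply: le_trans (nrmD _ _) _; rewrite scal.
  have : (1 - e) * nrm (u + e *: (J^T *m u)) <= (1 - e) * ((1 + e ^+ 2 * k ^+ 2) * nrm u).
    by rewrite ler_wpM2l//; lra.
  have h3 : 0 <= e ^+ 3 * k ^+ 2 * nrm u.
    by rewrite mulr_ge0// mulr_ge0 ?sqr_ge0// exprn_ge0// ltW.
  have h4 : e * (e * (k ^+ 2 + w)) * nrm u <= e * 2^-1 * nrm u.
    by rewrite ler_wpM2r// ler_wpM2l// ltW.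
  move: We h3 h4; rewrite !exprS !expr0; lra.
apply: le_trans (nrmD_ge _ _); rewrite scal.
have h1 : (1 - e) * nrm u <= (1 - e) * nrm (u + e *: (J^T *m u)).
  by rewrite ler_wpM2l//; lra.
have h4 : e * (e * (k ^+ 2 + w)) * nrm u <= e * 2^-1 * nrm u.
  by rewrite ler_wpM2r// ler_wpM2l// ltW.
have h5 : 0 <= e ^+ 2 * k ^+ 2 * nrm u by rewrite mulr_ge0.
move: We h1 h4 h5; rewrite !exprS !expr0; nra.
Qed.

End expansion.

(** * SAPD in rescaled coordinates *)

Section sapd_recursion.
Context (R : realType) (d : nat).
Variables (N : 'M[R]_d) (a b : R).
Hypothesis N_sym : N^T = N.
Let N2 := N *m N.
Let N3 := N *m N2.

(** Maps the rescaled iterates back to the original ones, and also the original noise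
to the rescaled one. *)
Definition unscale : 'M[R]_(d + d) := block_mx a^-1%:M 0 0 b^-1%:M.

Definition rotation : 'M[R]_(d + d) := block_mx 0 (- N) N 0.

Definition drift_rem (e : R) : 'M[R]_(d + d) :=
  block_mx (- (1 - e) *: N2) (e *: N3) 0 (- N2).

(** Exact, not truncated: [drift_rem] depends on [e] but stays bounded. *)
Definition drift (e : R) : 'M[R]_(d + d) :=
  (1 - e)%:M + (e * (1 - e)) *: rotation + e ^+ 2 *: drift_rem e.

Definition now_lead : 'M[R]_(d + d) := block_mx (-1)%:M 0 0 2%:M.
Definition now_rem (e : R) : 'M[R]_(d + d) := block_mx 0 (- (2 - e) *: N) 0 (-1)%:M.
Definition late_lead : 'M[R]_(d + d) := block_mx 0 0 0 (-1)%:M.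
Definition late_rem (e : R) : 'M[R]_(d + d) :=
  block_mx (e *: N2) ((1 - e) *: N) (- N) 1%:M.

(** The noises [w_(k+1)] and [w_k] both enter step [k + 2], since the momentum term uses
two consecutive noisy gradients. *)
Definition noise_now (e : R) := (e *: (now_lead + e *: now_rem e)) *m unscale.
Definition noise_late (e : R) := (e *: (late_lead + e *: late_rem e)) *m unscale.

Definition noise_first (e : R) := (e *: block_mx (-1)%:M (- e *: N) 0 1%:M) *m unscale.

(** One noise vector enters through [noise_now] and, a step later, through
[noise_late]; this is its total effect once both have been applied. *)
Definition noise_gain (e : R) := drift e *m noise_now e + noise_late e.

Lemma rotation_anti : rotation^T = - rotation.
Proof. by rewrite /rotation tr_block_mx opp_block_mx !linear0 linearN/= N_sym opprK. Qed.

Lemma bdd_drift_rem : bddm drift_rem.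
Proof.
apply: bddm_block; try exact: bddm_cst.
  apply: bddmZ (bddm_cst _).
  have h := bddsD (bdds_cst (-1)) (@bdds_id R).
  by case: h => C C0 hC; exists C => // e /hC; rewrite opprB addrC.
by apply: bddmZ (bddm_cst _); exact: bdds_id.
Qed.

Let bdds_1B : bdds (fun e : R => 1 - e).
Proof.
by exists 1 => // e /andP[e0 e1]; rewrite ger0_norm; lra.
Qed.

Let bdds_2B : bdds (fun e : R => - (2 - e)).
Proof.
exists 2 => // e /andP[e0 e1]; rewrite ler0_norm; lra.
Qed.

Lemma bdd_now_rem : bddm now_rem.
Proof. by apply: bddm_block; try exact: bddm_cst; apply: bddmZ (bddm_cst _). Qed.

Lemma bdd_late_rem : bddm late_rem.
Proof.
apply: bddm_block; try exact: bddm_cst; apply: bddmZ (bddm_cst _) => //.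
exact: bdds_id.
Qed.

(** At leading order [diag (-1, 2) + diag (0, -1) = diag (-1, 1)]: the momentum
correction of the second block cancels down to an invertible matrix. *)
Lemma noise_gain_expansion : exists2 H : R -> 'M[R]_(d + d), bddm H &
  forall e, noise_gain e
    = (e *: (block_mx (-1)%:M 0 0 1%:M + e *: H e)) *m unscale.
Proof.
pose M1 e := (- 1)%:M + (1 - e) *: rotation + e *: drift_rem e.
have bM1 : bddm M1.
  apply: bddmD; first apply: bddmD; first exact: bddm_cst.
    exact: bddmZ (bddm_cst _).
  by apply: bddmZ bdd_drift_rem; exact: bdds_id.
exists (fun e => now_rem e + late_rem e + M1 e *m (now_lead + e *: now_rem e)).
  apply: bddmD; first exact: bddmD bdd_now_rem bdd_late_rem.
  apply: bddmM => //; apply: bddmD; first exact: bddm_cst.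
  by apply: bddmZ bdd_now_rem; exact: bdds_id.
move=> e; rewrite /noise_gain /noise_now /noise_late mulmxA -mulmxDl; congr (_ *m _).
rewrite -scalemxAr -scalerDr; congr (_ *: _).
have -> : drift e = 1%:M + e *: M1 e.
  rewrite /drift /M1 !scalerDr !scalerA -expr2 !addrA; congr (_ + _ + _).
  by rewrite scale_scalar_mx mulrN1 raddfB/= raddfN.
rewrite mulmxDl mul1mx -scalemxAl.
have -> : block_mx (-1)%:M 0 0 1%:M = now_lead + late_lead.
  rewrite /now_lead /late_lead add_block_mx !addr0; congr block_mx.
  by rewrite -raddfD/=; congr (_%:M); lra.
set p := e *: now_rem e; set q := e *: late_rem e; set r := e *: (M1 e *m _).
rewrite !scalerDr -/p -/q -/r.
clearbody r; clearbody p q; move: now_lead late_lead => u v.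
by apply/matrixP => i j; rewrite !mxE; ring.
Qed.

End sapd_recursion.

(** The noiseless first iterate. The first step is apart, as no momentum is
available yet. *)
Definition first_mean (R : realType) d (N : 'M[R]_d) (e : R) (x y : 'cV[R]_d) :
    'cV[R]_(d + d) :=
  let y1 := (1 - e) *: y + e *: (N *m x) in
  col_mx ((1 - e) *: x - e *: (N *m y1)) y1.

Section scaled_recursion.
Context (R : realType) (d : nat).
Variables (N : 'M[R]_d) (e : R).
Implicit Types x y : 'cV[R]_d.

Let rotationE x y : rotation N *m col_mx x y = col_mx (- (N *m y)) (N *m x).
Proof. by rewrite mul_block_col mulNmx !mul0mx add0r addr0. Qed.

Let drift_remE x y : drift_rem N e *m col_mx x y =
  col_mx (- (1 - e) *: (N *m (N *m x)) + e *: (N *m (N *m (N *m y))))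
    (- (N *m (N *m y))).
Proof. by rewrite mul_block_col mulNmx mul0mx add0r -!scalemxAl -!mulmxA. Qed.

Let now_leadE x y : now_lead R d *m col_mx x y = col_mx (- x) (2 *: y).
Proof.
by rewrite mul_block_col !mul0mx add0r addr0 !mul_scalar_mx scaleN1r.
Qed.

Let now_remE x y : now_rem N e *m col_mx x y = col_mx (- (2 - e) *: (N *m y)) (- y).
Proof.
by rewrite mul_block_col !mul0mx !add0r -scalemxAl mul_scalar_mx scaleN1r.
Qed.

Let late_leadE x y : late_lead R d *m col_mx x y = col_mx 0 (- y).
Proof.
by rewrite mul_block_col !mul0mx !add0r mul_scalar_mx scaleN1r.
Qed.

Let late_remE x y : late_rem N e *m col_mx x y =
  col_mx (e *: (N *m (N *m x)) + (1 - e) *: (N *m y)) (- (N *m x) + y).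
Proof. by rewrite mul_block_col mulNmx mul1mx -!scalemxAl -!mulmxA. Qed.

Variables (X Y Q xi eta : nat -> 'cV[R]_d).
Let G k := N *m X k + eta k.
Hypothesis Y_rec : forall k, Y k.+1 = (1 - e) *: Y k + e *: (G k + (1 - e) *: Q k).
Hypothesis X_rec : forall k, X k.+1 = (1 - e) *: X k - e *: (N *m Y k.+1 + xi k).
Hypothesis Q_rec : forall k, Q k.+1 = G k.+1 - G k.

Let NX_late k : (1 - e) *: (N *m X k)
  = N *m X k.+1 + e *: (N *m (N *m Y k.+1) + N *m xi k).
Proof.
rewrite [X k.+1]X_rec mulmxBr -!scalemxAr mulmxDr.
move: (N *m X k) (N *m (N *m Y k.+1)) (N *m xi k) => p q r.
by apply/matrixP => i j; rewrite !mxE; ring.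
Qed.

(** The momentum term contains [N (X_(k+1) - X_k)]; [NX_late] expresses the older
iterate by the newer ones, so that only the last iterate remains. *)
Lemma scaled_step k : col_mx (X k.+2) (Y k.+2) =
  drift N e *m col_mx (X k.+1) (Y k.+1)
  + e *: (now_lead R d + e *: now_rem N e) *m col_mx (xi k.+1) (eta k.+1)
  + e *: (late_lead R d + e *: late_rem N e) *m col_mx (xi k) (eta k).
Proof.
have YE : Y k.+2 = (1 - e) *: Y k.+1 - e ^+ 2 *: (N *m (N *m Y k.+1))
    + (e * (1 - e)) *: (N *m X k.+1) + (e * (2 - e)) *: eta k.+1
    - (e * (1 - e)) *: eta k - e ^+ 2 *: (N *m xi k).
  rewrite Y_rec Q_rec /G; have := NX_late k.
  move: (N *m X k) (N *m X k.+1) (N *m (N *m Y k.+1)) (N *m xi k) => p q r s.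
  move=> /matrixP h; apply/matrixP => i j; have := h i j; rewrite !mxE => h'.
  have : e * ((1 - e) * p i j) = e * (q i j + e * (r i j + s i j)) by rewrite h'.
  lra.
have NYE : N *m Y k.+2 = (1 - e) *: (N *m Y k.+1)
    - e ^+ 2 *: (N *m (N *m (N *m Y k.+1)))
    + (e * (1 - e)) *: (N *m (N *m X k.+1)) + (e * (2 - e)) *: (N *m eta k.+1)
    - (e * (1 - e)) *: (N *m eta k) - e ^+ 2 *: (N *m (N *m xi k)).
  by rewrite YE !(mulmxDr, mulmxBr, mulmxN) -!scalemxAr.
have XE : X k.+2 = (1 - e) *: X k.+1 - e *: (N *m Y k.+2 + xi k.+1) by exact: X_rec.
rewrite /drift !mulmxDl mul_scalar_mx -!scalemxAl !mulmxDl -!scalemxAl.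
rewrite rotationE drift_remE now_leadE now_remE late_leadE late_remE.
rewrite !(scale_col_mx, add_col_mx) XE NYE YE {XE NYE YE}.
move: (N *m (N *m (N *m Y k.+1))) (N *m (N *m Y k.+1)) (N *m Y k.+1) (Y k.+1).
move: (N *m (N *m X k.+1)) (N *m X k.+1) (X k.+1).
move: (N *m eta k.+1) (N *m eta k) (N *m (N *m xi k)) (N *m xi k).
move: (eta k.+1) (eta k) (xi k.+1) (xi k).
move=> f1 f0 g1 g0 h1 h2 h3 h4 x2 x1 x y3 y2 y1 y.
by congr col_mx; apply/matrixP => i j; rewrite !mxE; ring.
Qed.

Lemma scaled_first : Q 0%N = 0 -> col_mx (X 1%N) (Y 1%N) =
  first_mean N e (X 0%N) (Y 0%N)
  + e *: block_mx (-1)%:M (- e *: N) 0 1%:M *m col_mx (xi 0%N) (eta 0%N).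
Proof.
move=> Q0; rewrite /first_mean; set y1 := _ + e *: (N *m X 0%N).
have Y1 : Y 1%N = y1 + e *: eta 0%N.
  by rewrite Y_rec Q0 scaler0 addr0 /G scalerDr addrA.
rewrite X_rec Y1 mulmxDr -scalemxAr -scalemxAl mul_block_col mul0mx add0r mul1mx.
rewrite mul_scalar_mx scaleN1r -scalemxAl scale_col_mx add_col_mx; congr col_mx.
move: (N *m y1) (N *m eta 0%N) => p q.
by apply/matrixP => i j; rewrite !mxE; ring.
Qed.

End scaled_recursion.

Section sapd_scaled.
Context (R : realType) (d : nat).
Variables (K N : 'M[R]_d) (a b e : R).
Hypothesis N_sym : N^T = N.
Hypothesis KN : K = (a * b) *: N.
Hypotheses (a_gt0 : 0 < a) (b_gt0 : 0 < b) (e_lt1 : e < 1).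
Variables (wx wy : nat -> 'cV[R]_d) (x0 y0 : 'cV[R]_d).

Let tau := (1 - (1 - e)) / ((1 - e) * a ^+ 2).
Let sigma := (1 - (1 - e)) / ((1 - e) * b ^+ 2).
Let st k := sapd K (a ^+ 2) (b ^+ 2) tau sigma (1 - e) wx wy x0 y0 k.
Let X k := a *: (st k).1.1.
Let Y k := b *: (st k).1.2.
Let Q k := b^-1 *: (st k).2.
Let xi k := a^-1 *: wx k.
Let eta k := b^-1 *: wy k.
Let G k := N *m X k + eta k.
Let Wn k := col_mx (wx k) (wy k).

Let a_neq0 : a != 0. Proof. by rewrite gt_eqF. Qed.
Let b_neq0 : b != 0. Proof. by rewrite gt_eqF. Qed.
Let e1_neq0 : 1 - e != 0. Proof. by rewrite subr_eq0 eq_sym lt_eqF. Qed.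

Let inv_step c : c != 0 -> (1 + (1 - (1 - e)) / ((1 - e) * c) * c)^-1 = 1 - e.
Proof.
move=> c0; rewrite invfM mulrA divfK// -[X in X + _](divff e1_neq0) -mulrDl.
by rewrite addrC subrK mul1r invrK.
Qed.

Let K_sym : K^T = K. Proof. by rewrite KN linearZ/= N_sym. Qed.

Let stE k : st k.+1 =
  let g := K *m (st k).1.1 + wy k in
  let y' := (1 - e) *: ((st k).1.2 + sigma *: (g + (1 - e) *: (st k).2)) in
  let x' := (1 - e) *: ((st k).1.1 - tau *: (K *m y' + wx k)) in
  (x', y', (K *m x' + wy k.+1) - g).
Proof.
have inv_tau : (1 + tau * a ^+ 2)^-1 = 1 - e by apply: inv_step; rewrite sqrf_eq0.
have inv_sigma : (1 + sigma * b ^+ 2)^-1 = 1 - e by apply: inv_step; rewrite sqrf_eq0.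
rewrite /st /=; case: (sapd _ _ _ _ _ _ _ _ _ _ k) => [[x y] q].
by rewrite inv_tau inv_sigma K_sym.
Qed.

Let Kx k : b^-1 *: (K *m (st k).1.1 + wy k) = G k.
Proof.
by rewrite scalerDr KN -scalemxAl scalerA /G /X -scalemxAr mulrCA mulVf// mulr1.
Qed.

Let Y_rec k : Y k.+1 = (1 - e) *: Y k + e *: (G k + (1 - e) *: Q k).
Proof.
rewrite {1}/Y stE /= -Kx /Q /Y; set g := K *m _ + _.
move: (st k).1.2 (st k).2 g => y q g; apply/matrixP => i j; rewrite !mxE /sigma.
by field; rewrite b_neq0 e1_neq0.
Qed.

Let X_rec k : X k.+1 = (1 - e) *: X k - e *: (N *m Y k.+1 + xi k).
Proof.
have xE : (st k.+1).1.1 =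
    (1 - e) *: ((st k).1.1 - tau *: (K *m (st k.+1).1.2 + wx k)) by rewrite stE.
rewrite {1}/X xE KN /Y /X /xi -scalemxAr -scalemxAl.
move: (st k).1.1 (N *m _) => x y; apply/matrixP => i j; rewrite !mxE /tau.
by field; rewrite a_neq0 e1_neq0.
Qed.

Let Q_rec k : Q k.+1 = G k.+1 - G k.
Proof. by rewrite -!Kx /Q [st k.+1]stE /= -scalerBr. Qed.

Let unscaleE k : unscale d a b *m Wn k = col_mx (xi k) (eta k).
Proof. by rewrite /unscale mul_block_col !mul0mx addr0 add0r !mul_scalar_mx. Qed.

Lemma sapd_step k : col_mx (X k.+2) (Y k.+2) =
  drift N e *m col_mx (X k.+1) (Y k.+1)
  + noise_now N a b e *m Wn k.+1 + noise_late N a b e *m Wn k.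
Proof.
rewrite /noise_now /noise_late -!mulmxA !unscaleE.
exact: scaled_step Y_rec X_rec Q_rec k.
Qed.

Lemma sapd_first : col_mx (X 1%N) (Y 1%N) =
  first_mean N e (a *: x0) (b *: y0) + noise_first N a b e *m Wn 0%N.
Proof.
rewrite /noise_first -mulmxA unscaleE.
by apply: (scaled_first Y_rec X_rec); rewrite /Q /st /= scaler0.
Qed.

Lemma sapd_zE k : sapd_z K (a ^+ 2) (b ^+ 2) tau sigma (1 - e) wx wy x0 y0 k
  = unscale d a b *m col_mx (X k) (Y k).
Proof.
rewrite /unscale mul_block_col !mul0mx addr0 add0r !mul_scalar_mx /X /Y !scalerA.
by rewrite !mulVf// !scale1r.
Qed.

End sapd_scaled.

(** * Linear forms of the noise *)

(** An open set is the union of the boxes with rational centres and radii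
[k.+1%:R^-1] that it contains, of which there are countably many. *)
Lemma random_vector_coord d (T : measurableType d) (R : realType) n
    (X : T -> 'cV[R]_n) :
  (forall i, measurable_fun setT (fun w => X w i 0)) -> random_vector X.
Proof.
move=> mX; pose G : set (set 'cV[R]_n) := [set U | open U].
pose box (qk : 'cV[rat]_n * nat) : set 'cV[R]_n :=
  [set x | forall i, `|x i 0 - ratr (qk.1 i 0)| < qk.2.+1%:R^-1].
have mbox qk : measurable (X @^-1` box qk).
  have -> : X @^-1` box qk = \bigcap_(i in [set` enum 'I_n])
      (fun w => X w i 0) @^-1` [set t | `|t - ratr (qk.1 i 0)| < qk.2.+1%:R^-1].
    apply/seteqP; split => [w h i _|w h i]; first exact: h.
    by apply: h; rewrite /= mem_enum.
  rewrite bigcap_seq; apply: bigsetI_measurable => i _.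
  rewrite -[_ @^-1` _]setTI; apply: mX => //.
  have -> : [set t : R | `|t - ratr (qk.1 i 0)| < qk.2.+1%:R^-1]
      = ball (ratr (qk.1 i 0) : R) qk.2.+1%:R^-1.
    by apply/seteqP; split => t; rewrite /ball/= distrC.
  exact: measurable_ball.
have mU U : open U -> measurable (X @^-1` U).
  move=> oU; have -> : X @^-1` U = \bigcup_(qk in [set qk | box qk `<=` U]) X @^-1` box qk.
    apply/seteqP; split => [w /= Uw|w [qk sU hw]]; last exact: sU.
    have /nbhs_ballP[r /= r0 sB] := open_nbhs_nbhs (conj oU Uw).
    have r2 : 0 < r / 2 by rewrite divr_gt0.
    have [k _ /(_ k (leqnn k)) /= hk] := near_infty_natSinv_lt (PosNum r2).
    have k0 : (0 : R) < k.+1%:R^-1 by rewrite invr_gt0.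
    have approx (i : 'I_n) : exists q : rat, `|X w i 0 - ratr q| < k.+1%:R^-1.
      have [q] := rat_in_itvoo (ltr_pwDr k0 (lexx (X w i 0))).
      rewrite in_itv/= => /andP[q1 q2]; exists q.
      by rewrite distrC ger0_norm ?subr_ge0 ?(ltW q1)// ltrBlDl.
    pose q : 'cV[rat]_n := \col_i sval (cid (approx i)).
    have qE i : `|X w i 0 - ratr (q i 0)| < k.+1%:R^-1.
      by rewrite mxE; case: cid.
    exists (q, k) => //= x hx; apply: sB; rewrite -[ball _ _]/(ball (X w) r).
    have rE : k.+1%:R^-1 + k.+1%:R^-1 < r by rewrite [r]splitr ltrD.
    rewrite mx_norm_ball /ball_/=; apply: le_lt_trans rE.
    apply/mx_norm_leP => [|i j]; first by rewrite addr_ge0// ltW.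
    rewrite (ord1 j) !mxE; apply: le_trans (ler_distD (ratr (q i 0)) _ _) _.
    by rewrite lerD// ?(ltW (qE i))// distrC (ltW (hx i)).
  rewrite bigcup_mkcond; apply: countable_bigcupT_measurable; first exact: countableP.
  by move=> qk; case: ifP.
have mXG : measurable_fun setT (X : T -> g_sigma_algebraType G).
  apply: (@measurability _ _ T (g_sigma_algebraType G) setT X G erefl) => _ [U oU <-].
  by rewrite setTI; exact: mU.
by move=> B bB; have := mXG measurableT B bB; rewrite setTI.
Qed.

Section noise_law.
Context disp (T : measurableType disp) (R : realType) (P : probability T R).

Lemma gaussian_linear_form n (X : T -> 'cV[R]_n) m S (u : 'cV[R]_n) :
  gaussian P X m S -> gaussian_rv P (fun w => dotp u (X w)) (dotp u m) (dotp u (S *m u)).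
Proof.
move=> [rX _ S0 lX]; split => //; last by move=> A mA; exact: lX.
exact: random_vector_comp rX (@continuous_dotp R n u).
Qed.

Lemma random_vector_of_linear_forms n (X : T -> 'cV[R]_n) :
  (forall u, measurable_fun setT (fun w => dotp u (X w))) -> random_vector X.
Proof.
move=> mX; apply: random_vector_coord => i; have := mX (delta_mx i 0).
rewrite (_ : (fun w => X w i 0) = fun w => dotp (delta_mx i 0) (X w))//.
by apply/funext => w; rewrite dotp_delta.
Qed.

Lemma gaussian_of_linear_forms n (X : T -> 'cV[R]_n) m (S : 'M[R]_n) : S^T = S ->
  (forall u, gaussian_rv P (fun w => dotp u (X w)) (dotp u m) (dotp u (S *m u))) ->
  gaussian P X m S.
Proof.
move=> S_sym lX; split => //; last by move=> u A mA; have [_ _] := lX u; exact.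
  by apply: random_vector_of_linear_forms => u; have [] := lX u.
by move=> u; have [] := lX u.
Qed.

Variables (d : nat) (delta : R) (wx wy : nat -> T -> 'cV[R]_d).
Hypothesis noise : gaussian_noise P delta wx wy.
Let v := delta ^+ 2 / d%:R.

(** The two noise sequences are handled as one family indexed by [nat + nat], each
vector contributing one independent Gaussian linear form. *)
Lemma noise_sum (m : nat) (c : nat -> 'cV[R]_(d + d)) :
  gaussian_rv P (fun w => \sum_(0 <= k < m) dotp (c k) (col_mx (wx k w) (wy k w)))
    0 (v * \sum_(0 <= k < m) sqnorm (c k)).
Proof.
have [gx gy ind] := noise.
pose W (i : nat + nat) := match i with inl k => wx k | inr k => wy k end.
pose cc (i : nat + nat) : 'cV[R]_d :=
  match i with inl k => usubmx (c k) | inr k => dsubmx (c k) end.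
pose Y i w := dotp (cc i) (W i w).
have gY i : gaussian_rv P (Y i) 0 (v * sqnorm (cc i)).
  have gW : gaussian P (W i) 0 v%:M by case: i.
  by have := gaussian_linear_form (cc i) gW; rewrite mul_scalar_mx dotpZr (dotpC _ 0) dotp0.
have mY i : measurable_fun setT (Y i) by have [] := gY i.
have indY (s : seq (nat + nat)) (B : nat + nat -> set R) : uniq s ->
    (forall i, i \in s -> measurable (B i)) ->
    P (\bigcap_(i in [set` s]) (Y i @^-1` B i)) = (\prod_(i <- s) P (Y i @^-1` B i))%E.
  move=> us mB; apply: (ind s (fun i => dotp (cc i) @^-1` B i)) => // i si.
  by apply: borel_continuous_preimage (mB _ si); exact: continuous_dotp.
pose s : seq (nat + nat) := map inl (iota 0 m) ++ map inr (iota 0 m).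
have us : uniq s.
  rewrite cat_uniq !map_inj_uniq ?iota_uniq/= ?andbT; try by move=> x y [].
  by apply/hasPn => _ /mapP[k _ ->]; apply/mapP => -[].
have sumE (F : nat + nat -> R) : \sum_(i <- s) F i
    = \sum_(0 <= k < m) (F (inl k) + F (inr k)).
  by rewrite big_cat/= !big_map big_split/= /index_iota subn0.
have := gaussian_rv_sum mY indY us (fun i _ => gY i).
have -> : \sum_(i <- s) (0 : R) = 0 by apply: big1.
rewrite -mulr_sumr (sumE (fun i => sqnorm (cc i))).
rewrite (eq_bigr (fun k => sqnorm (c k))) => [|k _]; last first.
  by rewrite /cc /sqnorm -dotp_col vsubmxK.
rewrite (_ : (fun w => \sum_(i <- s) Y i w) = fun w =>
  \sum_(0 <= k < m) dotp (c k) (col_mx (wx k w) (wy k w)))//.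
apply/funext => w; rewrite sumE; apply: eq_bigr => k _.
by rewrite /Y /cc /W -dotp_col vsubmxK.
Qed.

Lemma noise_indep01 (u1 u2 : 'cV[R]_d) (A B : set R) : measurable A -> measurable B ->
  P ((fun w => dotp u1 (wx 0%N w)) @^-1` A `&` (fun w => dotp u2 (wy 0%N w)) @^-1` B)
  = (P ((fun w => dotp u1 (wx 0%N w)) @^-1` A)
     * P ((fun w => dotp u2 (wy 0%N w)) @^-1` B))%E.
Proof.
move=> mA mB; have [_ _ ind] := noise.
have := ind [:: inl 0%N; inr 0%N] (fun i => match i with
  | inl _ => dotp u1 @^-1` A | inr _ => dotp u2 @^-1` B end) isT.
rewrite !big_cons big_nil mule1 => <-.
  congr (P _); apply/seteqP; split => [w [/= hA hB] [k|k]|w h].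
  - by rewrite /= !in_cons in_nil => /or3P[]// /eqP[->].
  - by rewrite /= !in_cons in_nil => /or3P[]// /eqP[->].
  - by split; [apply: (h (inl 0%N)); rewrite /= mem_head|
               apply: (h (inr 0%N)); rewrite /= !inE eqxx orbT].
move=> [k|k] _; apply: borel_continuous_preimage => //; exact: continuous_dotp.
Qed.

End noise_law.

(** * Linear recursions driven by a moving average *)

Section moving_average.
Context (R : realType) (p q : nat).
Variables (D : 'M[R]_p) (E0 E1 F : 'M[R]_(p, q)) (c : 'cV[R]_p).
Variables (Z : nat -> 'cV[R]_p) (W : nat -> 'cV[R]_q).
Hypothesis Z_first : Z 1%N = c + F *m W 0%N.
Hypothesis Z_step : forall k, Z k.+2 = D *m Z k.+1 + E0 *m W k.+1 + E1 *m W k.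
Let G := D *m E0 + E1.

(** Powers of the transpose, since covariances only involve the adjoint action on
linear forms; as an iterate it makes sense in every size, 0 included. *)
Definition tr_power (A : 'M[R]_p) (j : nat) : 'M[R]_p := iter j (mulmx A^T) 1%:M.

Let Dp := tr_power D.

Lemma tr_powerSr A j : tr_power A j.+1 = tr_power A j *m A^T.
Proof.
elim: j => [|j IH]; first by rewrite /tr_power /= mulmx1 mul1mx.
by rewrite [LHS]/tr_power iterS -/(tr_power A j.+1) {1}IH mulmxA.
Qed.

Let V k := Z k.+1 - E0 *m W k.

Let V_step k : V k.+1 = D *m V k + G *m W k.
Proof.
rewrite /V Z_step addrAC addrK mulmxBr /G mulmxDl mulmxA addrA; congr (_ + _).
by rewrite subrK.
Qed.

Let dotpV n u : dotp u (V n) = dotp (Dp n *m u) (V 0%N)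
  + \sum_(0 <= j < n) dotp (G^T *m (Dp (n.-1 - j)%N *m u)) (W j).
Proof.
elim: n u => [|n IH] u; first by rewrite big_geq// addr0 /Dp /tr_power /= mul1mx.
rewrite V_step dotpDr !dotp_mulmx IH big_nat_recr//= subnn.
rewrite mulmxA -tr_powerSr addrA; congr (_ + _ + _); last by rewrite mul1mx.
apply: eq_big_nat => j /andP[_ jn]; rewrite (mulmxA (Dp _)) -tr_powerSr.
by case: n jn {IH} => // n jn /=; rewrite subSn.
Qed.

(** Coefficient of [W j] in the linear form [u] of [Z n.+2]. The oldest noise also
enters through the first iterate, the newest only through [E0]. *)
Definition ma_coef n (u : 'cV[R]_p) (j : nat) : 'cV[R]_q :=
  if j == 0%N then (F - E0)^T *m (Dp n.+1 *m u) + G^T *m (Dp n *m u)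
  else if j == n.+1 then E0^T *m u else G^T *m (Dp (n - j)%N *m u).

Lemma dotp_moving_average n u : dotp u (Z n.+2) = dotp (Dp n.+1 *m u) c
  + \sum_(0 <= j < n.+2) dotp (ma_coef n u j) (W j).
Proof.
have -> : Z n.+2 = V n.+1 + E0 *m W n.+1 by rewrite /V subrK.
have V0 : V 0%N = c + (F - E0) *m W 0%N by rewrite /V Z_first mulmxBl addrA.
rewrite dotpDr dotp_mulmx dotpV V0 dotpDr (dotp_mulmx (F - E0)).
rewrite [in RHS]big_nat_recr//= {2}/ma_coef eqxx/=.
rewrite [in RHS]big_nat_recl// [in LHS]big_nat_recl//= subn0 {1}/ma_coef/=.
have -> : \sum_(0 <= i < n) dotp (ma_coef n u i.+1) (W i.+1)
    = \sum_(0 <= i < n) dotp (G^T *m (Dp (n - i.+1)%N *m u)) (W i.+1).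
  apply: eq_big_nat => i /andP[_ ni].
  by rewrite /ma_coef eqSS (ltn_eqF ni).
rewrite dotpDl; lra.
Qed.

(** Isolates the partial sum of a convergent series; the first two terms vanish in
the limit. *)
Lemma sum_sqnorm_ma_coef n u : \sum_(0 <= j < n.+2) sqnorm (ma_coef n u j)
  = sqnorm (ma_coef n u 0) - sqnorm (G^T *m (Dp n *m u))
    + \sum_(0 <= j < n.+1) sqnorm ((G^T *m Dp j) *m u) + sqnorm (E0^T *m u).
Proof.
rewrite big_nat_recr// big_nat_recl//= {3}/ma_coef eqxx /=.
rewrite [in RHS]big_nat_recr//= -mulmxA; congr (_ + _).
rewrite [in RHS]big_nat_rev/= add0n.
have -> : \sum_(0 <= i < n) sqnorm (ma_coef n u i.+1)
    = \sum_(0 <= i < n) sqnorm (G^T *m Dp (n - i.+1)%N *m u).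
  apply: eq_big_nat => i /andP[_ ni].
  by rewrite /ma_coef eqSS (ltn_eqF ni)/= mulmxA.
lra.
Qed.

End moving_average.

Lemma cvg_geometric_bound (R : realType) (x : nat -> R) (C r : R) :
  0 <= r < 1 -> (forall n, `|x n| <= C * r ^+ n) -> x n @[n --> \oo] --> (0 : R).
Proof.
move=> /andP[r0 r1] hx; apply/norm_cvg0P.
apply: (@squeeze_cvgr _ _ _ _ (fun=> 0) (fun n => C * r ^+ n)); last 1 first.
- rewrite -[X in _ --> X](mulr0 C); apply: cvgM; first exact: cvg_cst.
  by apply: cvg_expr; rewrite ger0_norm.
- by apply: nearW => n; rewrite normr_ge0 hx.
- exact: cvg_cst.
Qed.

Section contraction.
Context (R : realType) (p : nat) (D : 'M[R]_p) (r : R).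
Hypothesis r0 : 0 <= r.

Lemma nrm_tr_power : (forall u, nrm (D^T *m u) <= r * nrm u) ->
  forall j u, nrm (tr_power D j *m u) <= r ^+ j * nrm u.
Proof.
move=> Dr j u; elim: j => [|j IH]; first by rewrite /tr_power/= mul1mx mul1r.
rewrite {1}/tr_power iterS -/(tr_power D j) -mulmxA exprS -mulrA.
by apply: le_trans (Dr _) _; rewrite ler_wpM2l.
Qed.

Lemma nrm_tr_power_ge : (forall u, r * nrm u <= nrm (D^T *m u)) ->
  forall j u, r ^+ j * nrm u <= nrm (tr_power D j *m u).
Proof.
move=> Dr j u; elim: j => [|j IH]; first by rewrite /tr_power/= mul1mx mul1r.
rewrite /tr_power iterS -/(tr_power D j) -mulmxA exprS -mulrA.
by apply: le_trans (Dr _); rewrite ler_wpM2l.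
Qed.

End contraction.

Section limit_law.
Context disp (T : measurableType disp) disp' (T' : measurableType disp').
Context (R : realType) (P : probability T R) (P' : probability T' R).
Variables (d : nat) (delta : R) (wx wy : nat -> T -> 'cV[R]_d).
Hypothesis noise : gaussian_noise P delta wx wy.
Variables (p m : nat) (D : 'M[R]_p) (E0 E1 F : 'M[R]_(p, d + d)) (c : 'cV[R]_p).
Variables (Z : nat -> T -> 'cV[R]_p) (r : R).
Let v := delta ^+ 2 / d%:R.
Let W k w := col_mx (wx k w) (wy k w).
Let G := D *m E0 + E1.
Hypothesis Z_first : forall w, Z 1%N w = c + F *m W 0%N w.
Hypothesis Z_step :
  forall k w, Z k.+2 w = D *m Z k.+1 w + E0 *m W k.+1 w + E1 *m W k w.
Hypothesis r01 : 0 <= r < 1.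
Hypothesis D_le : forall u, nrm (D^T *m u) <= r * nrm u.
Variables (S : 'M[R]_p) (A : 'M[R]_(m, p)) (Y : T' -> 'cV[R]_m).
Hypothesis S_cvg : forall u,
  \sum_(0 <= j < k) sqnorm ((G^T *m tr_power D j) *m u) @[k --> \oo] --> dotp u (S *m u).
Hypothesis gY : gaussian P' Y 0 (v *: (A *m (S + E0 *m E0^T) *m A^T)).

Let r0 : 0 <= r. Proof. by case/andP: r01. Qed.

Let bound (q : nat) (B : 'M[R]_(q, p)) :
  exists2 b, 0 <= b & forall n u, nrm (B *m (tr_power D n *m u)) <= b * (r ^+ n * nrm u).
Proof.
have [b b0 Bb] := bddm_nrm (bddm_cst B); exists b => // n u.
have Bb' : forall u, nrm (B *m u) <= b * nrm u by apply: (Bb 0); rewrite lexx ler01.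
by apply: le_trans (Bb' _) _; rewrite ler_wpM2l// nrm_tr_power.
Qed.

(** The first two iterates are dropped, since the formula of the linear forms starts
at index 2. *)
Lemma ma_cvg_in_distribution : cvg_in_distribution P P' (fun n w => A *m Z n w) Y.
Proof.
pose mean n u := dotp (tr_power D n.+1 *m (A^T *m u)) c.
pose var n u := v * \sum_(0 <= j < n.+2) sqnorm (ma_coef D E0 E1 F n (A^T *m u) j).
have law n u : gaussian_rv P (fun w => dotp u (A *m Z n.+2 w)) (mean n u) (var n u).
  have := gaussian_rv_shift (mean n u) (noise_sum noise n.+2 (ma_coef D E0 E1 F n (A^T *m u))).
  rewrite addr0 (_ : (fun w => _ + _) = fun w => dotp u (A *m Z n.+2 w))//.
  apply/funext => w; rewrite dotp_mulmx.
  by rewrite (@dotp_moving_average _ _ _ _ _ _ _ _ (Z ^~ w) (W ^~ w) (Z_first w)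
    (fun k => Z_step k w)).
have cvg_mean u : mean n u @[n --> \oo] --> dotp u 0.
  rewrite dotpC dotp0.
  apply: (@cvg_geometric_bound _ _ (r * nrm (A^T *m u) * nrm c) r) => // n.
  apply: le_trans (cauchy_schwarz_abs _ _) _.
  rewrite mulrAC; apply: ler_wpM2r; first exact: nrm_ge0.
  by rewrite mulrAC -exprS; exact: nrm_tr_power.
have cvg_sq (q : nat) (x : nat -> 'cV[R]_q) C : (forall n, nrm (x n) <= C * r ^+ n) ->
    sqnorm (x n) @[n --> \oo] --> (0 : R).
  move=> hx; have nx : nrm (x n) @[n --> \oo] --> (0 : R).
    by apply: (@cvg_geometric_bound _ _ C r) => // n; rewrite ger0_norm ?nrm_ge0.
  have -> : (fun n => sqnorm (x n)) = (fun n => nrm (x n) * nrm (x n)).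
    by apply/funext => n; rewrite -sqr_nrm expr2.
  by rewrite -[X in _ --> X](mulr0 (0 : R)); exact: (cvgM nx nx).
have cvg_var u : var n u @[n --> \oo] -->
    dotp u ((v *: (A *m (S + E0 *m E0^T) *m A^T)) *m u).
  set x := A^T *m u.
  have -> : dotp u ((v *: (A *m (S + E0 *m E0^T) *m A^T)) *m u)
      = v * (0 - 0 + dotp x (S *m x) + sqnorm (E0^T *m x)).
    rewrite -scalemxAl dotpZr -!mulmxA dotp_mulmx -/x mulmxDl dotpDr subr0 add0r.
    by rewrite -mulmxA (dotp_mulmx E0).
  apply: cvgM; first exact: cvg_cst.
  under eq_cvg => n do rewrite sum_sqnorm_ma_coef.
  apply: cvgD; last exact: cvg_cst.
  have S_cvgS := @S_cvg x; rewrite -cvg_shiftS in S_cvgS.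
  apply: cvgD; last exact: S_cvgS.
  have [b1 b10 hb1] := bound (F - E0)^T; have [b2 b20 hb2] := bound G^T.
  apply: cvgB.
    apply: (cvg_sq _ _ (b1 * (r * nrm x) + b2 * nrm x)) => n; rewrite /ma_coef eqxx.
    apply: le_trans (nrmD _ _) _; rewrite mulrDl; apply: lerD.
      by apply: le_trans (hb1 _ _) _; rewrite exprS; lra.
    by apply: le_trans (hb2 _ _) _; lra.
  apply: (cvg_sq _ _ (b2 * nrm x)) => n.
  by apply: le_trans (hb2 _ _) _; lra.
have cvg2 : cvg_in_distribution P P' (fun n w => A *m Z n.+2 w) Y.
  have [rY _ _ _] := gY.
  have lY u := gaussian_linear_form u gY.
  apply: (cramer_wold _ rY law lY cvg_mean cvg_var) => n.
  apply: random_vector_of_linear_forms => u.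
  by have [] := law n u.
move=> f cf Mf; have lim := cvg2 f cf Mf.
rewrite -(cvg_shiftn 2).
have -> : (fun n => 'E_P[fun w => f (A *m Z (n + 2)%N w)])%E
    = (fun n => 'E_P[fun w => f (A *m Z n.+2 w)])%E.
  by apply/funext => n; rewrite addn2.
exact: lim.
Qed.

End limit_law.

(** * Size of the stationary covariance *)

Section stationary_covariance_bounds.
Context (R : realType) (d : nat).
Variables (N : 'M[R]_d) (a b : R).
Hypothesis N_sym : N^T = N.
Hypotheses (a_gt0 : 0 < a) (b_gt0 : 0 < b).
Let Un := unscale d a b.

Lemma geometric_sum (z : R) k : (1 - z) * \sum_(0 <= j < k) z ^+ j = 1 - z ^+ k.
Proof.
elim: k => [|k IH]; first by rewrite big_geq// mulr0 expr0 subrr.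
by rewrite big_nat_recr//= mulrDr IH exprS; ring.
Qed.

Lemma tr_unscale : Un^T = Un.
Proof. by rewrite /Un /unscale tr_block_mx !tr_scalar_mx !trmx0. Qed.

(** The lower bound is the upper bound for the inverse matrix. *)
Lemma unscale_bounds : exists c C : R, [/\ 0 < c, 0 <= C &
  forall u, c * nrm u <= nrm (Un^T *m u) <= C * nrm u].
Proof.
have [C C0 hC] := bddm_nrm (bddm_cst (Un^T)).
have [B B0 hB] := bddm_nrm (bddm_cst (unscale d a^-1 b^-1)).
exists ((1 + B)^-1), C; rewrite invr_gt0 ltr_wpDr//; split => // u.
rewrite (hC 0) ?lexx ?ler01// andbT mulrC ler_pdivrMr ?ltr_wpDr//.
have uE : u = unscale d a^-1 b^-1 *m (Un^T *m u).
  rewrite tr_unscale mulmxA /Un /unscale mulmx_block !mul0mx !mulmx0 !addr0 !add0r.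
  by rewrite -!scalar_mxM !invrK !divff ?gt_eqF// -scalar_mx_block mul1mx.
have := hB 0 _ (Un^T *m u); rewrite -uE lexx ler01 => /(_ isT) h.
by apply: le_trans h _; rewrite mulrC ler_wpM2l ?nrm_ge0// lerDr.
Qed.

Lemma noise_now_bound : exists2 C : R, 0 <= C & forall e, 0 <= e <= 1 ->
  forall u, nrm ((noise_now N a b e)^T *m u) <= C * e * nrm u.
Proof.
have bA : bddm (fun e => Un^T *m (now_lead R d + e *: now_rem N e)^T).
  apply: bddmM; first exact: bddm_cst.
  apply: bddm_tr; apply: bddmD; first exact: bddm_cst.
  by apply: bddmZ (bdd_now_rem N); exact: bdds_id.
have [C C0 hC] := bddm_nrm bA; exists C => // e e01 u.
have /andP[e0 _] := e01.
rewrite /noise_now -scalemxAl linearZ/= trmx_mul -scalemxAl nrmZ ger0_norm//.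
by rewrite -mulrA mulrCA ler_wpM2l// hC.
Qed.

Lemma nrm_signature (u : 'cV[R]_(d + d)) :
  nrm ((block_mx (-1)%:M 0 0 1%:M : 'M[R]_(d + d))^T *m u) = nrm u.
Proof.
rewrite tr_block_mx !tr_scalar_mx !trmx0 -[u]vsubmxK mul_block_col !mul0mx addr0 add0r.
rewrite mul1mx mul_scalar_mx /nrm; congr Num.sqrt.
by rewrite /sqnorm !dotp_col -!/(sqnorm _) sqnormZ sqrrN expr1n mul1r.
Qed.

(** The leading matrix [diag (-1, 1)] is an isometry, and a perturbation of size at
most one half of it leaves lengths comparable. *)
Lemma noise_gain_bounds : exists e0 c C : R, [/\ 0 < e0 <= 2^-1, 0 < c, 0 <= C &
  forall e, 0 < e <= e0 -> forall u,
    c * e * nrm u <= nrm ((noise_gain N a b e)^T *m u) <= C * e * nrm u].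
Proof.
have [H bH GE] := noise_gain_expansion N a b.
have [h h0 hH] := bddm_nrm (bddm_tr bH).
have [c [C [c0 C0 hU]]] := unscale_bounds.
have [e0 e0P e0h] := near_zero_choice h.
exists e0, (c / 2), (C * 2); rewrite mulr_ge0// divr_gt0//; split => // e ee0 u.
have /andP[e_gt0 e_le] : 0 < e <= 2^-1 by lra.
rewrite GE -scalemxAl linearZ/= trmx_mul -scalemxAl nrmZ ger0_norm ?(ltW e_gt0)// -mulmxA.
set x := _ *m u.
have nu := nrm_ge0 u.
have hHu : nrm (e *: ((H e)^T *m u)) <= 2^-1 * nrm u.
  rewrite nrmZ ger0_norm ?(ltW e_gt0)//; have h1 := hH e _ u.
  have {}h1 : nrm ((H e)^T *m u) <= h * nrm u by apply: h1; apply/andP; split; lra.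
  have h2 : e * nrm ((H e)^T *m u) <= e * (h * nrm u) by rewrite ler_wpM2l// (ltW e_gt0).
  have h3 : e * h * nrm u <= 2^-1 * nrm u by rewrite ler_wpM2r// e0h.
  lra.
have xE : x = (block_mx (-1)%:M 0 0 1%:M : 'M[R]_(d + d))^T *m u + e *: ((H e)^T *m u).
  by rewrite /x linearD/= linearZ/= mulmxDl -scalemxAl.
have x_le : nrm x <= 2 * nrm u.
  by rewrite xE; apply: le_trans (nrmD _ _) _; rewrite nrm_signature; lra.
have x_ge : 2^-1 * nrm u <= nrm x.
  by rewrite xE; apply: le_trans (nrmD_ge _ _); rewrite nrm_signature; lra.
have /andP[U1 U2] := hU x; apply/andP; split.
  rewrite (mulrC _ e) -!mulrA ler_wpM2l// ?(ltW e_gt0)//; apply: le_trans U1.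
  by rewrite ler_wpM2l// (ltW c0).
rewrite (mulrC _ e) -!mulrA ler_wpM2l// ?(ltW e_gt0)//; apply: le_trans U2 _.
by rewrite ler_wpM2l.
Qed.

(** The j-th term of the series is of order [e ^+ 2 * r ^+ j * sqnorm u] with [1 - r] of
order [e], so the sum is of order [e]. The newest noise only adds [O(e ^+ 2)]. *)
Lemma stationary_bounds : exists e0 lam Lam : R,
  [/\ 0 < e0 <= 2^-1, 0 < lam, 0 < Lam & forall e, 0 < e <= e0 ->
    let G := noise_gain N a b e in
    let E0 := noise_now N a b e in
    (forall u, nrm ((drift N e)^T *m u) <= (1 - e / 2) * nrm u) /\
    exists S : 'M[R]_(d + d), [/\ S^T = S,
      forall u, \sum_(0 <= j < k) sqnorm ((G^T *m tr_power (drift N e) j) *m u)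
        @[k --> \oo] --> dotp u (S *m u)
      & forall u, lam * e * sqnorm u <= dotp u ((S + E0 *m E0^T) *m u)
          <= Lam * e * sqnorm u]].
Proof.
have [e1 e1P hD] := near_rotation_bounds (rotation_anti N_sym) (bdd_drift_rem N).
have [e2 [c [C [e2P c0 C0 hG]]]] := noise_gain_bounds.
have [B B0 hE] := noise_now_bound.
exists (Num.min e1 e2), (c ^+ 2 / 4), (1 + 2 * C ^+ 2 + B ^+ 2).
have e12 : 0 < Num.min e1 e2 <= 2^-1.
  by rewrite lt_min ge_min; move: e1P e2P => /andP[-> ->] /andP[-> _].
split => //.
- by rewrite divr_gt0// exprn_gt0.
- by rewrite ltr_wpDr ?sqr_ge0// ltr_wpDr// mulr_ge0 ?sqr_ge0.
move=> e /andP[e0 ele] G E0.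
have /andP[ee1 ee2] : (e <= e1) && (e <= e2) by rewrite -le_min.
have e_le : e <= 2^-1 by case/andP: e12 => _; apply: le_trans.
have D_le u : nrm ((drift N e)^T *m u) <= (1 - e / 2) * nrm u.
  by have [] := hD e _ u; first by rewrite e0 ee1.
have D_ge u : (1 - 2 * e) * nrm u <= nrm ((drift N e)^T *m u).
  by have [] := hD e _ u; first by rewrite e0 ee1.
have G_bnd u : c * e * nrm u <= nrm (G^T *m u) <= C * e * nrm u by apply: hG; rewrite e0.
split => //.
have r0 : 0 <= 1 - e / 2 by lra.
have r0' : 0 <= 1 - 2 * e by lra.
have Q_le j u : nrm (G^T *m tr_power (drift N e) j *m u)
    <= C * e * (1 - e / 2) ^+ j * nrm u.
  rewrite -mulmxA; have /andP[_ h] := G_bnd (tr_power (drift N e) j *m u).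
  apply: le_trans h _; rewrite -[leRHS]mulrA ler_wpM2l ?mulr_ge0 ?(ltW e0)//.
  exact: nrm_tr_power.
have Q_ge j u : c * e * (1 - 2 * e) ^+ j * nrm u
    <= nrm (G^T *m tr_power (drift N e) j *m u).
  rewrite -[in leRHS]mulmxA; have /andP[h _] := G_bnd (tr_power (drift N e) j *m u).
  apply: le_trans h; rewrite -[leLHS]mulrA ler_wpM2l ?mulr_ge0 ?(ltW e0) ?(ltW c0)//.
  exact: nrm_tr_power_ge.
have r1 : 0 <= 1 - e / 2 < 1 by apply/andP; split; lra.
have [S S_sym S_cvg] := covariance_series r1 Q_le.
exists S; split => // u.
set z := (1 - 2 * e) ^+ 2; set y := (1 - e / 2) ^+ 2.
have nu2 : 0 <= sqnorm u by exact: sqnorm_ge0.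
have E_le : sqnorm (E0^T *m u) <= B ^+ 2 * e * sqnorm u.
  have h : nrm (E0^T *m u) <= B * e * nrm u by apply: hE; apply/andP; split; lra.
  have : nrm (E0^T *m u) ^+ 2 <= (B * e * nrm u) ^+ 2.
    by rewrite lerXn2r ?nnegrE ?nrm_ge0 ?mulr_ge0 ?nrm_ge0 ?(ltW e0).
  rewrite !exprMn !sqr_nrm => /le_trans; apply.
  rewrite ler_wpM2r// ler_wpM2l ?sqr_ge0// expr2 ler_piMl ?(ltW e0)//; lra.
have S_ge : c ^+ 2 / 4 * e * sqnorm u <= dotp u (S *m u).
  have lim : c ^+ 2 / 4 * e * sqnorm u * (1 - z ^+ k) @[k --> \oo]
      --> c ^+ 2 / 4 * e * sqnorm u * (1 - 0).
    apply: cvgM; first exact: cvg_cst.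
    apply: cvgB; first exact: cvg_cst.
    apply: cvg_expr; rewrite ger0_norm ?sqr_ge0// /z; nra.
  move: lim; rewrite subr0 mulr1 => lim; apply: ler_cvg_to lim (S_cvg u) _.
  apply: nearW => k; rewrite -geometric_sum.
  apply: (@le_trans _ _ (\sum_(0 <= j < k) (c * e) ^+ 2 * z ^+ j * sqnorm u)).
    rewrite -mulr_suml -mulr_sumr.
    set s := \sum_(0 <= j < k) _; have s0 : 0 <= s.
      by apply: sumr_ge0 => j _; rewrite exprn_ge0 ?sqr_ge0.
    have h1 : (1 - z) * s <= 4 * e * s by apply: ler_wpM2r => //; rewrite /z; nra.
    have h2 : 0 <= c ^+ 2 / 4 * e * sqnorm u.
      by rewrite -mulrA mulr_ge0 ?(mulr_ge0 (ltW e0) nu2)// divr_ge0 ?sqr_ge0.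
    have := ler_wpM2l h2 h1; rewrite exprMn; lra.
  apply: ler_sum => j _; rewrite /z -exprM mulnC exprM -!sqr_nrm -!exprMn.
  by rewrite lerXn2r ?nnegrE ?nrm_ge0 ?mulr_ge0 ?nrm_ge0 ?exprn_ge0 ?(ltW e0) ?(ltW c0).
have S_le : dotp u (S *m u) <= 2 * C ^+ 2 * e * sqnorm u.
  apply: ler_cvg_to (S_cvg u) (cvg_cst _) _.
  apply: nearW => k.
  apply: (@le_trans _ _ (\sum_(0 <= j < k) (C * e) ^+ 2 * y ^+ j * sqnorm u)).
    apply: ler_sum => j _; rewrite /y -exprM mulnC exprM -!sqr_nrm -!exprMn.
    by rewrite lerXn2r ?nnegrE ?nrm_ge0 ?mulr_ge0 ?nrm_ge0 ?exprn_ge0 ?(ltW e0).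
  rewrite -mulr_suml -mulr_sumr; have := geometric_sum y k.
  set s := \sum_(0 <= j < k) _ => hs; have s0 : 0 <= s.
    by apply: sumr_ge0 => j _; rewrite exprn_ge0 ?sqr_ge0.
  have h1 : e / 2 * s <= (1 - y) * s by apply: ler_wpM2r => //; rewrite /y; nra.
  have yk : 0 <= y ^+ k by rewrite exprn_ge0 ?sqr_ge0.
  have h3 : e * s <= 2 by lra.
  have h2 : 0 <= C ^+ 2 * e * sqnorm u.
    by rewrite -mulrA mulr_ge0 ?(mulr_ge0 (ltW e0) nu2) ?sqr_ge0.
  have := ler_wpM2l h2 h3; rewrite exprMn; lra.
rewrite mulmxDl dotpDr -mulmxA (dotp_mulmx E0) -/(sqnorm _).
have E_ge := sqnorm_ge0 (E0^T *m u).
have eu : 0 <= e * sqnorm u by rewrite mulr_ge0 ?(ltW e0).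
apply/andP; split; lra.
Qed.

End stationary_covariance_bounds.

(** * Quantiles of the squared norm of a Gaussian vector *)

Lemma quantile_between disp (T : measurableType disp) (R : realType)
    (P : probability T R) (U : T -> R) (p t1 t2 : R) :
  (forall t, (p%:E <= P [set w | (U w <= t)%R])%E -> t1 <= t) ->
  (p%:E <= P [set w | (U w <= t2)%R])%E ->
  t1 <= quantile P p U <= t2.
Proof.
move=> lb mem; have lb1 : lbound [set t : R | (p%:E <= P [set w | (U w <= t)%R])%E] t1.
  by move=> t; exact: lb.
apply/andP; split; first by apply: lb_le_inf => //; exists t2.
by apply: ge_inf => //; exists t1.
Qed.

Section gaussian_norm.
Context disp (T : measurableType disp) (R : realType) (P : probability T R).

Lemma sqnorm_delta n (i : 'I_n) : sqnorm (delta_mx i 0 : 'cV[R]_n) = 1.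
Proof. by rewrite /sqnorm dotp_delta mxE !eqxx. Qed.

Lemma sqnormE n (x : 'cV[R]_n) : sqnorm x = \sum_(i < n) x i 0 ^+ 2.
Proof. by apply: eq_bigr => i _; rewrite expr2. Qed.

Lemma measurable_sqnorm n (X : T -> 'cV[R]_n) : random_vector X ->
  measurable_fun setT (fun w => sqnorm (X w)).
Proof.
move=> rX; rewrite (_ : (fun w => _) = fun w => \sum_(i < n) X w i 0 ^+ 2); last first.
  by apply/funext => w; rewrite sqnormE.
apply: measurable_sum => i; apply: measurable_funX.
rewrite (_ : (fun w => _) = fun w => dotp (delta_mx i 0) (X w)).
  exact: random_vector_comp rX (@continuous_dotp R n _).
by apply/funext => w; rewrite dotp_delta.
Qed.

Lemma measurable_le_fun (U : T -> R) t : measurable_fun setT U ->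
  measurable [set w | (U w <= t)%R].
Proof.
move=> mU; rewrite (_ : [set w | _] = U @^-1` [set x | x <= t])//.
by apply: measurable_preimage => //; rewrite -set_itvNyc.
Qed.

Lemma gaussian_sqnorm_le n (X : T -> 'cV[R]_n) (S : 'M[R]_n) (hi a : R) :
  gaussian P X 0 S -> 0 <= hi -> 0 <= a -> (forall u, dotp u (S *m u) <= hi * sqnorm u) ->
  ((1 - n%:R * (2 * expR (- (a ^+ 2 / 4))))%:E
     <= P [set w | (sqnorm (X w) <= n%:R * (hi * a ^+ 2))%R])%E.
Proof.
move=> gX hi0 a0 S_le; have [rX _ _ _] := gX.
pose r := Num.sqrt hi * a; have r0 : 0 <= r by rewrite mulr_ge0 ?sqrtr_ge0.
have r2 : r ^+ 2 = hi * a ^+ 2 by rewrite exprMn sqr_sqrtr.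
pose far (i : 'I_n) := (fun w => dotp (delta_mx i 0) (X w)) @^-1` [set x : R | r < `|x|].
have mfar i : measurable (far i).
  have [mD _ _] := gaussian_linear_form (delta_mx i 0) gX.
  apply: measurable_preimage => //.
  rewrite (_ : [set x | _] = (fun x : R => `|x|) @^-1` `]r, +oo[).
    by apply: measurable_preimage => //; exact: measurableT_comp.
  by apply/seteqP; split => x /=; rewrite in_itv/= andbT.
have Pfar i : (P (far i) <= (2 * expR (- (a ^+ 2 / 4)))%:E)%E.
  apply: (gaussian_rv_tail (gaussian_linear_form (delta_mx i 0) gX) a0).
  have /ler_wsqrtr s_le : dotp (delta_mx i 0) (S *m delta_mx i 0) <= hi.
    by have := S_le (delta_mx i 0); rewrite sqnorm_delta mulr1.
  by rewrite (dotpC _ 0) dotp0 normr0 add0r /r; apply: ler_wpM2r.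
have mU : measurable (\big[setU/set0]_(i < n) far i) by apply: bigsetU_measurable.
have PU : (P (\big[setU/set0]_(i < n) far i) <= (n%:R * (2 * expR (- (a ^+ 2 / 4))))%:E)%E.
  apply: le_trans (_ : (\sum_(i < n) P (far i) <= _)%E).
    have [//] : measurable (\big[setU/set0]_(i < n) far i) /\
      (P (\big[setU/set0]_(i < n) far i) <= \sum_(i < n) P (far i))%E.
    elim/big_rec2: _ => [|i x A _ [mA PA]]; first by rewrite measure0.
    split; first exact: measurableU.
    apply: le_trans (measureU2 _ _ _) _ => //; exact: leeD2l.
  apply: le_trans (lee_sum _ (fun i _ => Pfar i)) _.
  by rewrite sumEFin sumr_const card_ord (mulr_natl _ n).
have mA : measurable [set w | (sqnorm (X w) <= n%:R * (hi * a ^+ 2))%R].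
  by apply: measurable_le_fun; exact: measurable_sqnorm.
apply: (@le_trans _ _ (P (~` \big[setU/set0]_(i < n) far i))).
  by rewrite probability_setC// EFinB leeB.
apply: le_measure; rewrite ?inE//; first exact: measurableC.
move=> w /= hw; rewrite sqnormE.
apply: (@le_trans _ _ (\sum_(i < n) r ^+ 2)); last first.
  by rewrite sumr_const card_ord r2 mulr_natl.
apply: ler_sum => i _; rewrite -[X w i 0 ^+ 2]real_normK ?num_real//.
rewrite lerXn2r ?nnegrE// leNgt; apply/negP => ri; apply: hw.
rewrite (bigD1 i)//=; left.
by rewrite /far/= dotp_delta.
Qed.

(** The factor [1 + ln (2 * n%:R)] absorbs the number of coordinates in the union
bound. *)
Lemma gaussian_sqnorm_quantile_le n (X : T -> 'cV[R]_n) (S : 'M[R]_n) (hi p : R) :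
  (0 < n)%N -> 0 < p < 1 -> gaussian P X 0 S -> 0 <= hi ->
  (forall u, dotp u (S *m u) <= hi * sqnorm u) ->
  (p%:E <= P [set w | (sqnorm (X w) <=
     n%:R * (hi * (4 * (1 + ln (2 * n%:R)) * (1 + ln (1 / (1 - p))))))%R])%E.
Proof.
move=> n0 /andP[p0 p1] gX hi0 S_le; set l := ln (1 / (1 - p)).
have n1 : 1 <= n%:R :> R by rewrite ler1n.
have q0 : 0 < 1 - p by rewrite subr_gt0.
have l0 : 0 <= l by rewrite ln_ge0// ler_pdivlMr//; lra.
have k0 : 0 <= ln (2 * n%:R : R) by rewrite ln_ge0//; lra.
set b := 4 * (1 + ln (2 * n%:R)) * (1 + l).
have b0 : 0 <= b by rewrite !mulr_ge0// addr_ge0.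
have := gaussian_sqnorm_le gX hi0 (sqrtr_ge0 b) S_le; rewrite sqr_sqrtr//.
apply: le_trans; rewrite lee_fin.
have : expR (- (b / 4)) <= (1 - p) / (2 * n%:R).
  have -> : (1 - p) / (2 * n%:R) = expR (- (ln (2 * n%:R) + l)).
    rewrite expRN expRD !lnK ?posrE ?divr_gt0//; last by lra.
    by rewrite [in RHS]invfM div1r invrK mulrC.
  by rewrite ler_expR lerN2 /b; nra.
rewrite ler_pdivlMr; [lra|lra].
Qed.

End gaussian_norm.

Section limit_vector.
Context disp (T : measurableType disp) (R : realType) (P : probability T R).
Variables (d : nat) (delta : R) (wx wy : nat -> T -> 'cV[R]_d).
Hypothesis d_gt0 : (0 < d)%N.
Hypothesis delta_gt0 : 0 < delta.
Hypothesis noise : gaussian_noise P delta wx wy.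
Let v := delta ^+ 2 / d%:R.
Variables (B L : 'M[R]_(d + d)) (lo : R).
Hypothesis lo_gt0 : 0 < lo.
Hypothesis B_sym : B^T = B.
Hypothesis B_ge : forall u, lo * sqnorm u <= dotp u (B *m u).
Hypothesis LB : L *m L^T = B.
Let zinf w := L *m col_mx (wx 0%N w) (wy 0%N w).

Let v_gt0 : 0 < v.
Proof. by rewrite divr_gt0 ?exprn_gt0// ltr0n. Qed.

Lemma gaussian_limit_vector : gaussian P zinf 0 (v *: B).
Proof.
apply: gaussian_of_linear_forms => [|u]; first by rewrite linearZ/= B_sym.
have := noise_sum noise 1 (fun _ => L^T *m u).
rewrite big_nat1 dotpC dotp0 -scalemxAl dotpZr -LB -mulmxA dotp_mulmx.
rewrite (_ : (fun w => \sum_(0 <= k < 1) _) = fun w => dotp u (zinf w))//.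
by apply/funext => w; rewrite big_nat1 /zinf dotp_mulmx.
Qed.

Let i0 : 'I_d := Ordinal d_gt0.
Let u0 : 'cV[R]_d := (Num.sqrt v)^-1 *: delta_mx i0 0.

Let standard (X : T -> 'cV[R]_d) : gaussian P X 0 v%:M ->
  gaussian_rv P (fun w => dotp u0 (X w)) 0 1.
Proof.
move=> gX; have := gaussian_linear_form u0 gX.
rewrite mul_scalar_mx dotpZr -/(sqnorm _) sqnormZ sqnorm_delta (dotpC _ 0) dotp0.
have -> : v * ((Num.sqrt v)^-1 ^+ 2 * 1) = 1.
  by rewrite mulr1 exprVn (sqr_sqrtr (ltW v_gt0)) mulfV// (gt_eqF v_gt0).
by [].
Qed.

(** Compares with the first coordinates of the two noises at time 0, normalized. *)
Lemma limit_vector_small_ball t : 0 <= t ->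
  (P [set w | (sqnorm (zinf w) <= t)%R] <= (1 - expR (- (7 * (t / (lo * v)))))%:E)%E.
Proof.
move=> t0; have [gx gy _] := noise.
have lv0 : 0 < lo * v by rewrite mulr_gt0.
have gX := standard (gx 0%N); have gY := standard (gy 0%N).
apply: le_trans (gaussian_pair_ball_le gX gY (noise_indep01 noise u0 u0) _); last first.
  by rewrite divr_ge0// ltW.
have [mX _ _] := gX; have [mY _ _] := gY; have [rz _ _ _] := gaussian_limit_vector.
apply: le_measure; rewrite ?inE.
- by apply: measurable_le_fun; exact: measurable_sqnorm.
- apply: (measurable_le_fun (U := fun w => dotp u0 (wx 0%N w) ^+ 2 + dotp u0 (wy 0%N w) ^+ 2)).
  by apply: measurable_funD; apply: measurable_funX.
move=> w /= hw; rewrite ler_pdivlMr//.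
have h := factor_nrm_ge (col_mx (wx 0%N w) (wy 0%N w)) lo_gt0 LB B_ge.
have coord (x : 'cV[R]_d) : dotp u0 x ^+ 2 * v <= sqnorm x.
  rewrite (dotpC u0) dotpZr dotpC dotp_delta exprMn exprVn sqr_sqrtr ?(ltW v_gt0)//.
  rewrite mulrAC mulVf ?gt_eqF// mul1r sqnormE (bigD1 i0)//= lerDl.
  by apply: sumr_ge0 => i _; exact: sqr_ge0.
apply: le_trans hw; apply: le_trans h.
rewrite mulrCA ler_wpM2l ?(ltW lo_gt0)// /sqnorm dotp_col -!/(sqnorm _) mulrDl.
by rewrite lerD.
Qed.

Lemma limit_vector_quantile_ge (p t : R) : 0 < p < 1 ->
  (p%:E <= P [set w | (sqnorm (zinf w) <= t)%R])%E ->
  lo * v / 7 * ln (1 / (1 - p)) <= t.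
Proof.
move=> /andP[p0 p1] hp; have lv0 : 0 < lo * v by rewrite mulr_gt0.
have q0 : 0 < 1 - p by rewrite subr_gt0.
have t0 : 0 <= t.
  rewrite leNgt; apply/negP => t0; move: hp.
  rewrite (_ : [set w | _] = set0) ?measure0 ?lee_fin ?leNgt ?p0//.
  by apply/seteqP; split => w //= hw; have := sqnorm_ge0 (zinf w); rewrite leNgt (le_lt_trans hw t0).
have := le_trans hp (limit_vector_small_ball t0); rewrite lee_fin => h.
have {}h : expR (- (7 * (t / (lo * v)))) <= 1 - p by lra.
have : - (7 * (t / (lo * v))) <= ln (1 - p).
  by rewrite -[leLHS]expRK ler_ln ?posrE ?expR_gt0.
rewrite div1r lnV ?posrE// => h1.
have {}h1 : - ln (1 - p) <= 7 * (t / (lo * v)) by lra.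
have : lo * v * - ln (1 - p) <= lo * v * (7 * (t / (lo * v))) by rewrite ler_pM2l.
rewrite (_ : lo * v * (7 * (t / (lo * v))) = 7 * t); first lra.
by field; rewrite ?gt_eqF.
Qed.

End limit_vector.

(** * Saddle point, limit law and quantile bounds *)

(** Comparing the saddle value with the values at [(xs, 0)] and [(0, ys)] gives
[mux / 2 * sqnorm xs <= - (muy / 2 * sqnorm ys)]. *)
Lemma saddle_point_objectiveP (R : realType) (d : nat) (K : 'M[R]_d) (mux muy : R)
    (xs ys : 'cV[R]_d) : 0 < mux -> 0 < muy ->
  saddle_point (objective K mux muy) xs ys <-> xs = 0 /\ ys = 0.
Proof.
move=> mux0 muy0; have sq0 : sqnorm (0 : 'cV[R]_d) = 0 by rewrite /sqnorm dotp0.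
split => [sp|[-> ->] x y].
  have [h1 h2] := sp 0 0; move: h1 h2.
  rewrite /objective sq0 mulmx0 dotp0 dotpC dotp0 => h1 h2.
  have hx : 0 <= mux * sqnorm xs by rewrite mulr_ge0 ?sqnorm_ge0 ?(ltW mux0).
  have hy : 0 <= muy * sqnorm ys by rewrite mulr_ge0 ?sqnorm_ge0 ?(ltW muy0).
  split; apply: sqnorm_eq0; apply/eqP.
    have : mux * sqnorm xs == 0 by rewrite eq_le hx andbT; lra.
    by rewrite mulf_eq0 gt_eqF.
  have : muy * sqnorm ys == 0 by rewrite eq_le hy andbT; lra.
  by rewrite mulf_eq0 gt_eqF.
rewrite /objective sq0 mulmx0 !dotp0 dotpC dotp0.
have hx : 0 <= mux * sqnorm x by rewrite mulr_ge0 ?sqnorm_ge0 ?(ltW mux0).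
have hy : 0 <= muy * sqnorm y by rewrite mulr_ge0 ?sqnorm_ge0 ?(ltW muy0).
by split; lra.
Qed.

Lemma theta_to_1_forall (R : realType) (Q : R * R -> Prop) :
  (forall p theta : R, 0 < p < 1 -> Q (p, theta)) -> \forall u \near theta_to_1, Q u.
Proof.
move=> hQ; exists (`]0, 1[%classic, setT) => /=.
  by split => //; exact: filterT.
by move=> [p theta] /= [hp _]; apply: hQ; move: hp; rewrite in_itv.
Qed.

(** Below, the bounds hold for every theta: [theta_to_1] only confines [p]. *)
Lemma bigO_theta_to_1 (R : realType) (f g : R * R -> R^o) (C : R) : 0 < C ->
  (forall p theta : R, 0 < p < 1 -> `|f (p, theta)| <= C * `|g (p, theta)|) ->
  f =O_theta_to_1 g.
Proof.
move=> C0 h; apply/eqOP; exists C; split; first by rewrite num_real.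
move=> k Ck; apply: theta_to_1_forall => p theta p01.
by apply: le_trans (h _ _ p01) _; rewrite ler_wpM2r// ltW.
Qed.

Section sapd_limit.
Context (R : realType) (d : nat) (K : 'M[R]_d) (mux muy delta : R).
Hypothesis K_sym : K^T = K.
Hypotheses (mux_gt0 : 0 < mux) (muy_gt0 : 0 < muy).

(** The quantifiers matter: [lam] and [Lam] do not depend on theta, and [B] depends
neither on the noise nor on the starting point. *)
Lemma sapd_limit_law : exists theta0 lam Lam : R,
  [/\ 0 < theta0 < 1, 0 < lam, 0 < Lam & forall theta, theta0 < theta < 1 ->
    exists2 B : 'M[R]_(d + d), B^T = B /\
      (forall u, lam * (1 - theta) * sqnorm u <= dotp u (B *m u)
         <= Lam * (1 - theta) * sqnorm u) &
    forall disp (T : measurableType disp) (P : probability T R)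
      (wx wy : nat -> T -> 'cV[R]_d) (x0 y0 : 'cV[R]_d)
      disp' (T' : measurableType disp') (P' : probability T' R)
      (Y : T' -> 'cV[R]_(d + d)),
    gaussian_noise P delta wx wy -> gaussian P' Y 0 ((delta ^+ 2 / d%:R) *: B) ->
    cvg_in_distribution P P'
      (fun n w => sapd_z K mux muy ((1 - theta) / (theta * mux))
         ((1 - theta) / (theta * muy)) theta (wx ^~ w) (wy ^~ w) x0 y0 n) Y].
Proof.
pose a := Num.sqrt mux; pose b := Num.sqrt muy.
have a0 : 0 < a by rewrite sqrtr_gt0.
have b0 : 0 < b by rewrite sqrtr_gt0.
have a2 : a ^+ 2 = mux by rewrite sqr_sqrtr ?ltW.
have b2 : b ^+ 2 = muy by rewrite sqr_sqrtr ?ltW.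
pose N := (a * b)^-1 *: K.
have N_sym : N^T = N by rewrite linearZ/= K_sym.
have KN : K = (a * b) *: N by rewrite scalerA divff ?scale1r// gt_eqF// mulr_gt0.
have [e0 [lam [Lam [e0P lam0 Lam0 hS]]]] := stationary_bounds N_sym a0 b0.
have [c [C [c0 C0 hU]]] := unscale_bounds d a0 b0.
exists (1 - e0), (lam * c ^+ 2), (1 + Lam * C ^+ 2).
have lC : 0 <= Lam * C ^+ 2 by rewrite mulr_ge0 ?sqr_ge0 ?ltW.
split; [by lra|by rewrite mulr_gt0 ?exprn_gt0|by lra|].
have symB (S E U : 'M[R]_(d + d)) : S^T = S ->
    (U *m (S + E *m E^T) *m U^T)^T = U *m (S + E *m E^T) *m U^T.
  by move=> S_sym; rewrite !trmx_mul trmxK linearD/= trmx_mul trmxK S_sym mulmxA.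
have dotpB (u : 'cV[R]_(d + d)) (M U : 'M[R]_(d + d)) :
    dotp u (U *m M *m U^T *m u) = dotp (U^T *m u) (M *m (U^T *m u)).
  by rewrite -!mulmxA dotp_mulmx.
move=> theta thP; pose e := 1 - theta.
have eP : 0 < e <= e0 by rewrite /e; lra.
have [D_le [S [S_sym S_cvg S_bnd]]] := hS e eP.
set U := unscale d a b in hU.
set E0 := noise_now N a b e in S_bnd.
exists (U *m (S + E0 *m E0^T) *m U^T).
  split; first by rewrite symB.
  move=> u; rewrite dotpB.
  have /andP[h1 h2] := S_bnd (U^T *m u); have /andP[u1 u2] := hU u.
  have nu := nrm_ge0 u; have e_gt0 : 0 < e by case/andP: eP.
  have q1 : c ^+ 2 * sqnorm u <= sqnorm (U^T *m u).
    rewrite -!sqr_nrm -exprMn lerXn2r ?nnegrE ?nrm_ge0//.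
    by rewrite mulr_ge0// ltW.
  have q2 : sqnorm (U^T *m u) <= C ^+ 2 * sqnorm u.
    by rewrite -!sqr_nrm -exprMn lerXn2r ?nnegrE ?nrm_ge0 ?mulr_ge0.
  have k1 := ler_wpM2l (mulr_ge0 (ltW lam0) (ltW e_gt0)) q1.
  have k2 := ler_wpM2l (mulr_ge0 (ltW Lam0) (ltW e_gt0)) q2.
  have k3 : 0 <= e * sqnorm u by rewrite mulr_ge0 ?sqnorm_ge0 ?ltW.
  by rewrite -/e; apply/andP; split; lra.
move=> disp T P wx wy x0 y0 disp' T' P' Y noise gY.
pose Z n w := let st := sapd K (a ^+ 2) (b ^+ 2) ((1 - (1 - e)) / ((1 - e) * a ^+ 2))
    ((1 - (1 - e)) / ((1 - e) * b ^+ 2)) (1 - e) (wx ^~ w) (wy ^~ w) x0 y0 n in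
  col_mx (a *: st.1.1) (b *: st.1.2).
have /andP[e_gt0 e_le] := eP; have e_lt1 : e < 1 by lra.
have thE : theta = 1 - e by rewrite /e opprB addrC subrK.
have zE : (fun n w => sapd_z K mux muy ((1 - theta) / (theta * mux))
    ((1 - theta) / (theta * muy)) theta (wx ^~ w) (wy ^~ w) x0 y0 n)
    = (fun n w => U *m Z n w).
  apply/funext => n; apply/funext => w; rewrite thE -a2 -b2.
  exact: sapd_zE.
rewrite zE; apply: (@ma_cvg_in_distribution _ _ _ _ _ _ _ _ _ _ _ noise _ _
  (drift N e) E0 (noise_late N a b e) (noise_first N a b e)
  (first_mean N e (a *: x0) (b *: y0)) Z (1 - e / 2) _ _ _ D_le S U Y S_cvg gY).
- move=> w; exact: sapd_first.
- move=> k w; exact: sapd_step.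
- by apply/andP; split; lra.
Qed.

End sapd_limit.

Theorem theorem12 (R : realType) (d : nat) (K : 'M[R]_d) (mux muy delta : R)
    (d_gt0 : (0 < d)%N) (K_sym : K^T = K)
    (mux_gt0 : 0 < mux) (muy_gt0 : 0 < muy) (delta_gt0 : 0 < delta) :
  (forall xs ys : 'cV[R]_d,
     saddle_point (objective K mux muy) xs ys <-> xs = 0 /\ ys = 0) /\
  exists (theta0 : R) (psi1 psi2 : R -> R -> R) (h1 h2 : R * R -> R^o),
    [/\ 0 < theta0 < 1,
        [/\ h1 =O_theta_to_1 (cst 1 : R * R -> R^o),
            (cst 1 : R * R -> R^o) =O_theta_to_1 h1,
            forall p theta : R, 0 < p < 1 -> 0 < theta < 1 -> 0 <= psi1 p theta
          & forall p theta : R, 0 < p < 1 -> 0 < theta < 1 ->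
              psi1 p theta = (1 - theta) * ln (1 / (1 - p)) * h1 (p, theta)],
        h2 =O_theta_to_1
          ((fun u => 1 + ln (1 / (1 - u.1))) : R * R -> R^o),
        forall p theta : R, 0 < p < 1 -> 0 < theta < 1 ->
          psi2 p theta = (1 - theta) * h2 (p, theta)
      & forall theta : R, theta0 < theta < 1 ->
        forall (disp : measure_display) (T : measurableType disp)
          (P : probability T R) (wx wy : nat -> T -> 'cV[R]_d)
          (x0 y0 : 'cV[R]_d),
        gaussian_noise P delta wx wy ->
        let tau := (1 - theta) / (theta * mux) in
        let sigma := (1 - theta) / (theta * muy) in
        let z := fun n w => sapd_z K mux muy tau sigma theta
                              (wx ^~ w) (wy ^~ w) x0 y0 n in
        let zs : 'cV[R]_(d + d) := col_mx 0 0 in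
        exists (disp' : measure_display) (T' : measurableType disp')
          (P' : probability T' R) (zinf : T' -> 'cV[R]_(d + d)),
          [/\ exists m S, gaussian P' zinf m S,
              cvg_in_distribution P P' z zinf
            & forall p : R, 0 < p < 1 ->
                psi1 p theta
                <= quantile P' p (fun w => sqnorm (zinf w - zs))
                <= psi2 p theta]].
Proof.
split; first by move=> xs ys; exact: saddle_point_objectiveP.
have [theta0 [lam [Lam [th0 lam0 Lam0 law]]]] :=
  sapd_limit_law delta K_sym mux_gt0 muy_gt0.
pose v := delta ^+ 2 / d%:R.
have v0 : 0 < v by rewrite divr_gt0 ?exprn_gt0// ltr0n.
pose c1 := lam * v / 7; have c1_gt0 : 0 < c1 by rewrite divr_gt0// (mulr_gt0 lam0 v0).
pose q : R := (d + d)%:R.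
have q1 : 1 <= q by rewrite ler1n addn_gt0 d_gt0.
pose c2 := q * (v * Lam * (4 * (1 + ln (2 * q)))).
have lnq : 0 <= ln (2 * q) by rewrite ln_ge0//; lra.
have q0 : 0 < q by lra.
have k0 : 0 < 4 * (1 + ln (2 * q)) by lra.
have c2_gt0 : 0 < c2 by exact: (mulr_gt0 q0 (mulr_gt0 (mulr_gt0 v0 Lam0) k0)).
have ell_ge0 (p : R) : 0 < p < 1 -> 0 <= ln (1 / (1 - p)).
  by move=> /andP[p0 p1]; rewrite ln_ge0// ler_pdivlMr//; lra.
exists theta0, (fun p theta => (1 - theta) * ln (1 / (1 - p)) * c1),
  (fun p theta => (1 - theta) * (c2 * (1 + ln (1 / (1 - p))))),
  (fun=> c1), (fun u => c2 * (1 + ln (1 / (1 - u.1)))).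
split => //.
- split => //.
  + apply: (@bigO_theta_to_1 _ _ _ c1) => // p theta _ /=.
    by rewrite normr1 mulr1 gtr0_norm.
  + apply: (@bigO_theta_to_1 _ _ _ c1^-1) => [|p theta _ /=]; first by rewrite invr_gt0.
    by rewrite normr1 gtr0_norm// mulVf// gt_eqF.
  + move=> p theta p01 /andP[_ th1].
    have e0 : 0 <= 1 - theta by lra.
    exact: (mulr_ge0 (mulr_ge0 e0 (ell_ge0 _ p01)) (ltW c1_gt0)).
- apply: (@bigO_theta_to_1 _ _ _ c2) => // p theta p01 /=.
  by rewrite normrM gtr0_norm.
move=> theta thP disp T P wx wy x0 y0 noise tau sigma z zs.
have [B [B_sym B_bnd] cvgB] := law theta thP.
have e0 : 0 < 1 - theta by lra.
have lo0 : 0 < lam * (1 - theta) by rewrite mulr_gt0.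
have B_ge u : lam * (1 - theta) * sqnorm u <= dotp u (B *m u) by case/andP: (B_bnd u).
have [L LB] := cholesky lo0 B_sym B_ge.
pose zinf w := L *m col_mx (wx 0%N w) (wy 0%N w).
have gz : gaussian P zinf 0 (v *: B) := gaussian_limit_vector noise B_sym LB.
exists disp, T, P, zinf; split.
- by exists 0, (v *: B).
- exact: cvgB noise gz.
move=> p p01.
have -> : (fun w => sqnorm (zinf w - zs)) = (fun w => sqnorm (zinf w)).
  by apply/funext => w; rewrite /zs col_mx0 subr0.
apply: quantile_between.
  move=> t /(limit_vector_quantile_ge d_gt0 delta_gt0 noise lo0 B_sym B_ge LB p01).
  by apply: le_trans; rewrite -/v /c1; lra.
have dd : (0 < d + d)%N by rewrite addn_gt0 d_gt0.
have hi0 : 0 <= v * (Lam * (1 - theta)) by exact: (mulr_ge0 (ltW v0) (mulr_ge0 (ltW Lam0) (ltW e0))).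
have S_le u : dotp u ((v *: B) *m u) <= v * (Lam * (1 - theta)) * sqnorm u.
  by rewrite -scalemxAl dotpZr -mulrA ler_pM2l//; case/andP: (B_bnd u).
have := gaussian_sqnorm_quantile_le dd p01 gz hi0 S_le.
rewrite (_ : _ * (_ * (4 * _ * _)) = (1 - theta) * (c2 * (1 + ln (1 / (1 - p)))))//.
by rewrite /c2 -/q; ring.
Qed.
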